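(* Let $F_0$ be a distribution on $\mathbb{R}_+$ with density $f_0$ and mean $1$, with associated age distribution $F$, hazard rate $\eta$, and observed hazard rate distributions $G$ (non-synchronized) and $G_0$ (synchronized). For each $N$, consider a local memory system with $N$ items, memory size $C_N$ (an integer, $1\le C_N<N$), and independent stationary renewal request processes $\Phi_1,\dots,\Phi_N$ with intensities $\lambda_1^{(N)}\ge\dots\ge\lambda_N^{(N)}>0$, where $\Phi_i$ has inter-arrival distribution $F_0(\lambda_i^{(N)}t)$. Assume: (i) $L_N(\lambda):=\frac1N\sum_{i=1}^N\mathbf{1}_{\{\lambda_i^{(N)}\le\lambda\}}$ converges weakly to a probability distribution $L$ with no atom at $0$; (ii) for each $N\ge1$ and $1\le i\ne j\le N$, $P^0_\Phi(X_i^{(N)}=X_j^{(N)})=0$, where $X_i^{(N)}$ are the observed hazard rates at time $0$ and $\Phi=\sum_{i=1}^N\Phi_i$. Suppose $\{L_N\}_{N\ge1}$ is uniformly integrable. Let $G_\infty(x)=\int_0^\infty G(x/\lambda)L(d\lambda)$ and let $Q_\infty$ be its quantile function. Let $c\in(0,1]$ be such that $1-c$ is a continuity point of $Q_\infty$ and that $\theta^*:=Q_\infty(1-c)\notin D_L\cdot D_{G_0}$. If $C_N/N\to c$ as $N\to\infty$, then the miss probability $M^{(N)}_{\mathcal{C}^*}$ of the optimal causal policy $\mathcal{C}^*$ satisfies $$\lim_{N\to\infty}M^{(N)}_{\mathcal{C}^*}=\frac{\int_0^\infty\lambda\,G_0\!\left(\frac{\theta^*}{\lambda}\right)L(d\l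ambda)}{\int_0^\infty\lambda\,L(d\lambda)}.$$
   Context: Framework: $(\Omega,\mathcal{F},P)$ carries a measurable flow $\{\vartheta_t\}$ preserving $P$, and stationarity means compatibility with the flow. The Palm probability of a stationary point process $\Phi$ of intensity $\lambda=\mathrm{E}[\Phi((0,1])]$ is $P^0_\Phi(A)=\frac1\lambda\mathrm{E}[\int_{(0,1]}\mathbf{1}_A(\vartheta_s\omega)\Phi(ds)]$. A stationary renewal process is a stationary simple point process whose inter-arrival times are i.i.d. under its Palm probability. Base distributions: $F(t)=\int_0^t(1-F_0(s))ds$, $\eta(t)=f_0(t)/(1-F_0(t))$, $G(x)=\int_{\eta^{-1}([0,x])}F(dt)$, $G_0(x)=\int_{\eta^{-1}([0,x])}F_0(dt)$. Observed hazard rates: $\eta_i(t)=\lambda_i^{(N)}\eta(\lambda_i^{(N)}t)$ is the hazard rate of the $i$-th process, $\tau_i^-(t)$ is the last point of $\Phi_i$ strictly before $t$, the stochastic intensity of $\Phi_i$ with respect to its natural history is $\lambda_i(t)=\eta_i(t-\tau_i^-(t))$, and $X_i^{(N)}=\lambda_i(0)$. Optimal policy and miss probability: the storage policy $\mathcal{C}^*$ stores at every time $t$ the $C_N$ items with the largest values of $\lambda_i(t)$ (ties broken by an arbitrary deterministic rule). With $\lambda^N=\sum_{i=1}^N\lambda_i^{(N)}$ and hit process $\Psi_{\mathcal{C}^*}(B)=\sum_{i=1}^N\int_B\mathbf{1}_{\{i\in\mathcal{C}^*(t)\}}\Phi_i(dt)$, the miss probability is $M^{(N)}_{\mathcal{C}^*}=1-P^0_\Phi(\Psi_{\mathcal{C}^*}(\{0\})=1)=\sum_{i=1}^N\frac{\lambda_i^{(N)}}{\lambda^N}P^0_{\Phi_i}(i\notin\mathcal{C}^*(0))$.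 $\{L_N\}$ is uniformly integrable if for every $\epsilon>0$ there is $K\ge0$ with $\sup_{N\ge1}\frac1N\sum_{i:\,\lambda_i^{(N)}\ge K}\lambda_i^{(N)}\le\epsilon$. $Q_\infty(p)=\inf\{x\ge0:G_\infty(x)\ge p\}$, $p\in[0,1]$. $D_L$ and $D_{G_0}$ are the sets of discontinuity points of $L$ and $G_0$, and $D_L\cdot D_{G_0}=\{\lambda x:\lambda\in D_L,\ x\in D_{G_0}\}$. *)

(* Defs.v *)
(* Written with MathComp-Analysis. *)
From HB Require Import structures.
From mathcomp Require Export all_boot all_order all_algebra.
From mathcomp Require Export all_classical all_reals all_analysis measurable_realfun.

Set Implicit Arguments.
Unset Strict Implicit.
Unset Printing Implicit Defensive.

Import Order.TTheory GRing.Theory Num.Theory.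
Import numFieldNormedType.Exports.

Local Open Scope classical_set_scope.
Local Open Scope ring_scope.

Section distributions.
Context {R : realType}.
Implicit Type mu : probability R R.

Definition distr_fun mu (t : R) : R := fine (mu `]-oo, t]%classic).

Definition is_density mu (f0 : R -> R) : Prop :=
  [/\ measurable_fun [set: R] f0, forall x, 0 <= f0 x &
      forall A, measurable A ->
        mu A = (\int[lebesgue_measure]_(x in A) (f0 x)%:E)%E].

(* The junk value 0 (division by 0) is taken only where F_0(t) = 1, a set which
   is null for F_0 (it has a density) and for the age law below. *)
Definition hazard_rate mu (f0 : R -> R) (t : R) : R := f0 t / (1 - distr_fun mu t).

(* F(dt) = (1 - F_0(t)) dt on [0, +oo[; total mass 1 when F_0 has mean 1. *)
Definition age_law mu (A : set R) : \bar R :=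
  (\int[lebesgue_measure]_(s in (A `&` `[0, +oo[%classic)%R)
     (1 - distr_fun mu s)%:E)%E.

(* x |-> nu (eta^-1 [0, x]): this is G for nu the age law, G_0 for nu = F_0. *)
Definition hazard_distr (nu : set R -> \bar R) (eta : R -> R) (x : R) : R :=
  fine (nu (eta @^-1` `[0, x])).

(* G_oo(x) = \int_0^oo G(x / l) L(dl) *)
Definition mixture_distr (G : R -> R) (L : probability R R) (x : R) : R :=
  \int[L]_(l in `]0, +oo[) G (x / l).

(* Equal to +oo when G stays below p, which can happen at p = 1. *)
Definition quantile (G : R -> R) (p : R) : \bar R :=
  ereal_inf [set x%:E | x in [set x : R | 0 <= x /\ p <= G x]].

Definition discontinuities (f : R -> R) : set R :=
  [set x | ~ {for x, continuous f}].

Definition empirical_distr N (lam : 'I_N -> R) (x : R) : R :=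
  N%:R^-1 * \sum_(i < N) (lam i <= x)%R%:R.

Definition weakly_converges (F_ : nat -> R -> R) (L : probability R R) : Prop :=
  forall x, {for x, continuous (distr_fun L)} ->
    F_ N x @[N --> \oo] --> distr_fun L x.

Definition unif_integrable (lam : forall N, 'I_N -> R) : Prop :=
  forall eps : R, 0 < eps -> exists2 K : R, 0 <= K &
    forall N, (0 < N)%N ->
      N%:R^-1 * \sum_(i < N | K <= lam N i) lam N i <= eps.

End distributions.

Section points.
Context {R : realType}.
Implicit Type m : {measure set R -> \bar R}.

Definition last_point_before m (t : R) : R :=
  sup [set s | s < t /\ (0 < m [set s])%E].

Definition next_point_after m (t : R) : R :=
  inf [set s | t < s /\ (0 < m [set s])%E].

(* The points of m in increasing order ... < T_-1 < T_0 <= 0 < T_1 < ..., when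
   they are unbounded on both sides. *)
Definition point m (n : int) : R :=
  let T0 := sup [set s | s <= 0 /\ (0 < m [set s])%E] in
  match n with
  | Posz k => iter k (next_point_after m) T0
  | Negz k => iter k.+1 (last_point_before m) T0
  end.

Definition inter_arrival m (n : int) : R := point m (n + 1) - point m n.

Definition scaled_hazard (eta : R -> R) (l t : R) : R := l * eta (l * t).

Definition stoch_intensity (eta : R -> R) (l : R) m (t : R) : R :=
  scaled_hazard eta l (t - last_point_before m t).

End points.

Section point_processes.
Context {R : realType} {d : measure_display} {Omega : measurableType d}.
Variable P : probability Omega R.
Variable theta : R -> Omega -> Omega.

Definition preserving_flow : Prop :=
  [/\ theta 0 = id,
      forall s t, theta (s + t) = theta s \o theta t,
      measurable_fun [set: R * Omega] (fun p => theta p.1 p.2) &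
      forall t A, measurable A -> P (theta t @^-1` A) = P A].

Definition is_point_process (Phi : R.-ker Omega ~> R) : Prop :=
  forall w (a b : R) (B : set R), measurable B -> B `<=` `[a, b] ->
    exists n : nat, Phi w B = n%:R%:E.

(* Phi (theta_t w) (B) = Phi w (B + t) *)
Definition flow_compatible (Phi : R.-ker Omega ~> R) : Prop :=
  forall t w (B : set R), measurable B -> Phi (theta t w) B = Phi w [set s | B (s - t)].

Definition is_simple (Phi : R.-ker Omega ~> R) : Prop :=
  {ae P, forall w, forall x : R, (Phi w [set x] <= 1)%E}.

Definition intensity (Phi : Omega -> {measure set R -> \bar R}) : \bar R :=
  (\int[P]_w Phi w `]0%R, 1%R]%classic)%E.

Definition palm (Phi : Omega -> {measure set R -> \bar R}) (A : set Omega) :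
    \bar R :=
  ((intensity Phi)^-1 *
   \int[P]_w \int[Phi w]_(s in `]0%R, 1%R]%classic) (\1_A (theta s w))%:E)%E.

Definition independent_family (Q : set Omega -> \bar R)
    (X : int -> Omega -> R) : Prop :=
  forall (s : seq int) (B : int -> set R), uniq s ->
    (forall n, measurable (B n)) ->
    Q [set w | forall n, n \in s -> B n (X n w)] =
    (\prod_(n <- s) Q (X n @^-1` B n))%E.

(* Stationary renewal process whose inter-arrival times have distribution
   function H under its Palm probability. *)
Definition stationary_renewal (Phi : R.-ker Omega ~> R) (H : R -> R) : Prop :=
  [/\ is_point_process Phi, flow_compatible Phi, is_simple Phi,
      independent_family (palm Phi) (fun n w => inter_arrival (Phi w) n) &
      forall n t,
        palm Phi [set w | inter_arrival (Phi w) n <= t] = (H t)%:E].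

Definition pp_sigma_algebra (Phi : R.-ker Omega ~> R) : set (set Omega) :=
  <<s [set E | exists (B : set R) (Y : set (\bar R)),
             [/\ measurable B, measurable Y &
                 E = (fun w => Phi w B) @^-1` Y]] >>.

Definition independent_processes N (Phi : 'I_N -> R.-ker Omega ~> R) : Prop :=
  forall A : 'I_N -> set Omega, (forall i, pp_sigma_algebra (Phi i) (A i)) ->
    P [set w | forall i, A i w] = (\prod_(i < N) P (A i))%E.

Section superposition.
Context {N : nat}.
Variables (Phi : 'I_N -> R.-ker Omega ~> R) (w : Omega).

Definition superposition (B : set R) : \bar R := (\sum_(i < N) Phi i w B)%E.

Let superposition0 : superposition set0 = 0%E.
Proof. by rewrite /superposition big1. Qed.

Let superposition_ge0 B : (0 <= superposition B)%E.
Proof. by rewrite /superposition; apply: sume_ge0. Qed.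

Let superposition_sigma_additive : semi_sigma_additive superposition.
Proof.
move=> F mF tF mUF; rewrite [X in _ --> X](_ : _ =
    limn (fun n => \sum_(0 <= i < n) superposition (F i))%E).
  by apply: is_cvg_ereal_nneg_natsum => k _; exact: sume_ge0.
rewrite nneseries_sum//; apply: eq_bigr => /= i _.
exact: measure_semi_bigcup.
Qed.

HB.instance Definition _ := isMeasure.Build _ _ _ superposition
  superposition0 superposition_ge0 superposition_sigma_additive.

End superposition.

Definition superpose N (Phi : 'I_N -> R.-ker Omega ~> R) (w : Omega) :
  {measure set R -> \bar R} := superposition Phi w.

Definition hit_process N (Phi : 'I_N -> R.-ker Omega ~> R)
    (C : R -> Omega -> {set 'I_N}) (w : Omega) (B : set R) : \bar R :=
  (\sum_(i < N) \int[Phi i w]_(t in B) (i \in C t w)%:R%:E)%E.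

Definition miss_probability N (Phi : 'I_N -> R.-ker Omega ~> R)
    (C : R -> Omega -> {set 'I_N}) : R :=
  1 - fine (palm (superpose Phi)
              [set w | hit_process Phi C w [set 0] = 1%E]).

(* A rule turning the vector of current values into a set of k items with the
   largest values; it embodies the deterministic tie-breaking. *)
Definition selects_largest N (k : nat) (rule : ('I_N -> R) -> {set 'I_N}) :
    Prop :=
  forall v, #|rule v| = k /\
    forall i j, i \in rule v -> j \notin rule v -> v j <= v i.

Definition optimal_policy N (eta : R -> R) (lam : 'I_N -> R)
    (Phi : 'I_N -> R.-ker Omega ~> R) (rule : ('I_N -> R) -> {set 'I_N})
    (t : R) (w : Omega) : {set 'I_N} :=
  rule (fun i => stoch_intensity eta (lam i) (Phi i w) t).

End point_processes.

(* Main.v *)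
(* Fix a level x. The number of items whose intensity at time 0 exceeds x is a
   sum of independent indicators with mean the sum of the 1 - G(x / lambda_i),
   which is close to N (1 - G_oo(x)). Under the Palm probability of item i the
   other processes keep their stationary law, so the same holds there up to one
   item, and by Chebyshev's inequality this number is below C_N if x > theta^*
   and above C_N if x < theta^*. In the first case a request for an item of
   intensity above x is a hit, in the second a request for an item of intensity
   at most x is a miss. As the intensity of item i at one of its points has
   distribution G_0( . / lambda_i), the miss probability lies asymptotically
   between the averages of lambda_i G_0(x / lambda_i), divided by that of the
   lambda_i, for x on either side of theta^*. These averages converge, up to an
   arbitrarily small change of x, by comparing lambda with a geometric grid of
   continuity points of L; uniform integrability controls the large lambda_i.
   Finally x |-> \int lambda G_0(x / lambda) L(d lambda) is continuous at
   theta^*, on the left because theta^* is not in D_L . D_{G_0}.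

   The stationary age of a renewal process has law F since the probability of a
   point in [-a, 0) has, by the Palm formula, increments governed by the Palm
   probability 1 - F_0 of an empty interval before a point. *)

(* Two difficulties shape the proof. The selection rule is an arbitrary function, so the hit event
   need not be measurable; it is only bracketed by measurable events, which suffices because [palm]
   is monotone on all sets. The last and next points are a supremum and an infimum over atoms, with
   default value 0 when there is none; each computation with them therefore sets aside a null event,
   and atoms are recovered from the mass of intervals because the measures are integer valued on
   bounded sets. Palm statements are reduced to a window []0, 1/(n+1)]]: by stationarity the mean
   number of points there that carry a given mark is [lam/(n+1)] times the Palm probability of the
   mark. Letting n grow yields the age law without any differentiation. It also yields the law of
   the other processes seen from a point of process i, since a shift within the window moves the
   endpoints of their intervals by at most [1/(n+1)]. Since averages converge only up to a change of
   level, three nested levels are used on each side of [thetastar]. *)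
Require Import Defs.
From HB Require Import structures.
From mathcomp Require Import ring lra.
Import Order.TTheory GRing.Theory Num.Theory.
Import numFieldNormedType.Exports.
Local Open Scope classical_set_scope.
Local Open Scope ring_scope.

Set Implicit Arguments.
Unset Strict Implicit.
Unset Printing Implicit Defensive.

(* [lra] fails on contexts with inequalities in the extended reals. *)
Ltac real_lra :=
  repeat match goal with
  | H : is_true (@Order.lt ereal_display _ _ _) |- _ => clear H
  | H : is_true (@Order.le ereal_display _ _ _) |- _ => clear H
  end; lra.

(** * Atoms of integer-valued measures *)

Section integer_valued.
Context {R : realType}.
Implicit Type m : {measure set R -> \bar R}.

Definition integer_valued m := forall (a b : R) (B : set R),
  measurable B -> B `<=` `[a, b] -> exists n : nat, m B = n%:R%:E.

(** The function [t |-> m (B & ]-oo, t])] is nondecreasing with integer values, so it jumps from 0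
    to at least 1 at the supremum x of its zero set, and the jump is the mass of [B] at x. *)
Lemma integer_valued_atom m (a b : R) (B : set R) : integer_valued m ->
  measurable B -> B `<=` `[a, b] -> (0 < m B)%E ->
  exists2 x, B x & (0 < m [set x])%E.
Proof.
move=> im mB Bab mB0.
have mBt t : measurable (B `&` `]-oo, t]) by exact: measurableI.
have Bsub t : B `&` `]-oo, t] `<=` `[a, b] by move=> y [/Bab].
pose S := [set t | m (B `&` `]-oo, t]) = 0%E].
have Sa : S (a - 1).
  rewrite /S /= (_ : _ `&` _ = set0) ?measure0// -subset0 => y [/Bab].
  by rewrite /= !in_itv/= => /andP[ay _] ya; real_lra.
have Sub : ubound S b.
  move=> t St; rewrite leNgt; apply/negP => bt; move: mB0; rewrite -St.
  rewrite (_ : B `&` _ = B) ?ltxx//; apply/seteqP; split => [y []//|y By].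
  by split => //; move: (Bab _ By); rewrite /= !in_itv/= => /andP[_ yb]; real_lra.
have hS : has_sup S by split; [exists (a - 1)|exists b].
pose x := sup S.
have lex t : t < x -> m (B `&` `]-oo, t]) = 0%E.
  move=> tx; have [s Ss ts] := sup_adherent (eps := x - t) ltac:(by rewrite subr_gt0) hS.
  apply/eqP; rewrite eq_le measure_ge0 andbT -Ss le_measure// ?inE//.
  by apply: setIS => y; rewrite /= !in_itv/= -/x in ts *; move=> ?; real_lra.
have ltx t : x < t -> (1 <= m (B `&` `]-oo, t]))%E.
  move=> xt; have [n mn] := im a b _ (mBt t) (@Bsub t).
  rewrite mn; case: n mn => [mn|n _]; last by rewrite lee_fin ler1n.
  by have := ub_le_sup hS.2 (mn : S t); rewrite leNgt xt.
have mlt : m (B `&` `]-oo, x[) = 0%E.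
  apply: measure_negligible; first exact: measurableI.
  apply: (@negligibleS _ _ _ _
      (\bigcup_n (B `&` `]-oo, (x - n.+1%:R^-1)%R]))); last first.
    apply: negligible_bigcup => k; apply/negligibleP => //.
    by apply: lex; rewrite ltrBlDr ltrDl invr_gt0.
  move=> y [By]; rewrite /= in_itv/= => yx.
  have /ltr_add_invr[k] : y < x by [].
  by move=> kx; exists k => //; split => //; rewrite /= in_itv/= lerBrDr ltW.
(* Continuity from above: the bound 1, valid at every point to the right of x, survives the limit.
   Mere positivity would not. *)
have mle : (1 <= m (B `&` `]-oo, x]))%E.
  have -> : B `&` `]-oo, x] = \bigcap_n (B `&` `]-oo, (x + n.+1%:R^-1)%R]).
    apply/seteqP; split => y /=.
      move=> [By]; rewrite in_itv/= => yx n _; split => //=.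
      by rewrite in_itv/= (le_trans yx)// lerDl invr_ge0.
    move=> h; split; first by have [] := h 0%N I.
    rewrite in_itv/= leNgt; apply/negP => /ltr_add_invr[k xk].
    by have [_] := h k I; rewrite /= in_itv/= leNgt xk.
  have cv := @nonincreasing_cvg_mu _ _ _ m
    (fun n => B `&` `]-oo, (x + n.+1%:R^-1)%R]).
  rewrite -(cvg_lim _ (cv _ _ _ _))//; last 3 first.
  - have [n ->] := im a b _ (mBt (x + 1^-1)) (@Bsub _); exact: ltry.
  - exact: bigcapT_measurable.
  - move=> i j ij; apply/subsetPset; apply: setIS => y /=.
    rewrite !in_itv/= => /le_trans; apply; rewrite lerD2l.
    by rewrite lef_pV2 ?posrE// ler_nat.
  apply: lime_ge; first by apply/cvg_ex; eexists; apply: cv => //;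
    [have [n ->] := im a b _ (mBt (x + 1^-1)) (@Bsub _); exact: ltry
    |exact: bigcapT_measurable
    |move=> i j ij; apply/subsetPset; apply: setIS => y /=;
     rewrite !in_itv/= => /le_trans; apply; rewrite lerD2l
       lef_pV2 ?posrE// ler_nat].
  by apply: nearW => n /=; apply: ltx; rewrite ltrDl invr_gt0.
have Ex : B `&` `]-oo, x] = (B `&` `]-oo, x[) `|` (B `&` [set x]).
  rewrite -setIUr; congr setI; apply/seteqP; split => y /=; rewrite !in_itv/=.
    by rewrite le_eqVlt => /orP[/eqP ->|]; [right|left].
  by case => [/ltW|->].
have mx : (1 <= m (B `&` [set x]))%E.
  have mU : m (B `&` `]-oo, x]) =
      (m (B `&` `]-oo, x[) + m (B `&` [set x]))%E.
    rewrite Ex measureU//; [exact: measurableI..|].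
    rewrite -subset0 => y [[_]] /=; rewrite in_itv/= => + [_ yx].
    by rewrite yx ltxx.
  by move: mle; rewrite mU mlt add0e.
have Bx : B x.
  apply: contrapT => Bx; move: mx; rewrite (_ : _ `&` _ = set0).
    by rewrite measure0 lee_fin ler10.
  by rewrite -subset0 => y [By yx]; apply: Bx; rewrite -yx.
exists x => //; apply: (@lt_le_trans _ _ (m (B `&` [set x]))).
  by apply: lt_le_trans mx; rewrite lte01.
by rewrite le_measure ?inE//; exact: measurableI.
Qed.

(** Strong induction on the integer [m B]: either nothing lies to the right of an atom x, or the
    part of [B] to the right of x has mass strictly smaller, since x itself is left out. *)
Lemma integer_valued_last_atom m (a b : R) (B : set R) : integer_valued m ->
  measurable B -> B `<=` `[a, b] -> (0 < m B)%E ->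
  exists x, [/\ B x, (0 < m [set x])%E & m (B `&` `]x, +oo[) = 0%E].
Proof.
move=> im mB0 Bab0; have [n mBn] := im _ _ _ mB0 Bab0.
elim/ltn_ind: n B mB0 Bab0 mBn => n IH B mB Bab mBn mB0.
have [x Bx x0] := integer_valued_atom im mB Bab mB0.
have mBx : measurable (B `&` `]x, +oo[) by exact: measurableI.
have Bxab : B `&` `]x, +oo[ `<=` `[a, b] by move=> y [/Bab].
have [k mk] := im _ _ _ mBx Bxab.
have [m0|m0] := eqVneq (m (B `&` `]x, +oo[)) 0%E; first by exists x.
have kn : (k < n)%N.
  rewrite -(ltr_nat R) -lte_fin -mk -mBn.
  have -> : m B = (m (B `&` `]x, +oo[) + m (B `\` `]x, +oo[))%E.
    by rewrite addeC -measureDI.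
  rewrite mk lteDl//; apply: lt_le_trans x0 _.
  rewrite le_measure ?inE//; first exact: measurableD.
  by move=> _ ->; split => //=; rewrite in_itv/= ltxx.
have [|y [[By xy] y0 my]] := IH _ kn _ mBx Bxab mk; first by rewrite lt0e m0/=.
exists y; split => //; rewrite -my; congr (m _); apply/seteqP; split => z /=.
  move=> [Bz]; rewrite !in_itv/= !andbT => yz; split => //; split => //.
  by rewrite /= in_itv/= andbT in xy; apply: lt_trans yz.
by move=> [[]].
Qed.

Lemma integer_valued_null_atoms m (a b : R) (B : set R) : integer_valued m ->
  measurable B -> B `<=` `[a, b] ->
  (forall x, B x -> m [set x] = 0%E) -> m B = 0%E.
Proof.
move=> im mB Bab h; apply/eqP; rewrite eq_le measure_ge0 andbT leNgt.
apply/negP => /(integer_valued_atom im mB Bab)[x Bx].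
by rewrite h ?ltxx.
Qed.

End integer_valued.

(** * Palm probabilities *)

Section point_process.
Context {R : realType} {d : measure_display} {Omega : measurableType d}.
Variable P : probability Omega R.
Variable theta : R -> Omega -> Omega.
Hypothesis flow : preserving_flow P theta.

Lemma measurable_flow (t : R) : measurable_fun [set: Omega] (theta t).
Proof.
have [_ _ mth _] := flow.
exact: (measurableT_comp mth (pair1_measurable t)).
Qed.

Lemma measurable_flow_event (A : set Omega) : measurable A ->
  measurable [set p : Omega * R | A (theta p.2 p.1)].
Proof.
move=> mA; have [_ _ mth _] := flow.
have m1 := measurableT_comp mth (@measurable_swap _ _ Omega R).
by have := m1 measurableT _ mA; rewrite setTI.
Qed.

Lemma measurable_flow_times (A : set Omega) (w : Omega) : measurable A ->
  measurable [set s | A (theta s w)].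
Proof.
move=> /measurable_flow_event/(measurable_xsection w).
by rewrite /xsection; under eq_set do rewrite inE.
Qed.

Section one_process.
Variable Phi : R.-ker Omega ~> R.
Hypothesis pp : is_point_process Phi.

Lemma point_process_integer w : integer_valued (Phi w).
Proof. by move=> a b B; exact: pp. Qed.

(** Measurability of sections requires a finite bound over all measurable sets for each outcome,
    while [Phi w] is finite on bounded sets only; restricting it to [I] supplies the bound. *)
Lemma measurable_fun_kernel_section (a b : R) (I : set R)
    (E : set (Omega * R)) : measurable I -> I `<=` `[a, b] -> measurable E ->
  measurable_fun [set: Omega] (fun w => Phi w (I `&` xsection E w)).
Proof.
move=> mI Iab mE.
have h w : exists M : R, forall X : set R, measurable X ->
    (mrestr (Phi w) mI X < M%:E)%E.
  have [n Hn] := pp w mI Iab; exists (n%:R + 1) => X mX.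
  apply: (@le_lt_trans _ _ (Phi w I)).
    by rewrite /mrestr le_measure ?inE//; exact: measurableI.
  by rewrite Hn lte_fin ltrDl.
have [_] := measurable_prod_subset_xsection_kernel h mE.
by apply: eq_measurable_fun => w _; rewrite /mrestr setIC.
Qed.

(** The number of points s of [Phi w] in [B] from which the shifted outcome has the property [A]. *)
Definition marked (B : set R) (A : set Omega) (w : Omega) : \bar R :=
  Phi w (B `&` [set s | A (theta s w)]).

Lemma measurable_marked (a b : R) (B : set R) (A : set Omega) : measurable B ->
  B `<=` `[a, b] -> measurable A -> measurable_fun [set: Omega] (marked B A).
Proof.
move=> mB Bab mA.
have := measurable_fun_kernel_section mB Bab (measurable_flow_event mA).
apply: eq_measurable_fun => w _; rewrite /marked; congr (Phi w (_ `&` _)).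
by apply/seteqP; split => s; rewrite /xsection /= inE.
Qed.

(** The Campbell measure of [B] and [A]; for the unit window it is the Palm measure before
    normalization. *)
Definition campbell (B : set R) (A : set Omega) : \bar R :=
  \int[P]_w marked B A w.

Lemma marked_ge0 B A w : (0 <= marked B A w)%E.
Proof. exact: measure_ge0. Qed.

Lemma campbell_ge0 B A : (0 <= campbell B A)%E.
Proof. by apply: integral_ge0 => w _; exact: marked_ge0. Qed.

Lemma campbell_setU (a b : R) (B1 B2 : set R) (A : set Omega) :
  measurable B1 -> measurable B2 -> B1 `<=` `[a, b] -> B2 `<=` `[a, b] ->
  B1 `&` B2 = set0 -> measurable A ->
  campbell (B1 `|` B2) A = (campbell B1 A + campbell B2 A)%E.
Proof.
move=> mB1 mB2 B1ab B2ab B12 mA.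
rewrite /campbell -ge0_integralD//; last 2 first.
- exact: measurable_marked B1ab _.
- exact: measurable_marked B2ab _.
apply: eq_integral => w _; rewrite /marked setIUl measureU//.
- by apply: measurableI => //; exact: measurable_flow_times.
- by apply: measurableI => //; exact: measurable_flow_times.
- by rewrite setIACA B12 set0I.
Qed.

(** Change of variable [theta t], which preserves [P]. A mark seen from s in the shifted outcome is
    the mark seen from [s + t] in the original one, by the flow property. *)
Lemma campbell_shift (a b t : R) (B : set R) (A : set Omega) :
  flow_compatible theta Phi ->
  measurable B -> B `<=` `[a, b] -> measurable A ->
  campbell [set s | B (s - t)] A = campbell B A.
Proof.
move=> fc mB Bab mA; have [_ thD _ thP] := flow.
have mm : measurable_fun setT (marked B A) by exact: measurable_marked Bab _.
have H := @ge0_integral_pushforward _ _ _ _ R _ (measurable_flow t) P setT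
  (marked B A) measurableT mm (fun w _ => marked_ge0 B A w).
transitivity (\int[P]_w (marked B A \o theta t) w)%E; last first.
  rewrite preimage_setT in H; rewrite -H; apply: eq_measure_integral.
    exact: measurable_flow.
  by move=> mt S mS _; exact: (thP t S mS).
apply: eq_integral => w _ /=.
rewrite /marked fc//; last first.
  by apply: measurableI => //; exact: measurable_flow_times.
congr (Phi w _); apply/seteqP; split => s /=.
  move=> [Bst As]; split => //; rewrite -[theta _ _]/((theta (s - t) \o theta t) w).
  by rewrite -thD subrK.
move=> [Bst]; rewrite -[theta _ _]/((theta (s - t) \o theta t) w).
by rewrite -thD subrK.
Qed.

Lemma campbell_shift_itv (a b t : R) (A : set Omega) :
  flow_compatible theta Phi -> measurable A ->
  campbell `]a + t, b + t] A = campbell `]a, b] A.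
Proof.
move=> fc mA; rewrite -(@campbell_shift a b t `]a, b])//; last first.
  by move=> y /=; rewrite !in_itv/= => /andP[/ltW -> ->].
congr campbell; apply/seteqP; split => y /=; rewrite !in_itv/=.
  by move=> /andP[? ?]; apply/andP; split; lra.
by move=> /andP[? ?]; apply/andP; split; lra.
Qed.

Lemma campbell_itvD (a b c : R) (A : set Omega) : measurable A ->
  a <= b -> b <= c ->
  campbell `]a, c] A = (campbell `]a, b] A + campbell `]b, c] A)%E.
Proof.
move=> mA ab bc; rewrite -(@campbell_setU a c)//.
- congr campbell; apply/seteqP; split => y /=; rewrite !in_itv/=.
    move=> /andP[-> yc]; case: (leP y b) => yb; [by left|right].
    by rewrite yc.
  by case=> /andP[? ?]; apply/andP; split; lra.
- by move=> y /=; rewrite !in_itv/= => /andP[? ?]; apply/andP; split; lra.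
- by move=> y /=; rewrite !in_itv/= => /andP[? ?]; apply/andP; split; lra.
- rewrite -subset0 => y [] /=; rewrite !in_itv/= => /andP[_ yb] /andP[].
  by rewrite ltNge yb.
Qed.

(** Only multiples of a window are compared, so additivity and shift invariance are enough to relate
    the unit window to the windows of length [1/(n+1)]. *)
Lemma campbell_muln (n : nat) (h : R) (A : set Omega) :
  flow_compatible theta Phi -> measurable A -> 0 <= h ->
  campbell `]0, h *+ n] A = (n%:R%:E * campbell `]0%R, h] A)%E.
Proof.
move=> fc mA h0; elim: n => [|n IH].
  rewrite mulr0n mul0e set_itv_ge; last by rewrite bnd_simp ltxx.
  rewrite /campbell; apply: integral0_eq => w _.
  by rewrite /marked set0I measure0.
rewrite mulrSr (@campbell_itvD 0 (h *+ n))//; last 2 first.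
- by rewrite mulrn_wge0.
- by rewrite lerDl.
rewrite IH -natr1 EFinD ge0_muleDl// ?lee_fin//; congr (_ + _)%E.
by rewrite mul1e -{1}[h *+ n]add0r [(h *+ n + h)%R]addrC campbell_shift_itv.
Qed.

Lemma campbell_setT (B : set R) :
  campbell B setT = (\int[P]_w Phi w B)%E.
Proof.
apply: eq_integral => w _; rewrite /marked; congr (Phi w _).
by apply/seteqP; split => [s []//|s Bs]; split.
Qed.

Lemma palmE (A : set Omega) : measurable A ->
  palm P theta Phi A = ((intensity P Phi)^-1 * campbell `]0%R, 1%R] A)%E.
Proof.
move=> mA; rewrite /palm; congr (_ * _)%E; apply: eq_integral => w _.
rewrite (_ : (fun s => _) = (fun s => (\1_[set s | A (theta s w)] s)%:E)) //.
by rewrite integral_indic// 1?setIC//; exact: measurable_flow_times.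
Qed.

End one_process.
End point_process.

Section palm_probability.
Context {R : realType} {d : measure_display} {Omega : measurableType d}.
Variable P : probability Omega R.
Variable theta : R -> Omega -> Omega.
Variable Phi : R.-ker Omega ~> R.
Variable lam : R.
Hypothesis flow : preserving_flow P theta.
Hypothesis pp : is_point_process Phi.
Hypothesis lam_gt0 : 0 < lam.
Hypothesis intensityE : intensity P Phi = lam%:E.

Let I01 : `]0%R, 1%R] `<=` (`[0%R, 1%R] : set R).
Proof. by move=> y /=; rewrite !in_itv/= => /andP[/ltW -> ->]. Qed.

(** [palm] is a formula on arbitrary sets. This variant, which agrees with it on measurable sets, is
    countably additive on them and can be declared a probability measure. *)
Let palm_law (A : set Omega) : \bar R :=
  ((lam^-1)%:E * campbell P theta Phi `]0%R, 1%R] A)%E.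

Let Q0 : palm_law set0 = 0%E.
Proof.
rewrite /palm_law /campbell integral0_eq ?mule0// => w _.
by rewrite /marked (_ : _ `&` _ = set0) ?measure0// -subset0 => s [].
Qed.

Let Q_ge0 A : (0 <= palm_law A)%E.
Proof.
apply: mule_ge0; first by rewrite lee_fin invr_ge0 ltW.
exact: campbell_ge0.
Qed.

Let Q_sigma_additive : semi_sigma_additive palm_law.
Proof.
move=> F mF tF mUF; rewrite [X in _ --> X](_ : _ =
    limn (fun n => \sum_(0 <= i < n) palm_law (F i))%E).
  by apply: is_cvg_ereal_nneg_natsum => k _; exact: Q_ge0.
rewrite nneseriesZl//; last by move=> n _; exact: campbell_ge0.
rewrite /palm_law /campbell -integral_nneseries//; last first.
  by move=> n; exact: (measurable_marked flow pp (measurable_itv _) I01 (mF n)).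
congr (_ * _)%E; apply: eq_integral => w _; rewrite /marked.
rewrite (_ : _ `&` _ =
    \bigcup_n (`]0, 1] `&` [set s | F n (theta s w)])); last first.
  apply/seteqP; split => s; first by move=> [s01 [n _ Fn]]; exists n.
  by move=> [n _ [s01 Fn]]; split => //; exists n.
have mn n : measurable (`]0, 1] `&` [set s | F n (theta s w)]).
  by apply: measurableI => //; exact: (measurable_flow_times flow w (mF n)).
rewrite measure_semi_bigcup//; last exact: bigcup_measurable.
by move=> i j _ _ [s [[_ Fi] [_ Fj]]]; apply: tF => //; exists (theta s w).
Qed.

#[local] HB.instance Definition _ := isMeasure.Build _ _ _ palm_law
  Q0 Q_ge0 Q_sigma_additive.

Let QT : palm_law setT = 1%E.
Proof.
rewrite /palm_law campbell_setT -[X in (_ * X)%E]/(intensity P Phi) intensityE -EFinM.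
by rewrite mulVf// gt_eqF.
Qed.

#[local] HB.instance Definition _ := Measure_isProbability.Build _ _ _ palm_law QT.

Lemma palm_probability : exists Q : probability Omega R,
  forall A, measurable A -> Q A = palm P theta Phi A.
Proof.
exists (palm_law : probability Omega R) => A mA; rewrite palmE// intensityE.
by rewrite inver gt_eqF.
Qed.

(** The unit window splits into [n+1] translates of this one. All later passages between [P] and a
    Palm probability go through this identity. *)
Lemma campbell_palm (Q : probability Omega R) (n : nat) (A : set Omega) :
  flow_compatible theta Phi ->
  (forall A, measurable A -> Q A = palm P theta Phi A) -> measurable A ->
  campbell P theta Phi `]0, n.+1%:R^-1] A = ((lam / n.+1%:R)%:E * Q A)%E.
Proof.
move=> fc QE mA; rewrite QE// palmE// intensityE inver gt_eqF//.
have := campbell_muln flow pp n.+1 fc mA (h := n.+1%:R^-1).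
rewrite -[n.+1%:R^-1 *+ n.+1]mulr_natr mulVf// invr_ge0// => /(_ (ler0n _ _)) ->.
rewrite !muleA -!EFinM (_ : lam / n.+1%:R * lam^-1 * n.+1%:R = 1) ?mul1e//.
by rewrite mulrAC mulfVK ?mulfV ?gt_eqF.
Qed.

End palm_probability.

Section lower_integral.
Context {d : measure_display} {T : measurableType d} {R : realType}.

(* The integral of a nonnegative function is a supremum over simple functions,
   hence monotone even without measurability. *)
Lemma ge0_le_lower_integral (mu : {measure set T -> \bar R}) (D : set T)
    (f g : T -> \bar R) : (forall x, D x -> 0 <= f x)%E ->
  (forall x, D x -> f x <= g x)%E ->
  (\int[mu]_(x in D) f x <= \int[mu]_(x in D) g x)%E.
Proof.
move=> f0 fg; have g0 x : D x -> (0 <= g x)%E.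
  by move=> Dx; exact: le_trans (f0 _ Dx) (fg _ Dx).
rewrite !ge0_integralE//; apply: le_ereal_sup => _ [h hf <-] /=.
by exists h => // x; apply: le_trans (hf x) _; exact: lee_restrict.
Qed.

End lower_integral.

Section half_lines.
Context {R : realType}.

Lemma measurable_half_lines : @measurable _ (measurableTypeR R) =
  <<s [set A | exists x : R, A = `]-oo, x]%classic] >>.
Proof.
apply/seteqP; split; last first.
  by apply: smallest_sub; [exact: sigma_algebra_measurable|move=> _ [x ->]].
rewrite RGenOInfty.measurableE; apply: smallest_sub.
  exact: smallest_sigma_algebra.
move=> _ [x ->]; rewrite -setCitvl -setTD.
by apply: sigma_algebraCD; apply: sub_sigma_algebra; exists x.
Qed.

Lemma eq_measure_half_lines (m1 m2 : {measure set R -> \bar R}) :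
  (m1 setT < +oo)%E -> (forall x : R, m1 `]-oo, x]%classic = m2 `]-oo, x]%classic) ->
  forall A, measurable A -> m1 A = m2 A.
Proof.
move=> m1oo m12; apply: (@measure_unique _ _ _
  [set A | exists x : R, A = `]-oo, x]%classic] (fun n => `]-oo, n%:R]%classic)).
- exact: measurable_half_lines.
- move=> _ _ [x ->] [y ->]; exists (Num.min x y).
  by apply/seteqP; split => z /=; rewrite !in_itv/= le_min; [case=> -> ->|move/andP].
- by move=> n; exists n%:R.
- rewrite -subTset => x _; exists (Num.truncn `|x|).+1 => //=.
  by rewrite in_itv/= (le_trans (ler_norm x))// ltW// truncnS_gt.
- by move=> _ [x ->].
- by move=> n; apply: le_lt_trans m1oo; rewrite le_measure ?inE.
Qed.

End half_lines.

(** * Measurability of the last and the next point *)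

Section random_atoms.
Context {R : realType} {d : measure_display} {Omega : measurableType d}.
Variable Phi : R.-ker Omega ~> R.
Hypothesis pp : is_point_process Phi.

Lemma measurable_void (B : set R) : measurable B ->
  measurable [set w | Phi w B = 0%E].
Proof.
move=> mB; have := measurable_kernel Phi _ mB measurableT _ (emeasurable_set1 0%E).
by rewrite setTI.
Qed.

(** The event on which the supremum defining [last_point_before (Phi w) 0] is over the empty set and
    takes the default value 0; countably many windows make it visibly measurable. *)
Definition no_past : set Omega :=
  \bigcap_n [set w | Phi w `]- n%:R, 0%R[%classic = 0%E].

Lemma measurable_no_past : measurable no_past.
Proof. by apply: bigcapT_measurable => n; exact: measurable_void. Qed.

Lemma no_pastP w : no_past w <-> forall s, s < 0 -> Phi w [set s] = 0%E.
Proof.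
split => [h s s0|h n _ /=].
  have := h (Num.truncn `|s|).+1 I; apply: subset_measure0 => // _ ->.
  rewrite /= in_itv/= s0 andbT ltrNl -(ltr0_norm s0).
  by rewrite truncnS_gt.
apply: (integer_valued_null_atoms (a := - n%:R) (b := 0)
  (point_process_integer pp w)) => //.
  by move=> y /=; rewrite !in_itv/= => /andP[/ltW -> /ltW].
by move=> x /=; rewrite in_itv/= => /andP[_ /h].
Qed.

Let past w := [set s | s < 0 /\ (0 < Phi w [set s])%E].

Let past_ub w : ubound (past w) 0.
Proof. by move=> s [/ltW]. Qed.

Lemma last_point_le0 w : last_point_before (Phi w) 0 <= 0.
Proof.
rewrite /last_point_before -/(past w).
have [->|ne] := eqVneq (past w) set0; first by rewrite sup0.
by apply: ge_sup => //; exact/set0P.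
Qed.

(** A supremum above x means an atom above x, and conversely positive mass of []x, 0[] produces an
    atom because the measure is integer valued. This turns statements on the last point into
    statements on void intervals. *)
Lemma last_point_gt w (x : R) : ~ no_past w ->
  x < last_point_before (Phi w) 0 <-> Phi w `]x, 0[%classic <> 0%E.
Proof.
move=> np; have ne : past w !=set0.
  apply: contrapT => ne; apply: np; apply/no_pastP => s s0.
  apply/eqP; rewrite eq_le measure_ge0 andbT leNgt; apply/negP => h.
  by apply: ne; exists s.
have hs : has_sup (past w) by split => //; exists 0; exact: past_ub.
split => [xl h|].
  have [s [s0 s1] xs] := sup_adherent (eps := sup (past w) - x)
    ltac:(by rewrite subr_gt0) hs.
  move: xs; rewrite subKr => xs; move: s1; rewrite lt0e => /andP[/eqP + _].
  apply; apply: subset_measure0 h => // _ ->.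
  by rewrite /= in_itv/= xs.
move/eqP; rewrite -measure_gt0 => h.
have sub : `]x, 0[ `<=` (`[x, 0] : set R).
  by move=> y /=; rewrite !in_itv/= => /andP[/ltW -> /ltW].
have [s] := integer_valued_atom (point_process_integer pp w) (measurable_itv _) sub h.
rewrite /= in_itv/= => /andP[xs s0] s1.
by apply: (lt_le_trans xs); apply: ub_le_sup; [exists 0; exact: past_ub|split].
Qed.

Lemma last_point_no_past w : no_past w -> last_point_before (Phi w) 0 = 0.
Proof.
move=> /no_pastP h; rewrite /last_point_before (_ : mkset _ = set0) ?sup0//.
by rewrite -subset0 => s [/h ->]; rewrite ltxx.
Qed.

Lemma void_last_point w (x : R) : last_point_before (Phi w) 0 <= x ->
  ~ no_past w -> Phi w `]x, 0[%classic = 0%E.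
Proof.
move=> lx np; apply: contrapT => h.
by have := (last_point_gt x np).2 h; rewrite ltNge lx.
Qed.

Lemma last_point_void w (x : R) : Phi w `]x, 0[%classic = 0%E ->
  last_point_before (Phi w) 0 <= x \/ no_past w.
Proof.
move=> h; have [np|np] := pselect (no_past w); [by right|left].
by rewrite leNgt; apply/negP => /(last_point_gt x np).
Qed.

Lemma measurable_last_point :
  measurable_fun [set: Omega] (fun w => last_point_before (Phi w) 0).
Proof.
apply: (measurability _ (RGenOInfty.measurableE R)) => _ /= -[_ [x ->] <-].
rewrite setTI.
have mv : measurable [set w | Phi w `]x, 0[%classic = 0%E] by exact: measurable_void.
have [x0|x0] := ltP x 0.
  (* Without a past the default value 0 exceeds the negative level x, so that event belongs to the
     preimage. *)
  rewrite (_ : _ @^-1` _ = no_past `|` ~` [set w | Phi w `]x, 0[%classic = 0%E]).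
    by apply: measurableU; [exact: measurable_no_past|exact: measurableC].
  apply/seteqP; split => w /=; rewrite in_itv/= andbT.
    have [np _|np] := pselect (no_past w); [by left|].
    by move=> /(last_point_gt x np); right.
  have [np _|np] := pselect (no_past w); first by rewrite last_point_no_past.
  by case=> // /(last_point_gt x np).
rewrite (_ : _ @^-1` _ = set0)// -subset0 => w /=; rewrite in_itv/= andbT.
by rewrite ltNge (le_trans (last_point_le0 w)).
Qed.

Definition no_future : set Omega :=
  \bigcap_n [set w | Phi w `]0%R, n%:R[%classic = 0%E].

Lemma measurable_no_future : measurable no_future.
Proof. by apply: bigcapT_measurable => n; exact: measurable_void. Qed.

Lemma no_futureP w : no_future w <-> forall s, 0 < s -> Phi w [set s] = 0%E.
Proof.
split => [h s s0|h n _ /=].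
  have := h (Num.truncn `|s|).+1 I; apply: subset_measure0 => // _ ->.
  by rewrite /= in_itv/= s0 (le_lt_trans (ler_norm s))// truncnS_gt.
apply: (integer_valued_null_atoms (a := 0) (b := n%:R)
  (point_process_integer pp w)) => //.
  by move=> y /=; rewrite !in_itv/= => /andP[/ltW -> /ltW].
by move=> x /=; rewrite in_itv/= => /andP[/h].
Qed.

Let future w := [set s | 0 < s /\ (0 < Phi w [set s])%E].

Let future_lb w : lbound (future w) 0.
Proof. by move=> s [/ltW]. Qed.

Lemma next_point_no_future w : no_future w -> next_point_after (Phi w) 0 = 0.
Proof.
move=> /no_futureP h; rewrite /next_point_after (_ : mkset _ = set0) ?inf0//.
by rewrite -subset0 => s [/h ->]; rewrite ltxx.
Qed.

Lemma next_point_ge0 w : 0 <= next_point_after (Phi w) 0.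
Proof.
rewrite /next_point_after -/(future w).
have [->|ne] := eqVneq (future w) set0; first by rewrite inf0.
by apply: lb_le_inf => //; exact/set0P.
Qed.

Lemma next_point_lt w (x : R) : ~ no_future w ->
  next_point_after (Phi w) 0 < x <-> Phi w `]0%R, x[%classic <> 0%E.
Proof.
move=> np; have ne : future w !=set0.
  apply: contrapT => ne; apply: np; apply/no_futureP => s s0.
  apply/eqP; rewrite eq_le measure_ge0 andbT leNgt; apply/negP => h.
  by apply: ne; exists s.
have hs : has_inf (future w) by split => //; exists 0; exact: future_lb.
split => [xl h|].
  have [s [s0 s1] xs] := inf_adherent (eps := x - inf (future w))
    ltac:(by rewrite subr_gt0) hs.
  move: xs; rewrite addrC subrK => xs; move: s1; rewrite lt0e => /andP[/eqP + _].
  apply; apply: subset_measure0 h => // _ ->.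
  by rewrite /= in_itv/= xs s0.
move/eqP; rewrite -measure_gt0 => h.
have sub : `]0, x[ `<=` (`[0, x] : set R).
  by move=> y /=; rewrite !in_itv/= => /andP[/ltW -> /ltW].
have [s] := integer_valued_atom (point_process_integer pp w) (measurable_itv _) sub h.
rewrite /= in_itv/= => /andP[xs s0] s1.
by apply: (le_lt_trans _ s0); apply: ge_inf; [exists 0; exact: future_lb|split].
Qed.

Lemma measurable_next_point :
  measurable_fun [set: Omega] (fun w => next_point_after (Phi w) 0).
Proof.
apply: (measurability _ (RGenInftyO.measurableE R)) => _ /= -[_ [x ->] <-].
rewrite setTI.
have mv : measurable [set w | Phi w `]0%R, x[%classic = 0%E] by exact: measurable_void.
have [x0|x0] := ltP 0 x.
  rewrite (_ : _ @^-1` _ = no_future `|` ~` [set w | Phi w `]0%R, x[%classic = 0%E]).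
    by apply: measurableU; [exact: measurable_no_future|exact: measurableC].
  apply/seteqP; split => w /=; rewrite in_itv/=.
    have [np _|np] := pselect (no_future w); [by left|].
    by move=> /(next_point_lt x np); right.
  have [np _|np] := pselect (no_future w); first by rewrite next_point_no_future.
  by case=> // /(next_point_lt x np).
rewrite (_ : _ @^-1` _ = set0)// -subset0 => w /=; rewrite in_itv/=.
by rewrite ltNge (le_trans x0)// next_point_ge0.
Qed.

(** The second alternative is the default value of an infimum over the empty set. Together with
    [next_point_void] this frames a void event between a strict and a weak inequality for the next
    point. *)
Lemma void_next_point w (a : R) : Phi w `]0%R, a]%classic = 0%E ->
  a <= next_point_after (Phi w) 0 \/ next_point_after (Phi w) 0 = 0.
Proof.
move=> h; have [np|np] := pselect (no_future w).
  by right; exact: next_point_no_future.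
left; rewrite leNgt; apply/negP => /(next_point_lt a np); apply.
by apply: subset_measure0 h => // y /=; rewrite !in_itv/= => /andP[-> /ltW].
Qed.

Lemma next_point_void w (a : R) : a < next_point_after (Phi w) 0 ->
  Phi w `]0%R, a]%classic = 0%E.
Proof.
move=> ha; have [np|np] := pselect (no_future w).
  by move/no_futureP : (np) => h; apply: (integer_valued_null_atoms (a := 0)
    (b := a) (point_process_integer pp w)) => // [y|x] /=;
    rewrite ?in_itv/=; [case/andP => /ltW -> ->|case/andP => /h].
apply: contrapT => h.
have ha' : ~ (next_point_after (Phi w) 0 < next_point_after (Phi w) 0).
  by rewrite ltxx.
apply: ha'; apply/(next_point_lt _ np) => h'; apply: h.
by apply: subset_measure0 h' => // y /=; rewrite !in_itv/= => /andP[-> /le_lt_trans->].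
Qed.

End random_atoms.

Section sublevel.
Context {R : realType} {d : measure_display} {T : measurableType d}.

Lemma measurable_sublevel (f : T -> R) (x : R) :
  measurable_fun [set: T] f -> measurable [set t | f t <= x].
Proof.
move=> mf; rewrite (_ : mkset _ = f @^-1` `]-oo, x]).
  by rewrite -[X in measurable X]setTI; exact: mf.
by apply/seteqP; split => t /=; rewrite in_itv.
Qed.

Lemma measurable_strict_sublevel (f : T -> R) (x : R) :
  measurable_fun [set: T] f -> measurable [set t | f t < x].
Proof.
move=> mf; rewrite (_ : mkset _ = f @^-1` `]-oo, x[).
  by rewrite -[X in measurable X]setTI; exact: mf.
by apply/seteqP; split => t /=; rewrite in_itv.
Qed.

End sublevel.

Section equal_laws.
Context {R : realType} {d1 d2 : measure_display}.
Context {T1 : measurableType d1} {T2 : measurableType d2}.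

Lemma eq_law (m1 : {measure set T1 -> \bar R}) (m2 : {measure set T2 -> \bar R})
    (f1 : T1 -> R) (f2 : T2 -> R) :
  measurable_fun [set: T1] f1 -> measurable_fun [set: T2] f2 ->
  (m1 setT < +oo)%E ->
  (forall x, m1 [set t | f1 t <= x] = m2 [set t | f2 t <= x]) ->
  forall A : set R, measurable A -> m1 (f1 @^-1` A) = m2 (f2 @^-1` A).
Proof.
move=> mf1 mf2 m1oo m12.
pose g1 : {mfun T1 >-> R} := HB.pack f1 (isMeasurableFun.Build _ _ _ _ _ mf1).
pose g2 : {mfun T2 >-> R} := HB.pack f2 (isMeasurableFun.Build _ _ _ _ _ mf2).
have E (T : Type) (f : T -> R) x : f @^-1` `]-oo, x] = [set t | f t <= x].
  by apply/seteqP; split => y /=; rewrite in_itv.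
apply: (@eq_measure_half_lines R (pushforward m1 g1) (pushforward m2 g2)).
  exact: m1oo.
by move=> x; have := m12 x; rewrite -(E _ f1) -(E _ f2).
Qed.

End equal_laws.

Section palm_monotone.
Context {R : realType} {d : measure_display} {Omega : measurableType d}.

(** Meant for events whose measurability is unknown: those on the interval sequence and the hit
    event of a policy with an arbitrary rule. *)
Lemma le_palm (P : probability Omega R) (theta : R -> Omega -> Omega)
    (Phi : Omega -> {measure set R -> \bar R}) (A B : set Omega) :
  A `<=` B -> (palm P theta Phi A <= palm P theta Phi B)%E.
Proof.
move=> AB; apply: lee_wpmul2l.
  by rewrite inve_ge0; apply: integral_ge0 => w _; exact: measure_ge0.
apply: ge0_le_lower_integral => w _.
  by apply: integral_ge0 => s _; rewrite lee_fin.
apply: ge0_le_lower_integral => s _; first by rewrite lee_fin.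
rewrite lee_fin !indicE ler_nat; case: (boolP (theta s w \in A)) => //.
by rewrite inE => /AB As; rewrite mem_set.
Qed.

End palm_monotone.

(** * A renewal process seen from the origin *)

Section renewal.
Context {R : realType} {d : measure_display} {Omega : measurableType d}.
Variable P : probability Omega R.
Variable theta : R -> Omega -> Omega.
Variable Phi : R.-ker Omega ~> R.
Variable lam : R.
Variable F0 : probability R R.
Variable Q : probability Omega R.
Hypothesis flow : preserving_flow P theta.
Hypothesis lam_gt0 : 0 < lam.
Hypothesis intensityE : intensity P Phi = lam%:E.
Hypothesis renewal :
  stationary_renewal P theta Phi (fun t => distr_fun F0 (lam * t)).
Hypothesis QE : forall A, measurable A -> Q A = palm P theta Phi A.
Hypothesis F0_atomless : forall x, F0 [set x] = 0%E.
Hypothesis F0_pos : F0 `]-oo, 0]%classic = 0%E.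

Let pp : is_point_process Phi. Proof. by case: renewal. Qed.
Let fc : flow_compatible theta Phi. Proof. by case: renewal. Qed.

Lemma shift_atom (s : R) (w : Omega) :
  Phi (theta s w) [set 0] = Phi w [set s].
Proof.
rewrite fc//; congr (Phi w _); apply/seteqP; split => y /=.
  by move/eqP; rewrite subr_eq0 => /eqP.
by move=> ->; rewrite subrr.
Qed.

Lemma shift_itv (b1 b2 : bool) (x y s : R) (w : Omega) :
  Phi (theta s w) [set` Interval (BSide b1 x) (BSide b2 y)] =
  Phi w [set` Interval (BSide b1 (x + s)) (BSide b2 (y + s))].
Proof.
rewrite fc//; congr (Phi w _); apply/seteqP; split => z /=; rewrite !in_itv/=;
  by case: b1; case: b2 => /= /andP[? ?]; apply/andP; split; lra.
Qed.

(** The points counted by the Palm formula would be points s of [Phi w] with no mass at s. *)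
Lemma palm_atom0 : Q [set w | Phi w [set 0] = 0%E] = 0%E.
Proof.
have mA := measurable_void Phi (measurable_set1 (0 : R)).
have mT w := measurable_flow_times flow w mA.
rewrite QE// palmE// /campbell integral0_eq ?mule0// => w _.
apply: (integer_valued_null_atoms (a := 0) (b := 1)
    (point_process_integer pp w)).
- exact: measurableI.
- by move=> s [] /=; rewrite !in_itv/= => /andP[/ltW -> ->].
- by move=> s [_] /=; rewrite shift_atom.
Qed.

(** [A] lies between [A'] without the null event [A0] and [A'] enlarged by it, and monotonicity of
    [palm] does the rest; [A] itself may fail to be measurable. *)
Lemma palm_eq_at_atom (A A' : set Omega) : measurable A' ->
  (forall w, (0 < Phi w [set 0%R])%E -> A w <-> A' w) ->
  palm P theta Phi A = Q A'.
Proof.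
move=> mA' AA'; pose A0 := [set w | Phi w [set 0] = 0%E].
have mA0 : measurable A0 := measurable_void Phi (measurable_set1 (0 : R)).
have nA0 w : ~ A0 w -> (0 < Phi w [set 0%R])%E.
  by move=> h; rewrite measure_gt0; exact/eqP.
apply/eqP; rewrite eq_le; apply/andP; split.
  have -> : Q A' = Q (A' `|` A0) by rewrite measureU0//; exact: palm_atom0.
  rewrite QE; last exact: measurableU.
  apply: le_palm => w Aw; have [|n0] := pselect (A0 w); [by right|left].
  by apply/AA' => //; exact: nA0.
have -> : Q A' = Q (A' `\` A0).
  rewrite measureD// ?ltey_eq ?fin_num_measure// [X in (_ - X)%E](_ : _ = 0%E).
    by rewrite sube0.
  by apply: (subset_measure0 _ _ _ palm_atom0) => //; exact: measurableI.
rewrite QE; last exact: measurableD.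
by apply: le_palm => w [A'w n0]; apply/AA' => //; exact: nA0.
Qed.

Let T0E w : (0 < Phi w [set 0%R])%E ->
  sup [set s | s <= 0 /\ (0 < Phi w [set s])%E] = 0.
Proof.
move=> w0; apply/eqP; rewrite eq_le; apply/andP; split.
  by apply: ge_sup; [exists 0; split|move=> s []].
by apply: ub_le_sup; [exists 0 => s []|split].
Qed.

Lemma palm_last_point (t : R) :
  Q [set w | - last_point_before (Phi w) 0 <= t] = F0 `]-oo, lam * t]%classic.
Proof.
(* The gap of index -1 ends at [T_0], which is 0 when the origin is a point; its length is then the
   age at the origin. *)
have [_ _ _ _ /(_ (-1) t)] := renewal.
rewrite (palm_eq_at_atom (A' := [set w | - last_point_before (Phi w) 0 <= t])).
- by rewrite /distr_fun fineK ?fin_num_measure.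
- apply: measurable_sublevel; apply: measurable_funN.
  exact: measurable_last_point.
- by move=> w w0; rewrite /inter_arrival /= /point /= T0E// sub0r.
Qed.

Lemma palm_next_point (t : R) :
  Q [set w | next_point_after (Phi w) 0 <= t] = F0 `]-oo, lam * t]%classic.
Proof.
have [_ _ _ _ /(_ 0 t)] := renewal.
rewrite (palm_eq_at_atom (A' := [set w | next_point_after (Phi w) 0 <= t])).
- by rewrite /distr_fun fineK ?fin_num_measure.
- by apply: measurable_sublevel; exact: measurable_next_point.
- by move=> w w0; rewrite /inter_arrival /= /point /= T0E// subr0.
Qed.

Let F0_lt x : F0 `]-oo, x[%classic = F0 `]-oo, x]%classic.
Proof.
rewrite (_ : `]-oo, x]%classic = `]-oo, x[ `|` [set x]).
  by rewrite measureU0//; exact: F0_atomless.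
by apply/seteqP; split => y /=; rewrite !in_itv/= le_eqVlt;
  [move/orP => [/eqP|]; [right|left]|case=> [->|->]; rewrite ?eqxx ?orbT].
Qed.

Lemma palm_next_point_lt (t : R) :
  Q [set w | next_point_after (Phi w) 0 < t] = F0 `]-oo, lam * t]%classic.
Proof.
have ms : measurable_fun [set: R] (fun t : R => t / lam).
  exact: mulrr_measurable.
have E : [set w | next_point_after (Phi w) 0 < t] =
    (fun w => next_point_after (Phi w) 0) @^-1` `]-oo, t[.
  by apply/seteqP; split => y /=; rewrite in_itv.
rewrite E (@eq_law _ _ _ _ _ Q F0 _ _ (measurable_next_point pp) ms)//.
- rewrite -F0_lt; congr (F0 _); apply/seteqP; split => y /=; rewrite !in_itv/=;
  by rewrite ltr_pdivrMr// mulrC.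
- by rewrite ltey_eq fin_num_measure.
- move=> x; rewrite [LHS]palm_next_point; congr (F0 _).
  by apply/seteqP; split => y /=; rewrite !in_itv/= ler_pdivrMr// mulrC.
Qed.

(** The void event contains that the next point is above a, and is contained in the event that it is
    at least a or equal to the default value 0. The two bounds agree because [F0] has no atom and
    does not charge []-oo, 0]]. *)
Lemma palm_void (a : R) : 0 <= a ->
  Q [set w | Phi w `]0%R, a]%classic = 0%E] =
  (1 - F0 `]-oo, (lam * a)%R]%classic)%E.
Proof.
move=> a0; have mN := measurable_next_point pp.
have mle x := measurable_sublevel x mN.
have mlt x := measurable_strict_sublevel x mN.
have mv := measurable_void Phi (measurable_itv `]0, a]).
apply/eqP; rewrite eq_le; apply/andP; split.
  rewrite -palm_next_point_lt -probability_setC//.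
  have Q0 : Q [set w | next_point_after (Phi w) 0 <= 0] = 0%E.
    by rewrite palm_next_point mulr0.
  rewrite -(measureU0 (measurableC (mlt a)) (mle 0) Q0).
  rewrite le_measure ?inE//.
    by apply: measurableU => //; exact: measurableC.
  move=> w /(void_next_point pp)[h|h]; [left|right] => /=.
    by apply/negP; rewrite -leNgt.
  by rewrite h.
rewrite -palm_next_point -probability_setC// le_measure ?inE//.
  exact: measurableC.
by move=> w /= /negP; rewrite -ltNge => /(next_point_void pp).
Qed.

End renewal.

(** * Uniqueness of a function with prescribed bounds on its increments *)

Section increments.
Context {R : realType}.

(** In one step of length h the upper bound for p and the lower bound for q differ by
    [l * h * (H (a + h) - H a)], and these differences telescope. *)
Let step_error (l : R) (p q H : R -> R) (n : nat) : 0 <= l -> p 0 = q 0 ->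
  (forall a, 0 <= H a) ->
  (forall a, 0 <= a ->
     l / n.+1%:R * (1 - H (a + n.+1%:R^-1)) <= p (a + n.+1%:R^-1) - p a
       <= l / n.+1%:R * (1 - H a)) ->
  (forall a, 0 <= a ->
     l / n.+1%:R * (1 - H (a + n.+1%:R^-1)) <= q (a + n.+1%:R^-1) - q a
       <= l / n.+1%:R * (1 - H a)) ->
  forall k : nat, p (k%:R / n.+1%:R) - q (k%:R / n.+1%:R) <=
    l / n.+1%:R * (H (k%:R / n.+1%:R)).
Proof.
move=> l0 pq0 H0 hp hq; elim=> [|k IH].
  rewrite mul0r pq0 subrr; apply: mulr_ge0 => //.
  by apply: divr_ge0.
have k0 : 0 <= k%:R / n.+1%:R :> R by apply: divr_ge0.
have -> : k.+1%:R / n.+1%:R = k%:R / n.+1%:R + n.+1%:R^-1 :> R.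
  by rewrite -natr1 mulrDl mul1r.
have /andP[_ h1] := hp _ k0; have /andP[h2 _] := hq _ k0.
move: IH h1 h2; set A := l / _; set x := k%:R / _; set y := x + _.
by rewrite !mulrBr mulr1; lra.
Qed.

(** A discrete substitute for the equation [p' = l * (1 - H)]. On the grid of step [1/(n+1)] the two
    functions differ by at most [l/(n+1)]; monotonicity between grid points costs as much again, and
    n is arbitrary. *)
Lemma increments_unique (l : R) (p q H : R -> R) : 0 <= l -> p 0 = q 0 ->
  (forall a, 0 <= H a <= 1) ->
  {homo p : x y / x <= y} -> {homo q : x y / x <= y} ->
  (forall n a, 0 <= a ->
     l / n.+1%:R * (1 - H (a + n.+1%:R^-1)) <= p (a + n.+1%:R^-1) - p a
       <= l / n.+1%:R * (1 - H a)) ->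
  (forall n a, 0 <= a ->
     l / n.+1%:R * (1 - H (a + n.+1%:R^-1)) <= q (a + n.+1%:R^-1) - q a
       <= l / n.+1%:R * (1 - H a)) ->
  forall a, 0 <= a -> p a = q a.
Proof.
move=> l0 pq0 H01 p_nd q_nd hp hq a a0.
have H0 x : 0 <= H x by have /andP[] := H01 x.
suff main n : `|p a - q a| <= 2 * (l / n.+1%:R).
  apply/eqP; rewrite -subr_eq0 -normr_le0; apply/ler_addgt0Pr => e e0.
  (* The shift to [l + 1] keeps the divisor positive when l is 0. *)
  have /ltr_add_invr[n] : 0 < e / (2 * (l + 1)).
    by apply: divr_gt0 => //; apply: mulr_gt0 => //; lra.
  rewrite !add0r => hn; apply: (le_trans (main n)).
  have l1 : 0 < 2 * (l + 1) by lra.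
  have := hn; rewrite ltr_pdivlMr// => hn'.
  have n0 : 0 <= n.+1%:R^-1 :> R by rewrite invr_ge0.
  apply: le_trans (ltW hn').
  by rewrite mulrA mulrC ler_wpM2l//; lra.
have h0 : 0 < n.+1%:R^-1 :> R by rewrite invr_gt0.
pose k := Num.truncn (a / n.+1%:R^-1).
have ah0 : 0 <= a / n.+1%:R^-1 by rewrite divr_ge0// ltW.
have /andP[k1 k2] := truncn_itv ah0.
have ka : k%:R / n.+1%:R <= a by rewrite -ler_pdivlMr.
have ak : a <= k.+1%:R / n.+1%:R by rewrite -ler_pdivrMr// ltW.
have k0 : 0 <= k%:R / n.+1%:R :> R by apply: divr_ge0.
have kS : k.+1%:R / n.+1%:R = k%:R / n.+1%:R + n.+1%:R^-1 :> R.
  by rewrite -natr1 mulrDl mul1r.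
have ln0 : 0 <= l / n.+1%:R by apply: divr_ge0.
have /andP[_ p1] := hp n _ k0; have /andP[_ q1] := hq n _ k0.
have e1 := step_error l0 pq0 H0 (hp n) (hq n) k.
have e2 := step_error l0 (esym pq0) H0 (hq n) (hp n) k.
have /andP[_ H1] := H01 (k%:R / n.+1%:R).
have e3 : l / n.+1%:R * H (k%:R / n.+1%:R) <= l / n.+1%:R by rewrite ler_piMr.
have e4 : l / n.+1%:R * (1 - H (k%:R / n.+1%:R)) <= l / n.+1%:R.
  by rewrite ler_piMr// gerBl.
have := (p_nd _ _ ka, p_nd _ _ ak, q_nd _ _ ka, q_nd _ _ ak).
rewrite kS => -[[[p2 p3] q2] q3].
have {}e1 := le_trans e1 e3; have {}e2 := le_trans e2 e3.
have {}p1 := le_trans p1 e4; have {}q1 := le_trans q1 e4.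
move: e1 e2 p1 q1 p2 p3 q2 q3; rewrite ler_norml; clear.
set A := l / _; set x := k%:R / _; set y := x + _ => *.
by apply/andP; split; lra.
Qed.

End increments.

(** * Probability that a stationary renewal process has a point in an interval *)

Section renewal.
Context {R : realType} {d : measure_display} {Omega : measurableType d}.
Variable P : probability Omega R.
Variable theta : R -> Omega -> Omega.
Variable Phi : R.-ker Omega ~> R.
Variable lam : R.
Variable F0 : probability R R.
Variable Q : probability Omega R.
Hypothesis flow : preserving_flow P theta.
Hypothesis lam_gt0 : 0 < lam.
Hypothesis intensityE : intensity P Phi = lam%:E.
Hypothesis renewal :
  stationary_renewal P theta Phi (fun t => distr_fun F0 (lam * t)).
Hypothesis QE : forall A, measurable A -> Q A = palm P theta Phi A.
Hypothesis F0_atomless : forall x, F0 [set x] = 0%E.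
Hypothesis F0_pos : F0 `]-oo, 0]%classic = 0%E.

Let pp : is_point_process Phi. Proof. by case: renewal. Qed.
Let fc : flow_compatible theta Phi. Proof. by case: renewal. Qed.
Let simple : is_simple P Phi. Proof. by case: renewal. Qed.

Let mvoid (B : set R) : measurable B -> measurable [set w | Phi w B = 0%E].
Proof. exact: measurable_void. Qed.

Lemma stationary_void (b1 b2 : bool) (x y s : R) :
  P [set w | Phi w [set` Interval (BSide b1 (x + s)) (BSide b2 (y + s))] = 0%E] =
  P [set w | Phi w [set` Interval (BSide b1 x) (BSide b2 y)] = 0%E].
Proof.
have [_ _ _ thP] := flow.
rewrite -[RHS](thP s); last exact: mvoid.
congr (P _); apply/seteqP; split => w /=; by rewrite (shift_itv renewal).
Qed.

(** A nonzero integer count is at least 1, so the indicator is below the count, whose mean is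
    [lam/(n+1)]. *)
Lemma not_void_le (n : nat) :
  (P [set w | Phi w `]0%R, (n.+1%:R^-1)%R]%classic <> 0%E] <= (lam / n.+1%:R)%:E)%E.
Proof.
set I : set R := `]0, n.+1%:R^-1]%classic.
have mI : measurable I by exact: measurable_itv.
have mv : measurable [set w | Phi w I <> 0%E] by exact: measurableC (mvoid mI).
have := campbell_palm flow pp lam_gt0 intensityE n fc QE measurableT.
rewrite probability_setT mule1 campbell_setT => <-.
rewrite -[X in P X]setIT -integral_indic//; apply: ge0_le_integral => //.
- exact/measurable_EFinP/measurable_indic.
- exact: measurable_kernel.
move=> w _; rewrite indicE; case: (boolP (_ \in _)) => [|_]; last exact: measure_ge0.
rewrite inE /= => h.
have [k hk] : exists k : nat, Phi w I = k%:R%:E.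
  by apply: (pp w (a := 0) (b := n.+1%:R^-1)) => // y; rewrite /I /= !in_itv/=
    => /andP[/ltW -> ->].
by move: h; rewrite hk; case: k {hk} => // k _; rewrite lee_fin ler1n.
Qed.

Let shift_set1 (x s : R) (w : Omega) :
  Phi (theta s w) [set x] = Phi w [set x + s].
Proof.
rewrite fc//; congr (Phi w _); apply/seteqP; split => y /= => [<-|->].
  by rewrite subrK.
by rewrite addrK.
Qed.

(** Stationarity moves t to the right end of a window that contains a point with probability at most
    [lam/(n+1)]. *)
Lemma no_fixed_atom (t : R) : P [set w | Phi w [set t] <> 0%E] = 0%E.
Proof.
have m1 x : measurable [set w | Phi w [set x] = 0%E] by exact: mvoid.
have [_ _ _ thP] := flow.
apply/eqP; rewrite eq_le measure_ge0 andbT; apply/lee_addgt0Pr => e e0.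
rewrite add0e; have /ltr_add_invr[n] : 0 < e / lam by exact: divr_gt0.
rewrite add0r => hn; apply: (@le_trans _ _ (lam / n.+1%:R)%:E); last first.
  by rewrite lee_fin mulrC -ler_pdivlMr// ltW.
apply: le_trans (not_void_le n).
have -> : P [set w | Phi w [set t] <> 0%E] =
    P [set w | Phi w [set n.+1%:R^-1] <> 0%E].
  rewrite -[RHS](thP (t - n.+1%:R^-1)); last exact: measurableC (m1 _).
  by congr (P _); apply/seteqP; split => w /=; rewrite shift_set1 addrC subrK.
rewrite le_measure ?inE//; [exact: measurableC (m1 _)|exact: measurableC (mvoid _)|].
move=> w /= h h'; apply: h; apply: subset_measure0 h' => // _ ->.
by rewrite /= in_itv/= lexx invr_gt0 ltr0n.
Qed.

(** By stationarity this is the distribution function of the age at time 0, as established later; it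
    vanishes for a negative. *)
Definition hit_prob (a : R) : R :=
  fine (P [set w | Phi w `]0%R, a]%classic <> 0%E]).

Lemma hit_probE (a : R) :
  P [set w | Phi w `]0%R, a]%classic <> 0%E] = (hit_prob a)%:E.
Proof. by rewrite fineK ?fin_num_measure//; exact: measurableC (mvoid _). Qed.

Lemma void_probE (a : R) :
  P [set w | Phi w `]0%R, a]%classic = 0%E] = (1 - hit_prob a)%:E.
Proof.
rewrite EFinB -hit_probE -probability_setC; last exact: measurableC (mvoid _).
by congr (P _); rewrite -[LHS]setCK.
Qed.

Lemma hit_prob_homo : {homo hit_prob : x y / x <= y}.
Proof.
move=> x y xy; rewrite -lee_fin -!hit_probE le_measure ?inE//.
- exact: measurableC (mvoid _).
- exact: measurableC (mvoid _).
move=> w /= h h'; apply: h; apply: subset_measure0 h' => // z /=.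
by rewrite !in_itv/= => /andP[-> /le_trans ->].
Qed.

Lemma hit_prob_le0 (a : R) : a <= 0 -> hit_prob a = 0.
Proof.
move=> a0; rewrite /hit_prob (_ : mkset _ = set0) ?measure0//.
rewrite -subset0 => w /=; apply.
by rewrite set_itv_ge ?measure0// bnd_simp -leNgt.
Qed.

(** With [h = 1/(n+1)], this event separates voidness of []h, a + h]] from voidness of []0, a + h]],
    so it accounts for the increment of [hit_prob] from a to [a + h]. *)
Let first_step (a : R) (n : nat) : set Omega :=
  [set w | Phi w `]0%R, n.+1%:R^-1]%classic <> 0%E /\
           Phi w `]n.+1%:R^-1, (a + n.+1%:R^-1)%R]%classic = 0%E].

Let measurable_first_step a n : measurable (first_step a n).
Proof. by apply: measurableI; [exact: measurableC (mvoid _)|exact: mvoid]. Qed.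

Let first_stepE (a : R) (n : nat) : 0 <= a ->
  P (first_step a n) = (hit_prob (a + n.+1%:R^-1) - hit_prob a)%:E.
Proof.
move=> a0; set h := n.+1%:R^-1.
have h0 : 0 < h by rewrite invr_gt0.
have split0 w : Phi w `]0%R, a + h]%classic = 0%E <->
    Phi w `]0%R, h]%classic = 0%E /\ Phi w `]h, a + h]%classic = 0%E.
  split=> [H|[H1 H2]].
    split; apply: subset_measure0 H => // y /=; rewrite !in_itv/= => /andP[? ?];
    by apply/andP; split; lra.
  apply: (@subset_measure0 _ _ _ (Phi w) _ (`]0, h] `|` `]h, a + h])) => //.
  - exact: measurableU.
  - move=> y /=; rewrite !in_itv/= => /andP[y0 y1].
    by have [yh|yh] := leP y h; [left; rewrite y0|right].
  - exact: null_set_setU.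
have E : [set w | Phi w `]h, a + h]%classic = 0%E] =
    first_step a n `|` [set w | Phi w `]0%R, a + h]%classic = 0%E].
  apply/seteqP; split => w /=.
    move=> H; have [H0|H0] := pselect (Phi w `]0%R, h]%classic = 0%E).
      by right; apply/split0.
    by left.
  by case=> [[]//|/split0 []].
have PU : P (first_step a n `|` [set w | Phi w `]0%R, (a + h)%R]%classic = 0%E]) =
    (P (first_step a n) + P [set w | Phi w `]0%R, (a + h)%R]%classic = 0%E])%E.
  rewrite measureU//; first exact: mvoid.
  by rewrite -subset0 => w [/= [H1 H2] /split0 []].
have := stationary_void false false 0 a h; rewrite add0r E PU !void_probE.
have -> : P (first_step a n) = (fine (P (first_step a n)))%:E.
  by rewrite fineK ?fin_num_measure.
by rewrite -EFinD => -[H]; congr EFin; lra.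
Qed.

(** A marked point s of the window is followed by a void []s, a + h + s]], which covers the rest of
    the window and []h, a + h]]. So at most one point is marked, simplicity gives it mass at most 1,
    and its existence forces [first_step]. *)
Let simple_marked (a : R) (n : nat) (w : Omega) : 0 <= a ->
  (forall x, Phi w [set x] <= 1)%E ->
  (marked theta Phi `]0%R, (n.+1%:R^-1)%R]
     [set w | Phi w `]0%R, (a + n.+1%:R^-1)%R]%classic = 0%E] w <=
   (\1_(first_step a n) w)%:E)%E.
Proof.
move=> a0 sw; set h := n.+1%:R^-1.
have h0 : 0 < h by rewrite invr_gt0.
rewrite /marked; set B := (X in Phi w X).
have BE s : B s <-> 0 < s <= h /\ Phi w `]s, a + h + s]%classic = 0%E.
  rewrite /B /= in_itv/= (shift_itv renewal) add0r.
  by split => [[]|[]].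
have mB : measurable B.
  apply: measurableI => //.
  exact: (measurable_flow_times flow w (mvoid (measurable_itv `]0%R, a + h]))).
have Bsub : B `<=` `[0, h] by move=> s /BE[/andP[/ltW ? ?] _]; rewrite /= in_itv/=; apply/andP.
have [B0|] := eqVneq (Phi w B) 0%E; first by rewrite B0 lee_fin.
rewrite -measure_gt0 => /(integer_valued_atom (point_process_integer pp w) mB Bsub).
move=> [x /BE[/andP[x0 xh] xv] x1].
have Bx : Phi w (B `\` [set x]) = 0%E.
  apply: (integer_valued_null_atoms (a := 0) (b := h)
    (point_process_integer pp w)).
  - exact: measurableD.
  - by move=> y [/Bsub].
  move=> y [/BE[/andP[y0 yh] yv] /= /eqP]; rewrite neq_lt => /orP[yx|xy].
    exfalso; move: x1; rewrite measure_gt0 => /eqP; apply.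
    apply: subset_measure0 yv => // _ ->; rewrite /= in_itv/=.
    by apply/andP; split; real_lra.
  apply: subset_measure0 xv => // _ ->; rewrite /= in_itv/=.
  by apply/andP; split; real_lra.
have -> : \1_(first_step a n) w = 1 :> R.
  rewrite indicE mem_set//; split.
    move=> H; move: x1; rewrite measure_gt0 => /eqP; apply.
    by apply: subset_measure0 H => // _ ->; rewrite /= in_itv/= x0.
  apply: subset_measure0 xv => // y; rewrite /= !in_itv/= -/h => /andP[? ?].
  by apply/andP; split; real_lra.
apply: (@le_trans _ _ (Phi w (B `\` [set x] `|` [set x]))).
  rewrite le_measure ?inE//; first by apply: measurableU => //; exact: measurableD.
  by move=> y By; have [->|/eqP yx] := eqVneq y x; [right|left].
have -> : Phi w (B `\` [set x] `|` [set x]) =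
    (Phi w (B `\` [set x]) + Phi w [set x])%E.
  by rewrite measureU ?setDKI//; exact: measurableD.
by rewrite Bx add0e sw.
Qed.

(** On [first_step], the last point s of the window is marked: []s, a + s]] is covered by the void
    end of the window and by the void []h, a + h]]. *)
Let marked_first_step (a : R) (n : nat) (w : Omega) : 0 <= a ->
  ((\1_(first_step a n) w)%:E <=
   marked theta Phi `]0%R, (n.+1%:R^-1)%R]
     [set w | Phi w `]0%R, a]%classic = 0%E] w)%E.
Proof.
move=> a0; set h := n.+1%:R^-1.
have h0 : 0 < h by rewrite invr_gt0.
rewrite indicE; case: (boolP (_ \in _)) => [|_]; last exact: measure_ge0.
rewrite inE => -[hw hv]; rewrite -/h in hw hv.
have sub : `]0, h] `<=` (`[0, h] : set R).
  by move=> y /=; rewrite !in_itv/= => /andP[/ltW -> ->].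
move/eqP : hw; rewrite -measure_gt0 => hw.
have [s [s0h s1 sv]] := integer_valued_last_atom (point_process_integer pp w)
  (measurable_itv _) sub hw.
rewrite /marked; set B := (X in Phi w X).
have mB : measurable B.
  apply: measurableI => //.
  exact: (measurable_flow_times flow w (mvoid (measurable_itv `]0%R, a]))).
have Bs : B s.
  split => //=; rewrite (shift_itv renewal) add0r.
  apply: (@subset_measure0 _ _ _ (Phi w) _
    ((`]0, h] `&` `]s, +oo[) `|` `]h, a + h])) => //.
  - by apply: measurableU => //; exact: measurableI.
  - move: s0h; rewrite /= in_itv/= => /andP[s0 sh] y /=; rewrite !in_itv/=.
    move=> /andP[sy ya]; have [yh|yh] := leP y h.
      by left; split; [apply/andP; split|apply/andP; split] => //; real_lra.
    by right; real_lra.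
  - by apply: null_set_setU => //; exact: measurableI.
have [k hk] : exists k : nat, Phi w B = k%:R%:E.
  by apply: (pp w mB (a := 0) (b := h)) => y [/sub].
have : (0 < Phi w B)%E.
  by apply: lt_le_trans s1 _; rewrite le_measure ?inE// => _ ->.
by rewrite hk lte_fin ltr0n lee_fin ler1n.
Qed.

(** The event [first_step] is bracketed by two numbers of marked points, whose means are [lam/(n+1)]
    times Palm void probabilities of []0, a + h]] and []0, a]]. *)
Lemma hit_prob_increments (n : nat) (a : R) : 0 <= a ->
  lam / n.+1%:R * (1 - distr_fun F0 (lam * (a + n.+1%:R^-1))) <=
    hit_prob (a + n.+1%:R^-1) - hit_prob a <=
  lam / n.+1%:R * (1 - distr_fun F0 (lam * a)).
Proof.
move=> a0; rewrite -!lee_fin -first_stepE//.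
have h0 : 0 < n.+1%:R^-1 :> R by rewrite invr_gt0.
have sub : `]0, n.+1%:R^-1] `<=` (`[0, n.+1%:R^-1] : set R).
  by move=> y /=; rewrite !in_itv/= => /andP[/ltW -> ->].
have E (b : R) : 0 <= b -> (lam / n.+1%:R * (1 - distr_fun F0 (lam * b)))%:E =
    campbell P theta Phi `]0%R, (n.+1%:R^-1)%R]
      [set w | Phi w `]0%R, b]%classic = 0%E].
  move=> b0; rewrite (campbell_palm flow pp lam_gt0 intensityE n fc QE (mvoid _))//.
  rewrite (palm_void flow lam_gt0 renewal QE F0_atomless F0_pos)//.
  by rewrite EFinM EFinB /distr_fun fineK ?fin_num_measure.
have a1 : 0 <= a + n.+1%:R^-1 by rewrite addr_ge0// ltW.
have mi : measurable_fun setT (fun w => (\1_(first_step a n) w : R)%:E).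
  exact/measurable_EFinP/measurable_indic.
have mm (b : R) : measurable_fun setT (marked theta Phi `]0%R, (n.+1%:R^-1)%R]
    [set w | Phi w `]0%R, b]%classic = 0%E]).
  exact: (measurable_marked flow pp _ sub (mvoid _)).
rewrite !E// -[X in P X]setIT -integral_indic//.
apply/andP; split; last first.
  by apply: ge0_le_integral => // w _; exact: marked_first_step.
apply: ae_ge0_le_integral => //.
apply: filterS simple => w sw _; exact: simple_marked.
Qed.

Lemma hit_prob_lipschitz (n : nat) (a : R) :
  hit_prob (a + n.+1%:R^-1) <= hit_prob a + lam / n.+1%:R.
Proof.
have h0 : 0 < n.+1%:R^-1 :> R by rewrite invr_gt0.
have ln0 : 0 <= lam / n.+1%:R by rewrite divr_ge0// ltW.
have H0 x : 0 <= distr_fun F0 x by rewrite fine_ge0.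
have hb b : 0 <= b -> hit_prob (b + n.+1%:R^-1) <= hit_prob b + lam / n.+1%:R.
  move=> /(hit_prob_increments n)/andP[_].
  rewrite lerBlDl => /le_trans; apply.
  by rewrite lerD2l ler_piMr// gerBl.
have [a0|a0] := leP 0 a; first exact: hb.
rewrite (hit_prob_le0 (ltW a0)) add0r.
have h := hb 0 (lexx _); rewrite (hit_prob_le0 (lexx 0)) !add0r in h.
by apply: le_trans h; apply: hit_prob_homo; rewrite gerDr ltW.
Qed.

End renewal.

(** * Distribution functions on the line and the age law *)

Section distribution_function.
Context {R : realType}.
Variable mu : probability R R.

Let idR : {mfun R >-> R} :=
  HB.pack (@idfun R) (isMeasurableFun.Build _ _ _ _ _ (@measurable_id _ R setT)).

Let cdfE (x : R) : cdf (P := mu) idR x = mu `]-oo, x]%classic.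
Proof. by []. Qed.

Lemma distr_funE (x : R) : (distr_fun mu x)%:E = mu `]-oo, x]%classic.
Proof. by rewrite /distr_fun fineK ?fin_num_measure. Qed.

Lemma distr_fun_ge0 (x : R) : 0 <= distr_fun mu x.
Proof. by rewrite fine_ge0. Qed.

Lemma distr_fun_le1 (x : R) : distr_fun mu x <= 1.
Proof. by rewrite -lee_fin distr_funE probability_le1. Qed.

Lemma distr_fun_itv (x y : R) : x <= y ->
  mu `]x, y]%classic = (distr_fun mu y - distr_fun mu x)%:E.
Proof.
move=> xy; rewrite EFinB !distr_funE.
have -> : `]-oo, y]%classic = `]-oo, x] `|` `]x, y].
  apply/seteqP; split => z /=; rewrite !in_itv/=.
    by have [zx|zx] := leP z x; [left|right].
  by case => [/le_trans ->//|/andP[]].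
have -> : mu (`]-oo, x] `|` `]x, y]) = (mu `]-oo, x]%classic + mu `]x, y]%classic)%E.
  rewrite measureU// -subset0 => z [] /=; rewrite !in_itv/= => h /andP[].
  by rewrite ltNge h.
by rewrite addeAC subee ?add0e// fin_num_measure.
Qed.

Lemma distr_fun_gt (x : R) : mu `]x, +oo[%classic = (1 - distr_fun mu x)%:E.
Proof.
by rewrite EFinB distr_funE -probability_setC// setCitvl.
Qed.

Lemma distr_fun_homo : {homo distr_fun mu : x y / x <= y}.
Proof. by move=> x y xy; rewrite -lee_fin !distr_funE -!cdfE cdf_nondecreasing. Qed.

Lemma measurable_distr_fun : measurable_fun [set: R] (distr_fun mu).
Proof. by apply: nondecreasing_measurable => // x y; exact: distr_fun_homo. Qed.

Lemma distr_fun_right_continuous : right_continuous (distr_fun mu).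
Proof.
move=> x; apply: fine_cvg; rewrite fineK ?fin_num_measure//.
exact: (@cdf_right_continuous _ _ _ mu idR).
Qed.

Lemma distr_fun_cvgy : distr_fun mu x @[x --> +oo] --> (1 : R).
Proof. by apply: fine_cvg; exact: (@cvg_cdfy1 _ _ _ mu idR). Qed.

Lemma distr_fun_tail (e : R) : 0 < e ->
  exists x0 : R, forall x, x0 <= x -> 1 - e < distr_fun mu x.
Proof.
move=> e0; have [x0 [_ h]] : \forall x \near +oo, 1 - e < distr_fun mu x.
  by apply: (cvgr_gt _ distr_fun_cvgy); rewrite ltrBlDr ltrDl.
by exists (x0 + 1) => x x0x; apply: h; lra.
Qed.

Lemma atomless_lt : (forall x, mu [set x] = 0%E) ->
  forall x : R, mu `]-oo, x[%classic = mu `]-oo, x]%classic.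
Proof.
move=> mu0 x; rewrite (_ : `]-oo, x]%classic = `]-oo, x[ `|` [set x]).
  by rewrite measureU0//; exact: mu0.
by apply/seteqP; split => y /=; rewrite !in_itv/= le_eqVlt;
  [move/orP => [/eqP|]; [right|left]|case=> [->|->]; rewrite ?eqxx ?orbT].
Qed.

End distribution_function.

Section age_law.
Context {R : realType}.
Variable F0 : probability R R.
Hypothesis F0_supp : F0 `[0, +oo[%classic = 1%E.
Hypothesis F0_atomless : forall x, F0 [set x] = 0%E.
Hypothesis F0_mean : (\int[F0]_x x%:E)%E = 1%E.

Lemma atomless_nonneg_le0 : F0 `]-oo, 0]%classic = 0%E.
Proof.
rewrite -atomless_lt// -setCitvr probability_setC// F0_supp subee//.
Qed.

Let surv (s : R) : \bar R := (1 - distr_fun F0 s)%:E.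

Let surv_ge0 s : (0 <= surv s)%E.
Proof. by rewrite lee_fin subr_ge0 distr_fun_le1. Qed.

Let measurable_surv D : measurable_fun D surv.
Proof.
apply/measurable_EFinP; apply: measurable_funTS; apply: measurable_funB => //.
exact: measurable_distr_fun.
Qed.

Let mpos (A : set R) : measurable A -> measurable (A `&` `[0, +oo[).
Proof. by move=> mA; exact: measurableI. Qed.

Let age0 : age_law F0 set0 = 0%E.
Proof. by rewrite /age_law set0I integral_set0. Qed.

Let age_ge0 A : (0 <= age_law F0 A)%E.
Proof. by apply: integral_ge0 => s _; exact: surv_ge0. Qed.

Let age_sigma_additive : semi_sigma_additive (age_law F0).
Proof.
move=> A mA tA mUA; rewrite [X in _ --> X](_ : _ =
    limn (fun n => \sum_(0 <= i < n) age_law F0 (A i))%E).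
  by apply: is_cvg_ereal_nneg_natsum => k _; exact: age_ge0.
rewrite /age_law setI_bigcupl ge0_integral_bigcup//.
- by move=> k; exact: mpos.
- exact: measurable_surv.
- by move=> s _; exact: surv_ge0.
- by move=> i j _ _ [s [[Ai _] [Aj _]]]; apply: tA => //; exists s.
Qed.

#[local] HB.instance Definition _ := isMeasure.Build _ _ _ (age_law F0)
  age0 age_ge0 age_sigma_additive.

Let normR : {mfun R >-> R} := HB.pack (@Num.norm R R)
  (isMeasurableFun.Build _ _ _ _ _ (@normr_measurable _ setT)).

(** The mean is the integral of the tail. The tail formula is for nonnegative variables, hence the
    absolute value, which changes the identity on an [F0]-null set only. *)
Let ageT : age_law F0 setT = 1%E.
Proof.
have <- : ('E_F0[normR] = 1)%E.
  rewrite expectation_def -F0_mean; apply: ae_eq_integral => //.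
  - by apply/measurable_EFinP; exact: normr_measurable.
  exists `]-oo, 0]%classic; split => //; first exact: atomless_nonneg_le0.
  move=> x /=; rewrite in_itv/= leNgt => h; apply/negP => x0.
  by apply: h => _; rewrite gtr0_norm.
rewrite ge0_expectation_ccdf//; last by move=> x; exact: normr_ge0.
rewrite /age_law setTI; apply: eq_integral => s; rewrite inE/= in_itv/= andbT => s0.
rewrite EFinB distr_funE -probability_setC// setCitvl /ccdf /distribution /pushforward.
have -> : normR @^-1` `]s, +oo[ = `]s, +oo[ `|` `]-oo, -s[.
  apply/seteqP; split => x /=; rewrite !in_itv/= !andbT.
    have [x0|x0] := leP 0 x; first by rewrite ger0_norm//; left.
    by rewrite ltr0_norm// ltrNr; right.
  case=> h; first by rewrite (lt_le_trans h)// ler_norm.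
  apply: (@lt_le_trans _ _ (- x)); first by rewrite ltrNr.
  by rewrite -normrN ler_norm.
rewrite measureU0//; apply: subset_measure0 atomless_nonneg_le0 => //.
by move=> x /=; rewrite !in_itv/= => h; lra.
Qed.

#[local] HB.instance Definition _ :=
  Measure_isProbability.Build _ _ _ (age_law F0) ageT.

Lemma age_probability : exists mu : probability R R,
  forall A, measurable A -> mu A = age_law F0 A.
Proof. by exists (age_law F0 : probability R R). Qed.

Variable muF : probability R R.
Hypothesis muFE : forall A, measurable A -> muF A = age_law F0 A.

Lemma age_pos : muF `]-oo, 0]%classic = 0%E.
Proof.
rewrite muFE// /age_law (_ : _ `&` _ = [set 0]) ?integral_set1//.
apply/seteqP; split => x /=; rewrite !in_itv/= andbT.
  by move=> [? ?]; apply/eqP; rewrite eq_le; apply/andP.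
by move=> ->.
Qed.

Lemma age_atomless (x : R) : muF [set x] = 0%E.
Proof. by rewrite muFE// /age_law (integral_Sset1 x)//; exact: subIsetl. Qed.

(** The density [1 - F_0] is nonincreasing. After scaling, these are the inequalities of
    [hit_prob_increments], so that [increments_unique] applies to the pair. *)
Lemma age_increments (x y : R) : 0 <= x <= y ->
  (y - x) * (1 - distr_fun F0 y) <= distr_fun muF y - distr_fun muF x <=
  (y - x) * (1 - distr_fun F0 x).
Proof.
move=> /andP[x0 xy].
have E : (distr_fun muF y - distr_fun muF x)%:E =
    (\int[lebesgue_measure]_(s in `]x, y]) surv s)%E.
  have xyE : muF `]x, y]%classic = (\int[lebesgue_measure]_(s in `]x, y]) surv s)%E.
    rewrite muFE// /age_law setIidl// => s /=; rewrite !in_itv/= andbT.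
    by move=> /andP[? _]; apply: le_trans x0 (ltW _).
  by rewrite -xyE distr_fun_itv.
have C (c : R) : ((y - x) * c)%:E = (\int[lebesgue_measure]_(s in `]x, y]) (cst c%:E s))%E.
  rewrite integral_cst// mulrC EFinM; congr (_ * _)%E.
  have := @lebesgue_measure_itv R `]x, y]; rewrite /= lte_fin.
  case: ltP => [_ ->//|yx ->].
  by congr EFin; apply/eqP; rewrite subr_eq0 eq_le yx xy.
rewrite -!lee_fin E !C; apply/andP; split; apply: ge0_le_integral => //.
- by move=> s _; rewrite lee_fin subr_ge0 distr_fun_le1.
- exact: measurable_surv.
- move=> s /=; rewrite in_itv/= => /andP[_ sy].
  by rewrite lee_fin lerD2l lerN2 distr_fun_homo.
- exact: measurable_surv.
- move=> s /=; rewrite in_itv/= => /andP[sx _].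
  by rewrite lee_fin lerD2l lerN2 distr_fun_homo// ltW.
Qed.

End age_law.

Section independent_product.
Context {R : realType} {d : measure_display} {Omega : measurableType d}.
Variable P : probability Omega R.

(** Both sides are integrals of tails over [r >= 0], and the product exceeds such an r exactly when
    f does and the outcome is in [A]. Independence is thus used level by level. *)
Lemma integral_indep_indic (f : Omega -> R) (A : set Omega) :
  measurable_fun [set: Omega] f -> (forall w, 0 <= f w) -> measurable A ->
  (forall r, 0 <= r ->
     P ([set w | r < f w] `&` A) = (P [set w | r < f w]%R * P A)%E) ->
  (\int[P]_w (f w * \1_A w)%:E = (\int[P]_w (f w)%:E) * P A)%E.
Proof.
move=> mf f0 mA ind.
have mg : measurable_fun setT (fun w => f w * \1_A w).
  by apply: measurable_funM => //; exact: measurable_indic.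
pose X : {mfun Omega >-> R} := HB.pack f (isMeasurableFun.Build _ _ _ _ _ mf).
pose Y : {mfun Omega >-> R} :=
  HB.pack (fun w => f w * \1_A w) (isMeasurableFun.Build _ _ _ _ _ mg).
have Y0 w : 0 <= Y w by rewrite mulr_ge0.
have eX : (\int[P]_w (f w)%:E = \int[lebesgue_measure]_(r in `[0%R, +oo[) ccdf (P := P) X r)%E.
  by rewrite -ge0_expectation_ccdf// expectation_def.
have eY : (\int[P]_w (f w * \1_A w)%:E =
    \int[lebesgue_measure]_(r in `[0%R, +oo[) ccdf (P := P) Y r)%E.
  by rewrite -ge0_expectation_ccdf// expectation_def.
rewrite eX eY muleC -ge0_integralZl//; last first.
  by apply: measurable_funTS; exact: ccdf_measurable.
apply: eq_integral => r; rewrite inE/= in_itv/= andbT => r0.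
rewrite muleC /ccdf /distribution /pushforward.
have -> : X @^-1` `]r, +oo[ = [set w | r < f w].
  by apply/seteqP; split => w /=; rewrite in_itv/= andbT.
rewrite -ind//; congr (P _); apply/seteqP; split => w /=;
  rewrite in_itv/= andbT indicE.
  case: (boolP (w \in A)) => [|_]; first by rewrite inE mulr1.
  by rewrite mulr0 ltNge r0.
by move=> [? /mem_set ->]; rewrite mulr1.
Qed.

End independent_product.

(** * Laws of the age and of the stochastic intensity at time 0 *)

Section renewal.
Context {R : realType} {d : measure_display} {Omega : measurableType d}.
Variable P : probability Omega R.
Variable theta : R -> Omega -> Omega.
Variable Phi : R.-ker Omega ~> R.
Variable lam : R.
Variable F0 : probability R R.
Variable muF : probability R R.
Variable Q : probability Omega R.
Hypothesis flow : preserving_flow P theta.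
Hypothesis lam_gt0 : 0 < lam.
Hypothesis intensityE : intensity P Phi = lam%:E.
Hypothesis renewal :
  stationary_renewal P theta Phi (fun t => distr_fun F0 (lam * t)).
Hypothesis QE : forall A, measurable A -> Q A = palm P theta Phi A.
Hypothesis F0_atomless : forall x, F0 [set x] = 0%E.
Hypothesis F0_supp : F0 `[0, +oo[%classic = 1%E.
Hypothesis muFE : forall A, measurable A -> muF A = age_law F0 A.

Let pp : is_point_process Phi. Proof. by case: renewal. Qed.
Let F0_pos : F0 `]-oo, 0]%classic = 0%E.
Proof. exact: atomless_nonneg_le0. Qed.

Lemma hit_prob_age (a : R) : hit_prob P Phi a = distr_fun muF (lam * a).
Proof.
have [a0|a0] := leP a 0.
  rewrite hit_prob_le0//; apply/esym/eqP; rewrite -eqe distr_funE -measure_le0.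
  apply: (@le_trans _ _ (muF `]-oo, 0]%classic)); last by rewrite (age_pos muFE).
  rewrite le_measure ?inE// => x /=; rewrite !in_itv/= => /le_trans; apply.
  by rewrite mulr_ge0_le0// ltW.
apply: (@increments_unique R lam (hit_prob P Phi) (fun a => distr_fun muF (lam * a))
  (fun a => distr_fun F0 (lam * a))) => //; last exact: ltW.
- exact: ltW.
- rewrite hit_prob_le0// mulr0; apply/esym/eqP.
  by rewrite -eqe distr_funE (age_pos muFE).
- by move=> b; rewrite distr_fun_ge0 distr_fun_le1.
- exact: hit_prob_homo.
- by move=> x y xy; apply: distr_fun_homo; rewrite ler_pM2l.
- move=> n b b0.
  exact: (hit_prob_increments flow lam_gt0 intensityE renewal QE F0_atomless F0_pos).
move=> n b b0.
have h0 : 0 < n.+1%:R^-1 :> R by rewrite invr_gt0.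
have := @age_increments R F0 muF muFE (lam * b) (lam * (b + n.+1%:R^-1)).
rewrite -mulrBr addrAC subrr add0r; apply; apply/andP; split.
  by rewrite mulr_ge0// ltW.
by rewrite ler_pM2l// lerDl ltW.
Qed.

Lemma hit_prob_tail (e : R) : 0 < e ->
  exists n : nat, 1 - e < hit_prob P Phi n%:R.
Proof.
move=> /(distr_fun_tail muF)[x0 hx].
exists (Num.truncn (`|x0| / lam)).+1; rewrite hit_prob_age; apply: hx.
apply: le_trans (ler_norm x0) _.
by rewrite -ler_pdivrMl// mulrC ltW// truncnS_gt.
Qed.

Let mvoid (B : set R) : measurable B -> measurable [set w | Phi w B = 0%E].
Proof. exact: measurable_void. Qed.

(** Shifting []0, -x]] by x gives []x, 0]], closed at 0, whereas the last point concerns []x, 0[];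
    the difference is the null event of a point at 0. *)
Lemma void_past_prob (x : R) :
  P [set w | Phi w `]x, 0%R[%classic = 0%E] = (1 - hit_prob P Phi (- x))%:E.
Proof.
have [x0|x0] := leP 0 x.
  rewrite hit_prob_le0 ?oppr_le0// subr0 (_ : mkset _ = setT) ?probability_setT//.
  rewrite -subTset => w _ /=.
  by rewrite set_itv_ge ?measure0// bnd_simp -leNgt.
rewrite -void_probE.
rewrite -(stationary_void flow renewal false false 0 (- x) x) add0r addNr.
have mf : measurable [set w | Phi w [set 0] <> 0%E].
  exact: measurableC (mvoid (measurable_set1 (0 : R))).
have f0 := no_fixed_atom flow lam_gt0 intensityE renewal QE 0.
rewrite -[RHS](measureU0 (mvoid (measurable_itv `]x, 0])) mf f0).
rewrite -[LHS](measureU0 (mvoid (measurable_itv `]x, 0[)) mf f0).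
congr (P _); apply/seteqP; split => w /= [h|]; last by right.
- have [h0|h0] := pselect (Phi w [set 0] = 0%E); last by right.
  left; apply: (@subset_measure0 _ _ _ (Phi w) _ (`]x, 0[ `|` [set 0])) => //.
  + exact: measurableU.
  + move=> y /=; rewrite !in_itv/= => /andP[-> /=].
    by rewrite le_eqVlt => /orP[/eqP|]; [right|left].
  + exact: null_set_setU.
- by right.
- left; apply: subset_measure0 h => // y /=.
  by rewrite !in_itv/= => /andP[-> /ltW].
Qed.

(* [P] is the law of [Phi] seen from a typical time; the lemma is also applied
   to Palm probabilities of other processes. *)
Lemma last_point_void_prob (mu : probability Omega R) (x : R) :
  mu (no_past Phi) = 0%E ->
  mu [set w | last_point_before (Phi w) 0 <= x] =
  mu [set w | Phi w `]x, 0%R[%classic = 0%E].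
Proof.
move=> np0; have ml := measurable_sublevel x (measurable_last_point pp).
have mn := measurable_no_past Phi.
rewrite -[LHS](measureU0 ml mn np0) -[RHS](measureU0 (mvoid (measurable_itv _)) mn np0).
congr (mu _); apply/seteqP; split => w /=.
  have [np|np] := pselect (no_past Phi w); [by right|].
  by case=> // /(void_last_point pp) h; left; exact: h.
by case=> [/(last_point_void pp)|]; [|right].
Qed.

(** An empty past makes every window []-n, 0[] void, and [hit_prob] tends to 1. The measure [mu] is
    left free in order to cover Palm probabilities of other processes. *)
Lemma no_past_null (mu : probability Omega R) :
  (forall n : nat, mu [set w | Phi w `]- n%:R, 0%R[%classic = 0%E] =
     (1 - hit_prob P Phi n%:R)%:E) ->
  mu (no_past Phi) = 0%E.
Proof.
move=> h; apply/eqP; rewrite eq_le measure_ge0 andbT; apply/lee_addgt0Pr => e e0.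
rewrite add0e; have [n hn] := hit_prob_tail e0.
apply: (@le_trans _ _ (mu [set w | Phi w `]- n%:R, 0%R[%classic = 0%E])).
  rewrite le_measure ?inE//; [exact: measurable_no_past|exact: mvoid|].
  by move=> w /(_ n I).
by rewrite h lee_fin; lra.
Qed.

Lemma stationary_no_past : P (no_past Phi) = 0%E.
Proof. by apply: no_past_null => n; rewrite void_past_prob opprK. Qed.

Lemma stationary_last_point (A : set R) : measurable A ->
  P ((fun w => last_point_before (Phi w) 0) @^-1` A) =
  muF ((fun t => - (t / lam)) @^-1` A).
Proof.
have ms : measurable_fun [set: R] (fun t : R => - (t / lam)).
  by apply: measurable_funN; exact: mulrr_measurable.
apply: (eq_law (measurable_last_point pp) ms).
  by rewrite ltey_eq fin_num_measure.
move=> x; rewrite [LHS]last_point_void_prob ?stationary_no_past//.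
rewrite void_past_prob hit_prob_age mulrN EFinB distr_funE.
(* A last point at or before x means a scaled age at least [-lam * x]; the strict form of the
   distribution function is needed to complement it. *)
rewrite -atomless_lt; last exact: (age_atomless muFE).
rewrite -probability_setC// setCitvl; congr (muF _).
apply/seteqP; split => t /=; rewrite in_itv/= andbT.
  by rewrite lerNl lerNl => h; rewrite lerNl ler_pdivlMr// mulNr mulrC.
by rewrite lerNl ler_pdivlMr// mulNr mulrC.
Qed.

Lemma palm_last_point_law (A : set R) : measurable A ->
  Q ((fun w => last_point_before (Phi w) 0) @^-1` A) =
  F0 ((fun t => - (t / lam)) @^-1` A).
Proof.
move=> mA.
have ms : measurable_fun [set: R] (fun t : R => t / lam).
  exact: mulrr_measurable.
have ml : measurable_fun setT (fun w => - last_point_before (Phi w) 0).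
  by apply: measurable_funN; exact: measurable_last_point.
have mN : measurable (-%R @^-1` A : set R).
  by rewrite -[X in measurable X]setTI; exact: oppr_measurable.
have h := @eq_law R _ _ _ _ Q F0 _ _ ml ms _ _ _ mN.
transitivity (Q ((fun w => - last_point_before (Phi w) 0) @^-1` (-%R @^-1` A))).
  by congr (Q _); apply/seteqP; split => w /=; rewrite opprK.
rewrite h//.
  by rewrite ltey_eq fin_num_measure.
move=> x; rewrite [LHS](palm_last_point flow renewal QE); congr (F0 _).
by apply/seteqP; split => y /=; rewrite !in_itv/= ler_pdivrMr// mulrC.
Qed.

Variable eta : R -> R.
Hypothesis measurable_eta : measurable_fun [set: R] eta.
Hypothesis eta_ge0 : forall t, 0 <= eta t.

Lemma measurable_stoch_intensity :
  measurable_fun [set: Omega] (fun w => stoch_intensity eta lam (Phi w) 0).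
Proof.
apply: measurable_funM => //; apply: measurableT_comp => //.
apply: measurable_funM => //; apply: measurable_funB => //.
exact: measurable_last_point.
Qed.

Let intensity_level (x : R) :
  (fun t => - (t / lam)) @^-1`
    [set s | scaled_hazard eta lam (0 - s) <= x] =
  eta @^-1` `[0, x / lam].
Proof.
apply/seteqP; split => t /=; rewrite in_itv/= eta_ge0 /scaled_hazard sub0r opprK;
by rewrite [lam * (t / lam)]mulrC divfK ?gt_eqF// ler_pdivlMr// mulrC.
Qed.

Let measurable_level (x : R) :
  measurable [set s | scaled_hazard eta lam (0 - s) <= x].
Proof.
apply: measurable_sublevel; apply: measurable_funM => //.
apply: measurableT_comp => //; apply: measurable_funM => //.
exact: measurable_funB.
Qed.

Lemma stationary_intensity_law (x : R) :
  P [set w | stoch_intensity eta lam (Phi w) 0 <= x] =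
  (hazard_distr (age_law F0) eta (x / lam))%:E.
Proof.
have me : measurable (eta @^-1` `[0, x / lam]).
  by rewrite -[X in measurable X]setTI; exact: measurable_eta.
rewrite [LHS](stationary_last_point (measurable_level x)) intensity_level.
by rewrite /hazard_distr -muFE// fineK ?fin_num_measure.
Qed.

Lemma palm_intensity_law (x : R) :
  Q [set w | stoch_intensity eta lam (Phi w) 0 <= x] =
  (hazard_distr F0 eta (x / lam))%:E.
Proof.
have me : measurable (eta @^-1` `[0, x / lam]).
  by rewrite -[X in measurable X]setTI; exact: measurable_eta.
rewrite [LHS](palm_last_point_law (measurable_level x)) intensity_level.
by rewrite /hazard_distr fineK ?fin_num_measure.
Qed.

End renewal.

(** * Independent processes under the Palm probability of one of them *)

Section independent_inputs.
Context {R : realType} {d : measure_display} {Omega : measurableType d}.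
Variable P : probability Omega R.
Variable theta : R -> Omega -> Omega.
Context {N : nat}.
Variable Phi : 'I_N -> R.-ker Omega ~> R.
Variable lam : 'I_N -> R.
Variable F0 : probability R R.
Variable muF : probability R R.
Variable Q : 'I_N -> probability Omega R.
Hypothesis flow : preserving_flow P theta.
Hypothesis lam_gt0 : forall i, 0 < lam i.
Hypothesis intensityE : forall i, intensity P (Phi i) = (lam i)%:E.
Hypothesis renewal : forall i,
  stationary_renewal P theta (Phi i) (fun t => distr_fun F0 (lam i * t)).
Hypothesis indep : independent_processes P Phi.
Hypothesis QE : forall i A, measurable A -> Q i A = palm P theta (Phi i) A.
Hypothesis F0_atomless : forall x, F0 [set x] = 0%E.
Hypothesis F0_supp : F0 `[0, +oo[%classic = 1%E.
Hypothesis muFE : forall A, measurable A -> muF A = age_law F0 A.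

Let pp i : is_point_process (Phi i). Proof. by case: (renewal i). Qed.
Let fc i : flow_compatible theta (Phi i). Proof. by case: (renewal i). Qed.
Let F0_pos : F0 `]-oo, 0]%classic = 0%E.
Proof. exact: atomless_nonneg_le0. Qed.
Let mvoid i (B : set R) : measurable B -> measurable [set w | Phi i w B = 0%E].
Proof. exact: measurable_void. Qed.

Let count i (n : nat) (w : Omega) : R := fine (Phi i w `]0%R, (n.+1%:R^-1)%R]%classic).

Let countE i n w : (count i n w)%:E = Phi i w `]0%R, (n.+1%:R^-1)%R]%classic.
Proof.
have sub : `]0, n.+1%:R^-1] `<=` (`[0, n.+1%:R^-1] : set R).
  by move=> y /=; rewrite !in_itv/= => /andP[/ltW -> ->].
rewrite /count; have [k ->] := pp i w (measurable_itv `]0, n.+1%:R^-1]) sub.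
by [].
Qed.

Let measurable_count i n : measurable_fun setT (count i n).
Proof.
apply: measurableT_comp => //; exact: measurable_kernel.
Qed.

(* If [D] holds at a point of [Phi i] in a short window then so does [A] at the
   origin, and [A] is independent of the number of points in the window. *)
Lemma palm_le_indep i (n : nat) (D A : set Omega) :
  measurable D -> measurable A ->
  (forall w (s : R), 0 < s <= n.+1%:R^-1 -> D (theta s w) -> A w) ->
  (forall r, P ([set w | r < count i n w] `&` A) =
     (P [set w | r < count i n w]%R * P A)%E) ->
  (Q i D <= P A)%E.
Proof.
move=> mD mA DA ind.
have h0 : 0 < n.+1%:R^-1 :> R by rewrite invr_gt0.
have sub : `]0, n.+1%:R^-1] `<=` (`[0, n.+1%:R^-1] : set R).
  by move=> y /=; rewrite !in_itv/= => /andP[/ltW -> ->].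
have l0 : (0 < (lam i / n.+1%:R)%:E)%E by rewrite lte_fin divr_gt0.
rewrite -(lee_pmul2l _ l0)//.
rewrite -(campbell_palm flow (pp i) (lam_gt0 i) (intensityE i) n (fc i) (QE i) mD).
have cT := campbell_palm flow (pp i) (lam_gt0 i) (intensityE i) n (fc i) (QE i) measurableT.
rewrite probability_setT mule1 campbell_setT in cT; rewrite -cT.
have -> : (\int[P]_w Phi i w `]0%R, (n.+1%:R^-1)%R]%classic =
    \int[P]_w (count i n w)%:E)%E by apply: eq_integral => w _; rewrite countE.
have c0 w : 0 <= count i n w by rewrite fine_ge0.
rewrite -integral_indep_indic//.
apply: ge0_le_integral => //.
- exact: (measurable_marked flow (pp i) _ sub mD).
- by apply/measurable_EFinP; apply: measurable_funM.
move=> w _; rewrite indicE /marked; case: (boolP (w \in A)) => wA /=.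
  rewrite mulr1 countE le_measure ?inE//; apply: measurableI => //.
  exact: (measurable_flow_times flow w mD).
rewrite mulr0 (_ : _ `&` _ = set0) ?measure0//.
rewrite -subset0 => s [/=]; rewrite in_itv/= => s0h Ds.
by move: wA; rewrite notin_setE; apply; apply: DA Ds.
Qed.

Let sigma_void i (B : set R) : measurable B ->
  pp_sigma_algebra (Phi i) [set w | Phi i w B = 0%E].
Proof.
move=> mB; apply: sub_sigma_algebra; exists B, [set 0%E]; split => //.
Qed.

Let sigma_count i n r : pp_sigma_algebra (Phi i) [set w | r < count i n w].
Proof.
apply: sub_sigma_algebra; exists `]0, n.+1%:R^-1]%classic, `]r%:E, +oo[%classic.
split; [exact: measurable_itv|exact: emeasurable_itv|].
by apply/seteqP; split => w /=; rewrite in_itv/= -countE lte_fin andbT.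
Qed.

Let sigma_T i : pp_sigma_algebra (Phi i) setT.
Proof. by apply: sub_sigma_algebra; exists set0, setT; split. Qed.

Let others (i : 'I_N) (E : 'I_N -> set Omega) : set Omega :=
  [set w | forall j, j != i -> E j w].

Let indep_insert i (C : set Omega) (E : 'I_N -> set Omega) :
  pp_sigma_algebra (Phi i) C -> (forall j, pp_sigma_algebra (Phi j) (E j)) ->
  P (C `&` others i E) = (P C * \prod_(j < N | j != i) P (E j))%E.
Proof.
move=> sC sE; have := @indep (fun j => if j == i then C else E j).
rewrite (bigD1 i)//= eqxx => h.
have E2 : (\prod_(j < N | j != i) P (if j == i then C else E j) =
    \prod_(j < N | j != i) P (E j))%E by apply: eq_bigr => j /negPf ->.
rewrite E2 in h.
rewrite -h; last by move=> j; case: eqP => // ->.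
congr (P _); apply/seteqP; split => w /=.
  by move=> [Cw Ew] j; case: eqP => // /eqP; exact: Ew.
move=> h'; split; first by have := h' i; rewrite eqxx.
by move=> j ji; have := h' j; rewrite (negPf ji).
Qed.

Let othersE i (E : 'I_N -> set Omega) :
  (forall j, pp_sigma_algebra (Phi j) (E j)) ->
  P (others i E) = (\prod_(j < N | j != i) P (E j))%E.
Proof.
move=> sE; have := indep_insert (@sigma_T i) sE.
by rewrite setTI probability_setT mul1e.
Qed.

Let measurable_others i (B : 'I_N -> set R) : (forall j, measurable (B j)) ->
  measurable (others i (fun j => [set w | Phi j w (B j) = 0%E])).
Proof.
move=> mB; rewrite (_ : others _ _ = \bigcap_(j in [set j | j != i])
    [set w | Phi j w (B j) = 0%E]); last by [].
apply: fin_bigcap_measurable; first exact: finite_finset.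
by move=> j _; exact: mvoid.
Qed.

Let count_others i n (B : 'I_N -> set R) r : (forall j, measurable (B j)) ->
  let A := others i (fun j => [set w | Phi j w (B j) = 0%E]) in
  P ([set w | r < count i n w] `&` A) = (P [set w | (r < count i n w)%R] * P A)%E.
Proof.
move=> mB A; rewrite indep_insert ?othersE// => j; exact: sigma_void.
Qed.

Let count_othersC i n (B : 'I_N -> set R) r : (forall j, measurable (B j)) ->
  let A := others i (fun j => [set w | Phi j w (B j) = 0%E]) in
  P ([set w | r < count i n w] `&` ~` A) =
  (P [set w | (r < count i n w)%R] * P (~` A))%E.
Proof.
move=> mB A; have mA : measurable A by exact: measurable_others.
set C := [set w | r < count i n w].
have mC : measurable C.
  rewrite (_ : C = ~` [set w | count i n w <= r]).
    by apply: measurableC; exact: measurable_sublevel.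
  by apply/seteqP; split => w /=; rewrite /C /= ltNge => /negP.
have H : P (C `&` A) = (P C * P A)%E by exact: count_others.
have HD : P (C `\` A) = (P C - P (C `&` A))%E.
  by rewrite measureD// ltey_eq fin_num_measure.
rewrite -setDE HD H.
rewrite probability_setC// muleBr ?fin_num_measure// ?mule1//.
Qed.

Let void_others i (B : 'I_N -> set R) : (forall j, measurable (B j)) ->
  P (others i (fun j => [set w | Phi j w (B j) = 0%E])) =
  (\prod_(j < N | j != i) P [set w | Phi j w (B j) = 0%E])%E.
Proof. by move=> mB; rewrite othersE// => j; exact: sigma_void. Qed.

(** Seen from a point s of [Phi i] in []0, h]], the interval []x j, 0[] becomes []x j + s, s[],
    which contains []x j + h, 0]] and is contained in []x j, h]]. These intervals are independent of
    the points of [Phi i] in the window; they give bounds [U] and [V] with a common limit as h tends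
    to 0. *)
Lemma palm_void_others i (x : 'I_N -> R) :
  Q i [set w | forall j, j != i -> Phi j w `]x j, 0%R[%classic = 0%E] =
  (\prod_(j < N | j != i) (1 - hit_prob P (Phi j) (- x j)))%:E.
Proof.
pose B j : set R := `]x j, 0[%classic.
set D := [set w | _].
have mD : measurable D := measurable_others i (fun j => measurable_itv `]x j, 0[).
pose U (n : nat) := \prod_(j < N | j != i)
  (1 - hit_prob P (Phi j) (- x j - n.+1%:R^-1)).
pose V (n : nat) := \prod_(j < N | j != i)
  (1 - hit_prob P (Phi j) (- x j + n.+1%:R^-1)).
have h0 n : 0 < n.+1%:R^-1 :> R by rewrite invr_gt0.
have UE n : P (others i (fun j => [set w | Phi j w `](x j + n.+1%:R^-1)%R, 0%R]%classic = 0%E]))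
    = (U n)%:E.
  rewrite (void_others i (B := fun j => `]x j + n.+1%:R^-1, 0]%classic))//.
  rewrite /U -prodEFin; apply: eq_bigr => j _; rewrite -void_probE.
  rewrite -(stationary_void flow (renewal j) false false 0 _ (x j + n.+1%:R^-1)).
  by rewrite add0r -opprD addNr.
have VE n : P (others i (fun j => [set w | Phi j w `]x j, (n.+1%:R^-1)%R]%classic = 0%E]))
    = (V n)%:E.
  rewrite (void_others i (B := fun j => `]x j, n.+1%:R^-1]%classic))//.
  rewrite /V -prodEFin; apply: eq_bigr => j _; rewrite -void_probE.
  rewrite -(stationary_void flow (renewal j) false false 0 _ (x j)).
  by rewrite add0r addrAC addNr add0r.
have DU n : (Q i D <= (U n)%:E)%E.
  rewrite -UE; apply: (palm_le_indep (n := n)) => //.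
  - exact: measurable_others.
  - move=> w s /andP[s0 sh] Dw j ji; have := Dw j ji.
    rewrite (shift_itv (renewal j)) add0r; apply: subset_measure0 => // y /=.
    rewrite !in_itv/= => /andP[y1 y2]; apply/andP; split.
      by apply: le_lt_trans y1; rewrite lerD2l.
    exact: le_lt_trans s0.
  - by move=> r; exact: count_others.
(* The lower bound on [D] is an upper bound on its complement, since [palm_le_indep] works in one
   direction only. *)
have DV n : (Q i (~` D) <= (1 - V n)%:E)%E.
  rewrite EFinB -VE -probability_setC; last exact: measurable_others.
  apply: (palm_le_indep (n := n)).
  - exact: measurableC.
  - by apply: measurableC; exact: measurable_others.
  - move=> w s /andP[s0 sh] Dw H; apply: Dw => j ji; have := H j ji.
    rewrite (shift_itv (renewal j)) add0r; apply: subset_measure0 => // y /=.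
    rewrite !in_itv/= => /andP[y1 y2]; apply/andP; split.
      by apply: lt_trans y1; rewrite ltrDl.
    exact: le_trans (ltW y2) sh.
  - by move=> r; exact: count_othersC.
pose W := \prod_(j < N | j != i) (1 - hit_prob P (Phi j) (- x j)).
have lip j n a : hit_prob P (Phi j) (a + n.+1%:R^-1) <=
    hit_prob P (Phi j) a + lam j / n.+1%:R.
  exact: (hit_prob_lipschitz flow (lam_gt0 j) (intensityE j) (renewal j) (QE j)
    F0_atomless F0_pos).
have cvg0 (j : 'I_N) : lam j / n.+1%:R @[n --> \oo] --> (0 : R).
  by rewrite -(mulr0 (lam j)); apply: cvgMr; exact: cvg_harmonic.
have cprod (f : 'I_N -> nat -> R) (l : 'I_N -> R) :
    (forall j, f j n @[n --> \oo] --> l j) ->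
    \prod_(j < N | j != i) f j n @[n --> \oo] --> \prod_(j < N | j != i) l j.
  move=> fl; exact: (@cvg_big R _ _ 1 (fun j => j != i) (@mul_continuous R)
    _ _ _ f l _ (fun j _ => fl j)).
have cU : U n @[n --> \oo] --> W.
  apply: cprod => j.
  apply: cvgB; first exact: cvg_cst.
  apply: (squeeze_cvgr (f := fun n => hit_prob P (Phi j) (- x j) - lam j / n.+1%:R)
    (h := fun=> hit_prob P (Phi j) (- x j))); last exact: cvg_cst.
    near=> n; apply/andP; split.
      by rewrite lerBlDr; apply: le_trans (lip _ _ _); rewrite subrK.
    by apply: hit_prob_homo; rewrite gerBl ltW.
  by rewrite -[X in _ --> X]subr0; apply: cvgB => //; exact: cvg_cst.
have cV : V n @[n --> \oo] --> W.
  apply: cprod => j.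
  apply: cvgB; first exact: cvg_cst.
  apply: (squeeze_cvgr (h := fun n => hit_prob P (Phi j) (- x j) + lam j / n.+1%:R)
    (f := fun=> hit_prob P (Phi j) (- x j))); first 1 last.
  - exact: cvg_cst.
  - by rewrite -[X in _ --> X]addr0; apply: cvgD => //; exact: cvg_cst.
  near=> n; apply/andP; split; last exact: lip.
  by apply: hit_prob_homo; rewrite lerDl ltW.
have QDE : Q i D = (fine (Q i D))%:E by rewrite fineK ?fin_num_measure.
rewrite -/W QDE; congr EFin; apply/eqP; rewrite eq_le; apply/andP; split.
  rewrite -(cvg_lim _ cU)//; apply: limr_ge; first by apply/cvg_ex; exists W.
  by apply: nearW => n; rewrite -lee_fin -QDE.
rewrite -(cvg_lim _ cV)//; apply: limr_le; first by apply/cvg_ex; exists W.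
apply: nearW => n; rewrite -lee_fin -QDE.
have := DV n; rewrite probability_setC// QDE -EFinB !lee_fin; lra.
Unshelve. all: by end_near. Qed.

(** A common point in the window puts a point of [Phi j] in []0, h]], an event independent of
    [Phi i] and of probability at most [lam j * h], with h arbitrarily small. *)
Lemma palm_no_common_point (i j : 'I_N) : j != i ->
  Q i [set w | Phi j w [set 0] <> 0%E] = 0%E.
Proof.
move=> ji; have m0 : measurable [set w | Phi j w [set 0] <> 0%E].
  exact: measurableC (mvoid j (measurable_set1 (0 : R))).
apply/eqP; rewrite eq_le measure_ge0 andbT; apply/lee_addgt0Pr => e e0.
rewrite add0e; have /ltr_add_invr[n] : 0 < e / lam j by exact: divr_gt0.
rewrite add0r => hn; apply: (@le_trans _ _ (lam j / n.+1%:R)%:E); last first.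
  by rewrite lee_fin mulrC -ler_pdivlMr// ltW.
apply: le_trans (not_void_le flow (lam_gt0 j) (intensityE j) (renewal j) (QE j) n).
(* Empty sets are void for every process, so the condition on all the other processes reduces to one
   on j. *)
pose B k : set R := if k == j then `]0, n.+1%:R^-1]%classic else set0.
have mB k : measurable (B k) by rewrite /B; case: ifP.
have AE : [set w | Phi j w `]0%R, (n.+1%:R^-1)%R]%classic <> 0%E] =
    ~` others i (fun k => [set w | Phi k w (B k) = 0%E]).
  apply/seteqP; split => w /= h H.
    by apply: h; have := H j ji; rewrite /= /B eqxx.
  apply: h => k ki /=; rewrite /B; case: eqP => [->//|_]; exact: measure0.
apply: (palm_le_indep (n := n)) => //.
- exact: measurableC (mvoid j _).
- move=> w s /andP[s0 sh] /=; rewrite (shift_atom (renewal j)) => h h'; apply: h.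
  by apply: subset_measure0 h' => // _ ->; rewrite /= in_itv/= s0.
- by move=> r; rewrite AE; exact: count_othersC.
Qed.

End independent_inputs.

(** * Joint laws of two variables, and Chebyshev's inequality for pairwise independent events *)

Section joint_law.
Context {R : realType} {d : measure_display} {Omega : measurableType d}.
Variables P Q : probability Omega R.
Variables f g : Omega -> R.
Hypothesis mf : measurable_fun [set: Omega] f.
Hypothesis mg : measurable_fun [set: Omega] g.

Let mpre (h : Omega -> R) (A : set R) : measurable_fun [set: Omega] h ->
  measurable A -> measurable (h @^-1` A).
Proof. by move=> mh mA; rewrite -[X in measurable X]setTI; exact: mh. Qed.

(** With [C] fixed, both sides are finite measures in [A], determined by half-lines. It is used once
    per coordinate. *)
Let extend (h : Omega -> R) (C : set Omega) (c : R) : 0 <= c ->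
  measurable_fun [set: Omega] h -> measurable C ->
  (forall x, Q ([set w | h w <= x] `&` C) = (c%:E * P [set w | (h w <= x)%R])%E) ->
  forall A, measurable A -> Q (h @^-1` A `&` C) = (c%:E * P (h @^-1` A))%E.
Proof.
move=> c0 mh mC H A mA.
apply: (@eq_law R _ _ _ _ (mrestr Q mC) (mscale (NngNum c0) P) h h mh mh) => //.
have : (Q (setT `&` C) < +oo)%E by rewrite ltey_eq fin_num_measure//; exact: measurableI.
exact.
Qed.

Lemma joint_law :
  (forall x y, Q ([set w | f w <= x] `&` [set w | g w <= y]) =
     (P [set w | (f w <= x)%R] * P [set w | (g w <= y)%R])%E) ->
  forall A B, measurable A -> measurable B ->
  Q (f @^-1` A `&` g @^-1` B) = (P (f @^-1` A) * P (g @^-1` B))%E.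
Proof.
move=> H A B mA mB.
have E C : measurable C -> P C = (fine (P C))%:E.
  by move=> mC; rewrite fineK ?fin_num_measure.
rewrite [P (f @^-1` A)]E; last exact: mpre.
rewrite setIC; apply: extend => //; [by rewrite fine_ge0|exact: mpre|].
move=> y; rewrite setIC -E; last exact: mpre.
rewrite [P [set w | g w <= y]]E; last exact: measurable_sublevel.
rewrite muleC; apply: extend => //; [by rewrite fine_ge0|exact: measurable_sublevel|].
move=> x; rewrite H -E; last exact: measurable_sublevel.
by rewrite muleC.
Qed.

End joint_law.

Section counting_events.
Context {R : realType} {d : measure_display} {Omega : measurableType d}.
Variable Q : probability Omega R.
Context {N : nat}.
Variable p : pred 'I_N.
Variable E : 'I_N -> set Omega.
Variable q : 'I_N -> R.
Hypothesis mE : forall j, measurable (E j).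
Hypothesis QE1 : forall j, p j -> Q (E j) = (q j)%:E.
Hypothesis QE2 : forall j k, p j -> p k -> j != k ->
  Q (E j `&` E k) = (q j * q k)%:E.

Let S (w : Omega) : R := \sum_(j < N | p j) \1_(E j) w.
Let m : R := \sum_(j < N | p j) q j.

Let q_ge0 j : p j -> 0 <= q j.
Proof. by move=> pj; rewrite -lee_fin -QE1. Qed.

Let q_le1 j : p j -> q j <= 1.
Proof. by move=> pj; rewrite -lee_fin -QE1// probability_le1. Qed.

Let m_ge0 : 0 <= m. Proof. exact: sumr_ge0. Qed.

Let S_ge0 w : 0 <= S w. Proof. exact: sumr_ge0. Qed.

Let measurable_S : measurable_fun setT S.
Proof.
rewrite /S; under eq_fun do rewrite big_mkcond.
apply: measurable_sum => j; case: (p j) => //; exact: measurable_indic.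
Qed.

Let integral_S : (\int[Q]_w (S w)%:E = m%:E)%E.
Proof.
under eq_integral do rewrite /S -sumEFin big_mkcond /=.
rewrite ge0_integral_sum//.
- rewrite /m -sumEFin [RHS]big_mkcond/=; apply: eq_bigr => j _.
  case: ifPn => pj; last by rewrite integral0.
  by rewrite integral_indic// setIT; exact: QE1.
- move=> j; case: (p j) => //.
  by apply/measurable_EFinP; exact: measurable_indic.
- by move=> j w _; case: ifPn => // _; rewrite lee_fin.
Qed.

(** Off the diagonal the terms are products of the [q j], already in [m ^+ 2]; each of the at most
    [N] diagonal terms adds at most 1. *)
Let integral_S2 : (\int[Q]_w (S w ^+ 2)%:E <= (m ^+ 2 + N%:R)%:E)%E.
Proof.
have SE w : (S w ^+ 2)%:E = (\sum_(j < N) \sum_(k < N)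
    (if p j && p k then \1_(E j `&` E k) w else 0%R)%:E)%E.
  rewrite expr2 /S big_distrlr/= -sumEFin big_mkcond/=; apply: eq_bigr => j _.
  rewrite sumEFin; case: (p j) => /=; last by rewrite big1.
  rewrite [in LHS]big_mkcond/=; congr EFin; apply: eq_bigr => k _.
  by case: (p k) => //; rewrite indicI.
under eq_integral do rewrite SE.
have mjk j k : measurable_fun setT
    (fun w => (if p j && p k then \1_(E j `&` E k) w else 0 : R)%:E).
  apply/measurable_EFinP; case: (p j && p k) => //.
  by apply: measurable_indic; exact: measurableI.
rewrite ge0_integral_sum//; last 2 first.
- by move=> j; apply: emeasurable_sum => k; exact: mjk.
- by move=> j w _; apply: sume_ge0 => k _; rewrite lee_fin; case: ifP.
have -> : (\sum_(j < N) \int[Q]_w \sum_(k < N)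
    (if p j && p k then \1_(E j `&` E k) w else 0%R)%:E)%E =
    (\sum_(j < N) \sum_(k < N) (if p j && p k then fine (Q (E j `&` E k)) else 0%R)%:E)%E.
  apply: eq_bigr => j _; rewrite ge0_integral_sum//; last first.
    by move=> k w _; rewrite lee_fin; case: ifP.
  apply: eq_bigr => k _; case: ifPn => [/andP[pj pk]|_]; last by rewrite integral0.
  rewrite integral_indic ?setIT ?fineK ?fin_num_measure//; exact: measurableI.
under eq_bigr do rewrite sumEFin.
rewrite sumEFin lee_fin.
have -> : N%:R = \sum_(j < N) (1 : R) by rewrite sumr_const card_ord.
have -> : m ^+ 2 = \sum_(j < N) \sum_(k < N) (if p j && p k then q j * q k else 0).
  rewrite expr2 /m big_distrlr/= big_mkcond/=; apply: eq_bigr => j _.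
  by case: (p j) => /=; [rewrite big_mkcond|rewrite big1].
rewrite -big_split/=; apply: ler_sum => j _.
rewrite [leLHS](bigD1 j)//= [X in _ <= X + _](bigD1 j)//=.
have -> : \sum_(k < N | k != j) (if p j && p k then fine (Q (E j `&` E k)) else 0) =
    \sum_(k < N | k != j) (if p j && p k then q j * q k else 0).
  apply: eq_bigr => k kj; case: ifPn => // /andP[pj pk].
  by rewrite QE2// eq_sym.
case: (boolP (p j)) => pj /=; last first.
  by rewrite !add0r lerDl.
rewrite setIid QE1//= addrAC lerD2r.
by have := q_le1 pj; have := mulr_ge0 (q_ge0 pj) (q_ge0 pj); lra.
Qed.

Lemma chebyshev_count (t : R) : 0 < t ->
  (Q [set w | (t <= `|S w - m|)%R] <= (N%:R / t ^+ 2)%:E)%E.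
Proof.
move=> t0; have mD : measurable_fun setT (fun w => S w - m) by exact: measurable_funB.
have mA : measurable [set w | t <= `|S w - m|].
  rewrite (_ : mkset _ = ~` [set w | `|S w - m| < t]); last first.
    by apply/seteqP; split => w /=; [rewrite leNgt => /negP|move/negP; rewrite -leNgt].
  apply: measurableC; apply: measurable_strict_sublevel.
  exact: measurableT_comp.
have mD2 : measurable_fun setT (fun w => (S w - m) ^+ 2).
  by apply: measurable_funX.
have var : (\int[Q]_w ((S w - m) ^+ 2)%:E <= N%:R%:E)%E.
  (* The cross term of the square is moved to the left so that every integrand is nonnegative. *)
  have I1 : (\int[Q]_w ((S w - m) ^+ 2 + 2 * m * S w)%:E =
      \int[Q]_w (S w ^+ 2 + m ^+ 2)%:E)%E.
    by apply: eq_integral => w _; congr EFin; ring.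
  have I2 : (\int[Q]_w ((S w - m) ^+ 2 + 2 * m * S w)%:E =
      \int[Q]_w ((S w - m) ^+ 2)%:E + (2 * m ^+ 2)%:E)%E.
    under eq_integral do rewrite EFinD.
    rewrite ge0_integralD//; last 4 first.
    - by move=> w _; rewrite lee_fin sqr_ge0.
    - exact/measurable_EFinP.
    - by move=> w _; rewrite lee_fin; apply: mulr_ge0 => //; apply: mulr_ge0.
    - by apply/measurable_EFinP; apply: measurable_funM.
    congr (_ + _)%E; under eq_integral do rewrite EFinM.
    rewrite ge0_integralZl//; last 3 first.
    - exact/measurable_EFinP.
    - by move=> w _; rewrite lee_fin.
    - by rewrite lee_fin mulr_ge0.
    by rewrite integral_S -EFinM; congr EFin; ring.
  have I3 : (\int[Q]_w (S w ^+ 2 + m ^+ 2)%:E =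
      \int[Q]_w (S w ^+ 2)%:E + (m ^+ 2)%:E)%E.
    under eq_integral do rewrite EFinD.
    rewrite ge0_integralD//; last 3 first.
    - by move=> w _; rewrite lee_fin sqr_ge0.
    - by apply/measurable_EFinP; apply: measurable_funX.
    - by move=> w _; rewrite lee_fin sqr_ge0.
    rewrite integral_cst//; congr (_ + _)%E.
    by rewrite -[RHS]mule1; congr (_ * _)%E; exact: probability_setT.
  have h : (\int[Q]_w ((S w - m) ^+ 2)%:E + (2 * m ^+ 2)%:E <=
      N%:R%:E + (2 * m ^+ 2)%:E)%E.
    rewrite -I2 I1 I3; apply: le_trans (leeD2r _ integral_S2) _.
    by rewrite -!EFinD lee_fin; lra.
  by rewrite leeD2rE in h.
have t20 : (0 < (t ^+ 2)%:E)%E by rewrite lte_fin exprn_gt0.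
rewrite -(lee_pmul2l _ t20)// -EFinM [X in (_ <= X%:E)%E](_ : _ = N%:R); last first.
  by rewrite mulrC divfK// gt_eqF// exprn_gt0.
apply: le_trans var; rewrite -[X in Q X]setIT -integral_indic//.
have mi : measurable_fun setT (fun w => (\1_[set w | t <= `|S w - m|] w : R)%:E).
  by apply/measurable_EFinP; exact: measurable_indic.
rewrite -ge0_integralZl//; last exact: ltW.
apply: ge0_le_integral => //.
- by move=> w _; rewrite mule_ge0// lee_fin// sqr_ge0.
- exact: emeasurable_funM.
- exact/measurable_EFinP.
move=> w _; rewrite -EFinM lee_fin indicE; case: (boolP (_ \in _)) => [|_].
  by rewrite inE /= mulr1 => tw; rewrite -[leRHS]real_normK ?num_real// lerXn2r ?nnegrE// ltW.
by rewrite mulr0 sqr_ge0.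
Qed.

End counting_events.

Lemma measurable_superlevel {R : realType} {d : measure_display}
    {T : measurableType d} (f : T -> R) (x : R) :
  measurable_fun [set: T] f -> measurable [set t | x <= f t].
Proof.
move=> mf; rewrite (_ : mkset _ = ~` [set t | f t < x]).
  by apply: measurableC; exact: measurable_strict_sublevel.
by apply/seteqP; split => t /=; [rewrite leNgt => /negP|move/negP; rewrite -leNgt].
Qed.

(** * Number of items above a level, seen from a point of one process *)

Section intensities_at_points.
Context {R : realType} {d : measure_display} {Omega : measurableType d}.
Variable P : probability Omega R.
Variable theta : R -> Omega -> Omega.
Context {N : nat}.
Variable Phi : 'I_N -> R.-ker Omega ~> R.
Variable lam : 'I_N -> R.
Variable F0 : probability R R.
Variable muF : probability R R.
Variable Q : 'I_N -> probability Omega R.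
Hypothesis flow : preserving_flow P theta.
Hypothesis lam_gt0 : forall i, 0 < lam i.
Hypothesis intensityE : forall i, intensity P (Phi i) = (lam i)%:E.
Hypothesis renewal : forall i,
  stationary_renewal P theta (Phi i) (fun t => distr_fun F0 (lam i * t)).
Hypothesis indep : independent_processes P Phi.
Hypothesis QE : forall i A, measurable A -> Q i A = palm P theta (Phi i) A.
Hypothesis F0_atomless : forall x, F0 [set x] = 0%E.
Hypothesis F0_supp : F0 `[0, +oo[%classic = 1%E.
Hypothesis muFE : forall A, measurable A -> muF A = age_law F0 A.
Variable eta : R -> R.
Hypothesis measurable_eta : measurable_fun [set: R] eta.
Hypothesis eta_ge0 : forall t, 0 <= eta t.

Let pp i : is_point_process (Phi i). Proof. by case: (renewal i). Qed.
Let F0_pos : F0 `]-oo, 0]%classic = 0%E.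
Proof. exact: atomless_nonneg_le0. Qed.
Let mvoid i (B : set R) : measurable B -> measurable [set w | Phi i w B = 0%E].
Proof. exact: measurable_void. Qed.
Let last i (w : Omega) : R := last_point_before (Phi i w) 0.
Let mlast i : measurable_fun setT (last i).
Proof. exact: measurable_last_point. Qed.

(** All other processes are given the empty interval []0, 0[], which contributes a factor 1. *)
Let palm_void_two i j k (x y : R) : j != i -> k != i -> j != k ->
  Q i ([set w | Phi j w `]x, 0%R[%classic = 0%E] `&`
       [set w | Phi k w `]y, 0%R[%classic = 0%E]) =
  ((1 - hit_prob P (Phi j) (- x)) * (1 - hit_prob P (Phi k) (- y)))%:E.
Proof.
move=> ji ki jk.
pose z m := if m == j then x else if m == k then y else 0.
have zj : z j = x by rewrite /z eqxx.
have zk : z k = y by rewrite /z eq_sym (negPf jk) eqxx.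
have zm m : m != j -> m != k -> z m = 0 by rewrite /z => /negPf -> /negPf ->.
have := palm_void_others flow lam_gt0 intensityE renewal indep QE F0_atomless F0_supp i z.
rewrite (bigD1 j)//= (bigD1 k)/=; last by rewrite ki eq_sym jk.
rewrite zj zk big1 ?mulr1; last first.
  move=> m /andP[/andP[_ mj] mk]; rewrite zm// oppr0 hit_prob_le0 ?subr0//.
move=> <-; congr (Q i _); apply/seteqP; split => w /=.
  move=> [hj hk] m mi; have [->|mj] := eqVneq m j; first by rewrite zj.
  have [->|mk] := eqVneq m k; first by rewrite zk.
  by rewrite zm// set_itv_ge ?measure0// bnd_simp ltxx.
by move=> h; split; [have := h _ ji; rewrite zj|have := h _ ki; rewrite zk].
Qed.

Let palm_void_one i j (x : R) : j != i ->
  Q i [set w | Phi j w `]x, 0%R[%classic = 0%E] =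
  (1 - hit_prob P (Phi j) (- x))%:E.
Proof.
move=> ji; pose z m := if m == j then x else 0.
have zj : z j = x by rewrite /z eqxx.
have zm m : m != j -> z m = 0 by rewrite /z => /negPf ->.
have := palm_void_others flow lam_gt0 intensityE renewal indep QE F0_atomless F0_supp i z.
rewrite (bigD1 j)//= zj big1 ?mulr1; last first.
  by move=> m /andP[_ mj]; rewrite zm// oppr0 hit_prob_le0 ?subr0.
move=> <-; congr (Q i _); apply/seteqP; split => w /=.
  move=> hj m mi; have [->|mj] := eqVneq m j; first by rewrite zj.
  by rewrite zm// set_itv_ge ?measure0// bnd_simp ltxx.
by move=> h; have := h _ ji; rewrite zj.
Qed.

Let stat_no_past j : P (no_past (Phi j)) = 0%E.
Proof.
exact: (stationary_no_past flow (lam_gt0 j) (intensityE j) (renewal j) (QE j)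
  F0_atomless F0_supp muFE).
Qed.

Let palm_no_past i j : j != i -> Q i (no_past (Phi j)) = 0%E.
Proof.
move=> ji; apply: (no_past_null flow (lam_gt0 j) (intensityE j) (renewal j) (QE j)
  F0_atomless F0_supp muFE) => n.
by rewrite palm_void_one// opprK.
Qed.

Let last_prob j x : P [set w | last j w <= x] = (1 - hit_prob P (Phi j) (- x))%:E.
Proof.
rewrite [LHS](last_point_void_prob (renewal j))//.
exact: (void_past_prob flow (lam_gt0 j) (intensityE j) (renewal j) (QE j)).
Qed.

Let palm_last_one i j (A : set R) : j != i -> measurable A ->
  Q i (last j @^-1` A) = P (last j @^-1` A).
Proof.
move=> ji; apply: (eq_law (mlast j) (mlast j)).
  by rewrite ltey_eq fin_num_measure.
move=> x; rewrite [RHS]last_prob [LHS](last_point_void_prob (renewal j))//.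
  exact: palm_void_one.
exact: palm_no_past.
Qed.

(** Pairs are what the second moment of a count involves. Outside the null event that j or k has no
    past, conditions on the last points are void conditions. *)
Let palm_last_two i j k (A B : set R) : j != i -> k != i -> j != k ->
  measurable A -> measurable B ->
  Q i (last j @^-1` A `&` last k @^-1` B) =
  (P (last j @^-1` A) * P (last k @^-1` B))%E.
Proof.
move=> ji ki jk; apply: joint_law => // x y.
have mle m z := measurable_sublevel z (mlast m).
have mn m := measurable_no_past (Phi m).
have n0 : Q i (no_past (Phi j) `|` no_past (Phi k)) = 0%E.
  by apply: null_set_setU => //; exact: palm_no_past.
have mU := measurableU _ _ (mn j) (mn k).
transitivity (Q i ([set w | Phi j w `]x, 0%R[%classic = 0%E] `&`
    [set w | Phi k w `]y, 0%R[%classic = 0%E])); last first.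
  by rewrite palm_void_two// EFinM -!last_prob.
rewrite -[LHS](measureU0 (measurableI _ _ (mle j x) (mle k y)) mU n0).
rewrite -[RHS](measureU0 (measurableI _ _ (mvoid j _) (mvoid k _)) mU n0)//.
congr (Q i _); apply/seteqP; split => w /=.
  have [npj|npj] := pselect (no_past (Phi j) w); first by right; left.
  have [npk|npk] := pselect (no_past (Phi k) w); first by right; right.
  case=> [[hj hk]|[]//]; left; split.
    exact: (void_last_point (pp j)) npj.
  exact: (void_last_point (pp k)) npk.
case=> [[hj hk]|]; last by right.
have [|npj] := last_point_void (pp j) hj; last by right; left.
have [|npk] := last_point_void (pp k) hk; last by right; right.
by left.
Qed.

Let X j (w : Omega) : R := stoch_intensity eta (lam j) (Phi j w) 0.

Let mX j : measurable_fun setT (X j).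
Proof. exact: (measurable_stoch_intensity (renewal j) measurable_eta). Qed.

Definition exceeds (x : R) j : set Omega :=
  [set w | x < stoch_intensity eta (lam j) (Phi j w) 0].

Let exceedsC x j : exceeds x j = ~` [set w | X j w <= x].
Proof. by apply/seteqP; split => w /=; rewrite /exceeds /= ltNge => /negP. Qed.

Lemma measurable_exceeds x j : measurable (exceeds x j).
Proof. by rewrite exceedsC; apply: measurableC; exact: measurable_sublevel. Qed.

Let level x j : set R := [set s | x < scaled_hazard eta (lam j) (0 - s)].

Let measurable_level x j : measurable (level x j).
Proof.
rewrite (_ : level x j = ~` [set s | scaled_hazard eta (lam j) (0 - s) <= x]).
  apply: measurableC; apply: measurable_sublevel; apply: measurable_funM => //.
  apply: measurableT_comp => //; apply: measurable_funM => //.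
  exact: measurable_funB.
by apply/seteqP; split => w /=; rewrite /level /= ltNge => /negP.
Qed.

Let G := hazard_distr (age_law F0) eta.

Lemma hazard_age_bounds (x : R) : 0 <= hazard_distr (age_law F0) eta x <= 1.
Proof.
have me : measurable (eta @^-1` `[0, x]).
  by rewrite -[X in measurable X]setTI; exact: measurable_eta.
rewrite /hazard_distr -muFE// fine_ge0//= -lee_fin fineK ?fin_num_measure//.
exact: probability_le1.
Qed.

Let exceeds_prob x j : P (exceeds x j) = (1 - G (x / lam j))%:E.
Proof.
rewrite exceedsC probability_setC; last exact: measurable_sublevel.
rewrite [X in (_ - X)%E](stationary_intensity_law flow (lam_gt0 j) (intensityE j)
  (renewal j) (QE j) F0_atomless F0_supp muFE measurable_eta eta_ge0).
by rewrite EFinB.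
Qed.

(* The other processes have the same joint law under the Palm probability of
   [Phi i] as under [P], hence the centering at the stationary mean. *)
Lemma palm_exceeds_deviation i (x t : R) : 0 < t ->
  (Q i [set w | (t <= `|\sum_(j < N | j != i) \1_(exceeds x j) w -
     \sum_(j < N | j != i) (1 - G (x / lam j))|)%R] <= (N%:R / t ^+ 2)%:E)%E.
Proof.
apply: chebyshev_count.
- by move=> j; exact: measurable_exceeds.
- move=> j ji; rewrite -exceeds_prob.
  exact: (@palm_last_one i j (level x j) ji (measurable_level x j)).
move=> j k ji ki jk; rewrite EFinM -!exceeds_prob.
exact: (@palm_last_two i j k _ _ ji ki jk (measurable_level x j) (measurable_level x k)).
Qed.

Definition nexceeds (x : R) (w : Omega) : R := \sum_(j < N) \1_(exceeds x j) w.

Lemma measurable_nexceeds x : measurable_fun setT (nexceeds x).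
Proof.
by apply: measurable_sum => j; apply: measurable_indic; exact: measurable_exceeds.
Qed.

Let nexceedsD1 x i w :
  (\sum_(j < N | j != i) \1_(exceeds x j) w : R) <= nexceeds x w <=
  (\sum_(j < N | j != i) \1_(exceeds x j) w : R) + 1.
Proof.
rewrite /nexceeds [X in _ <= X <= _](bigD1 i)//= addrC lerDl lerD2l.
by rewrite indicE; case: (_ \in _) => /=; rewrite ?ler01 ?lexx.
Qed.

Let meanD1 x i : \sum_(j < N) (1 - G (x / lam j)) - 1 <=
  \sum_(j < N | j != i) (1 - G (x / lam j)) <= \sum_(j < N) (1 - G (x / lam j)).
Proof.
rewrite [X in X - 1](bigD1 i)//= [X in _ <= _ <= X](bigD1 i)//=.
by have /andP[] := hazard_age_bounds (x / lam i); rewrite -/G => g0 g1; lra.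
Qed.

Let measurable_deviation i x (m : R) : measurable_fun setT
  (fun w => `|\sum_(j < N | j != i) \1_(exceeds x j) w - m|).
Proof.
apply: measurableT_comp => //; apply: measurable_funB => //.
under eq_fun do rewrite big_mkcond.
apply: measurable_sum => j; case: (j != i) => //.
by apply: measurable_indic; exact: measurable_exceeds.
Qed.

(** Item i itself adds at most one to the count, which is why the threshold is [c + 1] while the
    mean is compared with c. *)
Lemma palm_nexceeds_gt i (x t : R) (c : nat) : 0 < t ->
  \sum_(j < N) (1 - G (x / lam j)) + t <= c%:R ->
  (Q i [set w | (c.+1%:R <= nexceeds x w)%R] <= (N%:R / t ^+ 2)%:E)%E.
Proof.
move=> t0 hc; apply: le_trans (palm_exceeds_deviation i x t0).
rewrite le_measure ?inE//.
- by apply: measurable_superlevel; exact: measurable_nexceeds.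
- by apply: measurable_superlevel; exact: measurable_deviation.
move=> w /= h; have /andP[_ h1] := nexceedsD1 x i w.
have /andP[_ h2] := meanD1 x i; apply: le_trans (ler_norm _).
by move: h; rewrite -natr1 => h; lra.
Qed.

(** Leaving item i out lowers the mean by at most one; the additional 1 in the condition pays for
    it. *)
Lemma palm_nexceeds_lt i (x t : R) (c : nat) : 0 < t ->
  c%:R + 1 + t <= \sum_(j < N) (1 - G (x / lam j)) ->
  (Q i [set w | (nexceeds x w < c%:R)%R] <= (N%:R / t ^+ 2)%:E)%E.
Proof.
move=> t0 hc; apply: le_trans (palm_exceeds_deviation i x t0).
rewrite le_measure ?inE//.
- by apply: measurable_strict_sublevel; exact: measurable_nexceeds.
- by apply: measurable_superlevel; exact: measurable_deviation.
move=> w /= h; have /andP[h1 _] := nexceedsD1 x i w.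
have /andP[h2 _] := meanD1 x i; rewrite distrC; apply: le_trans (ler_norm _).
by lra.
Qed.

End intensities_at_points.

(** * Bounds on the miss probability at a fixed level *)

Section selection.
Context {R : realType} {N : nat}.
Variables (k : nat) (rule : ('I_N -> R) -> {set 'I_N}).
Hypothesis sel : selects_largest k rule.

(** If i were left out, the k stored items would have values at least [v i], and with i there would
    be [k + 1] items above x, however ties are broken. *)
Lemma selected_above (v : 'I_N -> R) (x : R) i : x < v i ->
  (#|[pred j | (x < v j)%R]| <= k)%N -> i \in rule v.
Proof.
move=> xi; apply: contraTT => ir; rewrite -ltnNge.
have [<- h] := sel v.
have : i |: rule v \subset [pred j | x < v j].
  apply/fintype.subsetP => j; rewrite !inE => /orP[/eqP ->//|jr].
  by apply: lt_le_trans xi _; exact: h.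
by move=> /subset_leq_card; rewrite cardsU1 ir.
Qed.

(** If i were stored, so would be every item above x; none of these is i, hence there would be at
    most [k - 1] of them. *)
Lemma not_selected_below (v : 'I_N -> R) (x : R) i : v i <= x ->
  (k <= #|[pred j | (x < v j)%R]|)%N -> i \notin rule v.
Proof.
move=> xi; apply: contraTN => ir; rewrite -ltnNge.
have [<- h] := sel v; rewrite (cardsD1 i (rule v)) ir ltnS.
apply: subset_leq_card; apply/fintype.subsetP => j; rewrite !inE => xj.
have ji : j != i by apply: contraTneq xj => ->; rewrite -leNgt.
rewrite ji /=; apply: contraTT xj => jr; rewrite -leNgt.
by apply: le_trans xi; exact: h.
Qed.

End selection.

Section superposition_palm.
Context {R : realType} {d : measure_display} {Omega : measurableType d}.
Variable P : probability Omega R.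
Variable theta : R -> Omega -> Omega.
Context {N : nat}.
Variable Phi : 'I_N -> R.-ker Omega ~> R.
Variable lam : 'I_N -> R.
Variable Q : 'I_N -> probability Omega R.
Hypothesis flow : preserving_flow P theta.
Hypothesis lam_gt0 : forall i, 0 < lam i.
Hypothesis N_gt0 : (0 < N)%N.
Hypothesis intensityE : forall i, intensity P (Phi i) = (lam i)%:E.
Hypothesis pp : forall i, is_point_process (Phi i).
Hypothesis QE : forall i A, measurable A -> Q i A = palm P theta (Phi i) A.

Lemma sum_intensity_gt0 : 0 < \sum_(i < N) lam i.
Proof.
case: N N_gt0 lam lam_gt0 => // n _ l l0.
rewrite big_ord_recl; apply: ltr_pwDl => //.
by apply: sumr_ge0 => i _; exact: ltW.
Qed.

Lemma superpose_intensity :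
  intensity P (superpose Phi) = (\sum_(i < N) lam i)%:E.
Proof.
rewrite /intensity /superpose /superposition ge0_integral_sum//; last first.
  by move=> i; exact: measurable_kernel.
by rewrite -sumEFin; apply: eq_bigr => i _; exact: intensityE.
Qed.

(** The point measure is a sum, so its Palm formula is the mixture of those of the items: a typical
    request is for item i with probability proportional to [lam i]. *)
Lemma palm_superpose (A : set Omega) : measurable A ->
  palm P theta (superpose Phi) A =
  (\sum_(i < N) lam i / (\sum_(j < N) lam j) * fine (Q i A))%:E.
Proof.
move=> mA; have L0 := sum_intensity_gt0.
rewrite /palm superpose_intensity inver gt_eqF//.
have -> : (\int[P]_w \int[superpose Phi w]_(s in `]0%R, 1%R]) (\1_A (theta s w))%:E =
    \int[P]_w \sum_(i < N) marked theta (Phi i) `]0%R, 1%R] A w)%E.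
  apply: eq_integral => w _.
  rewrite (_ : (fun s => _) = (fun s => (\1_[set s | A (theta s w)] s)%:E))//.
  rewrite integral_indic//; last exact: (measurable_flow_times flow w mA).
  by rewrite setIC.
have sub : `]0%R, 1%R] `<=` (`[0%R, 1%R] : set R).
  by move=> y /=; rewrite !in_itv/= => /andP[/ltW -> ->].
rewrite ge0_integral_sum//; last first.
  by move=> i; exact: (measurable_marked flow (pp i) _ sub mA).
have -> : (\sum_(i < N) \int[P]_w marked theta (Phi i) `]0%R, 1%R] A w)%E =
    (\sum_(i < N) lam i * fine (Q i A))%:E.
  rewrite -sumEFin; apply: eq_bigr => i _.
  rewrite EFinM fineK ?fin_num_measure// QE// (palmE flow)// intensityE.
  by rewrite inver gt_eqF// muleA -EFinM mulfV ?gt_eqF// mul1e.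
rewrite -EFinM big_distrr/=; congr EFin; apply: eq_bigr => i _.
by rewrite mulrA [_^-1 * _]mulrC.
Qed.

End superposition_palm.

Section miss_sandwich.
Context {R : realType} {d : measure_display} {Omega : measurableType d}.
Variable P : probability Omega R.
Variable theta : R -> Omega -> Omega.
Context {N : nat}.
Variable Phi : 'I_N -> R.-ker Omega ~> R.
Variable lam : 'I_N -> R.
Variable F0 : probability R R.
Variable Q : 'I_N -> probability Omega R.
Hypothesis flow : preserving_flow P theta.
Hypothesis lam_gt0 : forall i, 0 < lam i.
Hypothesis intensityE : forall i, intensity P (Phi i) = (lam i)%:E.
Hypothesis renewal : forall i,
  stationary_renewal P theta (Phi i) (fun t => distr_fun F0 (lam i * t)).
Hypothesis indep : independent_processes P Phi.
Hypothesis QE : forall i A, measurable A -> Q i A = palm P theta (Phi i) A.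
Variable eta : R -> R.
Hypothesis measurable_eta : measurable_fun [set: R] eta.
Variables (k : nat) (rule : ('I_N -> R) -> {set 'I_N}).
Hypothesis sel : selects_largest k rule.

Let pp i : is_point_process (Phi i). Proof. by case: (renewal i). Qed.

Let mvoid i (B : set R) : measurable B -> measurable [set w | Phi i w B = 0%E].
Proof. exact: measurable_void. Qed.

Let X j (w : Omega) : R := stoch_intensity eta (lam j) (Phi j w) 0.

Let mX j : measurable_fun setT (X j).
Proof. exact: (measurable_stoch_intensity (renewal j) measurable_eta). Qed.

Let nexceedsE x w :
  nexceeds Phi lam eta x w = (#|[pred j | (x < X j w)%R]|)%:R.
Proof.
rewrite /nexceeds -sum1_card natr_sum [RHS]big_mkcond/=.
apply: eq_bigr => j _; rewrite inE indicE /exceeds /X.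
by case: (boolP (x < _)) => h; [rewrite mem_set|rewrite memNset//; exact/negP].
Qed.

Let simple_point i : set Omega := [set w | Phi i w [set 0] = 1%E].

Let measurable_simple_point i : measurable (simple_point i).
Proof.
have := measurable_kernel (Phi i) _ (measurable_set1 (0 : R)) measurableT _
  (emeasurable_set1 1%E).
by rewrite setTI.
Qed.

Let palm_simple_point i : Q i (~` simple_point i) = 0%E.
Proof.
have mS := measurable_simple_point i.
rewrite QE; last exact: measurableC.
rewrite (palmE flow)//; last exact: measurableC.
rewrite /campbell (ae_eq_integral (cst 0%E))//.
- by rewrite integral0 mule0.
- have sub : `]0%R, 1%R] `<=` (`[0%R, 1%R] : set R).
    by move=> y /=; rewrite !in_itv/= => /andP[/ltW -> ->].
  exact: (measurable_marked flow (pp i) _ sub (measurableC mS)).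
have [_ _ simple _ _] := renewal i.
apply: filterS simple => w sw _ /=.
apply: (integer_valued_null_atoms (a := 0) (b := 1) (point_process_integer (pp i) w)).
- apply: measurableI => //.
  exact: (measurable_flow_times flow w (measurableC mS)).
- by move=> s [] /=; rewrite !in_itv/= => /andP[/ltW -> ->].
move=> s [_]; rewrite /simple_point /= (shift_atom (renewal i)) => h.
have [n hn] : exists n : nat, Phi i w [set s] = n%:R%:E.
  by apply: (pp i w (a := s) (b := s)) => // _ ->; rewrite /= in_itv/= lexx.
move: h (sw s); rewrite hn lee_fin; case: n {hn} => [//|n].
by rewrite (ler_nat _ _ 1); case: n.
Qed.

(** Almost sure under [Q i]. The origin then carries a single point, which belongs to item i, and
    the hit process there is 0 or 1 according to whether i is stored. *)
Let request i : set Omega := simple_point i `&`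
  \bigcap_(j in [set j | j != i]) [set w | Phi j w [set 0] = 0%E].

Let measurable_request i : measurable (request i).
Proof.
apply: measurableI; first exact: measurable_simple_point.
apply: fin_bigcap_measurable; first exact: finite_finset.
by move=> j _; exact: mvoid.
Qed.

Let palm_request i : Q i (~` request i) = 0%E.
Proof.
rewrite setCI; apply: null_set_setU.
- by apply: measurableC.
- apply: measurableC; apply: fin_bigcap_measurable; first exact: finite_finset.
  by move=> j _; exact: mvoid.
- exact: palm_simple_point.
rewrite setC_bigcap; apply: measure_negligible.
  apply: fin_bigcup_measurable; first exact: finite_finset.
  by move=> j _; apply: measurableC; exact: mvoid.
rewrite bigcup_mkcond.
have -> : \bigcup_(j : 'I_N) (if j \in [set j | j != i] then
    ~` [set w | Phi j w [set 0] = 0%E] else set0) =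
    \big[setU/set0]_(j < N) (if j \in [set j | j != i] then
    ~` [set w | Phi j w [set 0] = 0%E] else set0).
  by rewrite -bigcup_seq; apply/seteqP; split => w [j _ h]; exists j => //=;
    rewrite mem_index_enum.
apply: (big_ind (fun A => (Q i).-negligible A)).
- exact: negligible_set0.
- by move=> A B; exact: negligibleU.
move=> j _; case: ifPn => [|_]; last exact: negligible_set0.
rewrite inE/= => ji; apply/negligibleP; first by apply: measurableC; exact: mvoid.
exact: (palm_no_common_point flow lam_gt0 intensityE renewal indep QE ji).
Qed.

Let pol := optimal_policy eta lam Phi rule.

Let hit_at_request i w : request i w ->
  hit_process Phi pol w [set 0] = (i \in pol 0 w)%:R%:E.
Proof.
move=> [hi hj].
have hE j : (\int[Phi j w]_(t in [set 0%R]) ((j \in pol t w)%:R : R)%:E =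
    ((j \in pol 0 w)%:R : R)%:E * Phi j w [set 0%R])%E.
  rewrite -integral_cst//; apply: eq_integral => t.
  by rewrite inE /= => ->.
rewrite /hit_process (bigD1 i)//= hE hi mule1 big1 ?adde0// => j ji.
by rewrite hE hj// mule0.
Qed.

Let Lam : R := \sum_(i < N) lam i.

Let le_request i (A : set Omega) : measurable A -> (Q i A <= Q i (request i `&` A))%E.
Proof.
move=> mA; have mr := measurable_request i.
rewrite -(measureU0 (measurableI _ _ mr mA) (measurableC mr) (palm_request i)).
rewrite le_measure ?inE//.
  by apply: measurableU; [exact: measurableI|exact: measurableC].
move=> w Aw; have [rw|rw] := pselect (request i w); first by left.
by right.
Qed.

(** A measurable event inside the hit event; [up] plays the same role for the miss event. The hit
    event depends on [rule] and may fail to be measurable. *)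
Let lo (x : R) : set Omega := \bigcup_i
  (request i `&` ([set w | x < X i w] `&` [set w | nexceeds Phi lam eta x w < k.+1%:R])).

Let up (x : R) : set Omega := \bigcup_i
  (request i `&` ([set w | X i w <= x] `&` [set w | k%:R <= nexceeds Phi lam eta x w])).

Let mnx x : measurable_fun setT (nexceeds Phi lam eta x).
Proof. exact: (measurable_nexceeds renewal measurable_eta). Qed.

Let m_gt x i : measurable [set w | x < X i w].
Proof. exact: (measurable_exceeds renewal measurable_eta). Qed.

Let m_lo x : measurable (lo x).
Proof.
apply: fin_bigcup_measurable; first exact: finite_finset.
move=> i _; apply: measurableI => //; apply: measurableI => //.
exact: measurable_strict_sublevel.
Qed.

Let m_up x : measurable (up x).
Proof.
apply: fin_bigcup_measurable; first exact: finite_finset.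
move=> i _; apply: measurableI => //; apply: measurableI.
  exact: measurable_sublevel.
exact: measurable_superlevel.
Qed.

Let Hit : set Omega := [set w | hit_process Phi pol w [set 0] = 1%E].

Let lo_hit x : lo x `<=` Hit.
Proof.
move=> w [i _ [rw [xi nx]]]; rewrite /Hit /= (hit_at_request rw).
rewrite /pol /optimal_policy (selected_above sel (x := x))//.
by move: nx => /=; rewrite nexceedsE ltr_nat ltnS.
Qed.

Let up_miss x : up x `<=` ~` Hit.
Proof.
move=> w [i _ [rw [xi nx]]]; rewrite /Hit /= (hit_at_request rw).
rewrite /pol /optimal_policy (negPf (not_selected_below sel (x := x) _ _))//.
  by move=> -[] /esym/eqP; rewrite oner_eq0.
by move: nx => /=; rewrite nexceedsE ler_nat.
Qed.

Let weights_sum : (0 < N)%N -> \sum_(i < N) lam i / Lam = 1.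
Proof.
move=> N0; rewrite -big_distrl/= divff// gt_eqF//.
exact: (sum_intensity_gt0 lam_gt0).
Qed.

(** [miss_probability] applies [fine], which respects the order on finite values only; comparison
    with the empty and the full event gives finiteness. *)
Let palm_hit_fin : (0 < N)%N -> palm P theta (superpose Phi) Hit \is a fin_num.
Proof.
move=> N0; have h := @le_palm _ _ _ P theta (superpose Phi) _ _ (@subsetT _ Hit).
have hT := palm_superpose flow lam_gt0 N0 intensityE pp QE measurableT.
rewrite ge0_fin_numE; first by apply: le_lt_trans h _; rewrite hT ltry.
rewrite (_ : 0%E = palm P theta (superpose Phi) set0); first exact: le_palm.
rewrite (palm_superpose flow lam_gt0 N0 intensityE pp QE measurable0).
by rewrite big1// => i _; rewrite measure0 mulr0.
Qed.

Let inter_ge i (A B : set Omega) : measurable A -> measurable B ->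
  1 - (fine (Q i (~` A)) + fine (Q i (~` B))) <= fine (Q i (A `&` B)).
Proof.
move=> mA mB; have mAB := measurableI _ _ mA mB.
have h : (Q i (~` A `|` ~` B) <= Q i (~` A) + Q i (~` B))%E.
  by apply: measureU2; exact: measurableC.
rewrite -setCI probability_setC// in h.
move: h; rewrite -[Q i (A `&` B)]fineK ?fin_num_measure//.
rewrite -[Q i (~` A)]fineK ?fin_num_measure//; last exact: measurableC.
rewrite -[Q i (~` B)]fineK ?fin_num_measure//; last exact: measurableC.
by rewrite -EFinB -EFinD lee_fin; lra.
Qed.

Lemma miss_le (x : R) : (0 < N)%N ->
  miss_probability P theta Phi pol <= \sum_(i < N) lam i / Lam *
    (fine (Q i [set w | (X i w <= x)%R]) +
     fine (Q i [set w | (k.+1%:R <= nexceeds Phi lam eta x w)%R])).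
Proof.
move=> N0; rewrite /miss_probability -/Hit.
have L0 : 0 < Lam := sum_intensity_gt0 lam_gt0 N0.
have h := @le_palm _ _ _ P theta (superpose Phi) _ _ (@lo_hit x).
rewrite (palm_superpose flow lam_gt0 N0 intensityE pp QE (m_lo x)) in h.
rewrite -(fineK (palm_hit_fin N0)) lee_fin in h.
rewrite lerBlDr -lerBlDl; apply: le_trans h.
(* The constant 1 is distributed over the items as the sum of their weights, so that the comparison
   is made item by item. *)
rewrite -[X in X - _](weights_sum N0) -sumrB; apply: ler_sum => i _.
rewrite -[X in X - _]mulr1 -mulrBr ler_wpM2l//; first by rewrite divr_ge0// ltW.
apply: le_trans (_ : fine (Q i ([set w | x < X i w] `&`
    [set w | nexceeds Phi lam eta x w < k.+1%:R])) <= _).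
  apply: le_trans (inter_ge _ (m_gt x i) (measurable_strict_sublevel _ (mnx x))).
  rewrite lerD2l lerN2 lerD// le_eqVlt; apply/orP; left; apply/eqP;
    congr (fine (Q i _)); apply/seteqP; split => w /=.
  - by move/negP; rewrite -leNgt.
  - by rewrite leNgt => /negP.
  - by move/negP; rewrite -leNgt.
  - by rewrite leNgt => /negP.
have mAB : measurable ([set w | x < X i w] `&`
    [set w | nexceeds Phi lam eta x w < k.+1%:R]).
  by apply: measurableI => //; exact: measurable_strict_sublevel.
rewrite fine_le ?fin_num_measure//; apply: le_trans (le_request i mAB) _.
rewrite le_measure ?inE//; first exact: measurableI.
by move=> w h; exists i.
Qed.

Lemma miss_ge (x : R) : (0 < N)%N ->
  \sum_(i < N) lam i / Lam *
    (fine (Q i [set w | (X i w <= x)%R]) -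
     fine (Q i [set w | (nexceeds Phi lam eta x w < k%:R)%R])) <=
  miss_probability P theta Phi pol.
Proof.
move=> N0; rewrite /miss_probability -/Hit.
have L0 : 0 < Lam := sum_intensity_gt0 lam_gt0 N0.
have sub : Hit `<=` ~` up x by move=> w h /up_miss; apply.
have h := @le_palm _ _ _ P theta (superpose Phi) _ _ sub.
rewrite (palm_superpose flow lam_gt0 N0 intensityE pp QE (measurableC (m_up x))) in h.
rewrite -(fineK (palm_hit_fin N0)) lee_fin in h.
rewrite lerBrDr -lerBrDl; apply: le_trans h _.
rewrite lerBrDl -[leRHS](weights_sum N0) -big_split/=; apply: ler_sum => i _.
rewrite -mulrDr -[leRHS]mulr1 ler_wpM2l//; first by rewrite divr_ge0// ltW.
have -> : fine (Q i (~` up x)) = 1 - fine (Q i (up x)).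
  by rewrite probability_setC// fineB ?fin_num_measure.
rewrite addrCA gerDl subr_le0.
have mA : measurable [set w | X i w <= x] by exact: measurable_sublevel.
have mB : measurable [set w | k%:R <= nexceeds Phi lam eta x w].
  exact: measurable_superlevel.
apply: le_trans (_ : fine (Q i ([set w | X i w <= x] `&`
    [set w | k%:R <= nexceeds Phi lam eta x w])) <= _).
  have := inter_ge i mA mB.
  have -> : fine (Q i (~` [set w | X i w <= x])) = 1 - fine (Q i [set w | X i w <= x]).
    by rewrite probability_setC// fineB ?fin_num_measure.
  have -> : ~` [set w | k%:R <= nexceeds Phi lam eta x w] =
      [set w | nexceeds Phi lam eta x w < k%:R].
    by apply/seteqP; split => w /=; [move/negP; rewrite -ltNge|rewrite ltNge => /negP].
  lra.
have mAB := measurableI _ _ mA mB.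
rewrite fine_le ?fin_num_measure//; apply: le_trans (le_request i mAB) _.
rewrite le_measure ?inE//; first exact: measurableI.
by move=> w h'; exists i.
Qed.

Lemma miss_ge0 : (0 < N)%N -> 0 <= miss_probability P theta Phi pol.
Proof.
move=> N0; rewrite /miss_probability -/Hit subr_ge0 -lee_fin fineK ?palm_hit_fin//.
have h := @le_palm _ _ _ P theta (superpose Phi) _ _ (@subsetT _ Hit).
apply: le_trans h _.
rewrite (palm_superpose flow lam_gt0 N0 intensityE pp QE measurableT) lee_fin.
rewrite -(weights_sum N0) ler_sum// => i _.
by rewrite probability_setT mulr1.
Qed.

End miss_sandwich.

(** * Averages over the rates and their limit law *)

Section real_facts.
Context {R : realType}.

(** The power with exponent -1 is the inverse on nonnegative reals, hence at [x ^+ 2]; at 0 both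
    sides take the value 0. *)
Lemma measurable_inv : measurable_fun [set: R] (fun x : R => x^-1).
Proof.
have -> : (fun x : R => x^-1) = (fun x => x * (x ^+ 2) `^ (-1)).
  apply/funext => x; rewrite powR_inv1 ?sqr_ge0//.
  have [->|x0] := eqVneq x 0; first by rewrite invr0 mul0r.
  by rewrite expr2 invfM mulrA divff// mul1r.
apply: measurable_funM => //.
by apply: (measurableT_comp (@measurable_powR R (-1))); apply: measurable_funX.
Qed.

Lemma exprn_unbounded (r x : R) : 1 < r -> exists k : nat, x <= r ^+ k.
Proof.
move=> r1; have bern (k : nat) : k%:R * (r - 1) <= r ^+ k.
  elim: k => [|k IH]; first by rewrite mul0r expr0 ler01.
  have e1 : 1 <= r ^+ k by rewrite exprn_ege1// ltW.
  have : 0 <= (r ^+ k - 1) * (r - 1) by rewrite mulr_ge0 ?subr_ge0// ltW.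
  by rewrite -(natr1 k) exprSr; move: IH; clear; lra.
exists (Num.truncn (`|x| / (r - 1))).+1; apply: le_trans (bern _).
rewrite -ler_pdivrMr ?subr_gt0//; apply/ltW.
apply: le_lt_trans (truncnS_gt _); rewrite ler_pM2r ?ler_norm//.
by rewrite invr_gt0 subr_gt0.
Qed.

(** A countable set is Lebesgue null, an interval is not. *)
Lemma countable_lt_itv (A : set R) (a b : R) : countable A -> a < b ->
  exists2 x, a < x < b & ~ A x.
Proof.
move=> cA ab; apply: contrapT => h.
have sub : `]a, b[ `<=` A.
  move=> x /=; rewrite in_itv/= => xab; apply: contrapT => Ax.
  by apply: h; exists x.
have cI : countable (`]a, b[ : set R) by exact: sub_countable (subset_card_le sub) cA.
have := countable_lebesgue_measure0 cI.
have := @lebesgue_measure_itv R `]a, b[; rewrite /= lte_fin ab => -> /eqP.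
by rewrite -EFinB eqe subr_eq0 gt_eqF.
Qed.

End real_facts.

Section discontinuities.
Context {R : realType}.
Variable mu : probability R R.

Lemma distr_fun_left (x : R) : mu [set x] = 0%E ->
  distr_fun mu y @[y --> x^'-] --> distr_fun mu x.
Proof.
move=> mx; apply/cvgrPdist_lt => e e0.
have [n hn] : exists n : nat, distr_fun mu x - e < distr_fun mu (x - n.+1%:R^-1).
  have U : \bigcup_n (`]-oo, (x - n.+1%:R^-1)%R]%classic : set R) = `]-oo, x[%classic :> set R.
    apply/seteqP; split => y /=; rewrite in_itv/=.
      move=> [n _]; rewrite /= in_itv/= => /le_lt_trans; apply.
      by rewrite ltrBlDr ltrDl invr_gt0.
    move=> /ltr_add_invr[n hn]; exists n => //=.
    by rewrite in_itv/= lerBrDr ltW.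
  have cv : (mu \o (fun n => `]-oo, (x - n.+1%:R^-1)%R]%classic)) n @[n --> \oo]
      --> mu `]-oo, x[%classic.
    rewrite -U; apply: nondecreasing_cvg_mu => //.
      exact: bigcupT_measurable.
    move=> i j ij; apply/subsetPset => y /=; rewrite !in_itv/= => /le_trans; apply.
    by rewrite lerD2l lerN2 lef_pV2 ?posrE// ler_nat.
  have E : mu `]-oo, x[%classic = (distr_fun mu x)%:E.
    rewrite distr_funE (_ : `]-oo, x]%classic = `]-oo, x[ `|` [set x]).
      by rewrite measureU0.
    by apply/seteqP; split => y /=; rewrite !in_itv/= le_eqVlt;
      [move/orP => [/eqP|]; [right|left]|case=> [->|->]; rewrite ?eqxx ?orbT].
  rewrite E in cv.
  have cv' : distr_fun mu (x - n.+1%:R^-1) @[n --> \oo] --> distr_fun mu x.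
    exact: fine_cvg cv.
  have /cvgrPdist_lt/(_ e e0)[n _ /(_ n (leqnn _)) /= h] := cv'.
  by exists n; move: h => /ltr_normlP[_]; lra.
near=> y; rewrite ger0_norm ?subr_ge0; last first.
  by apply: distr_fun_homo; apply/ltW; near: y; exact: nbhs_left_lt.
rewrite ltrBlDr -ltrBlDl; apply: lt_le_trans hn _; apply: distr_fun_homo.
near: y; apply: nbhs_left_ge; by rewrite ltrBlDr ltrDl invr_gt0.
Unshelve. all: by end_near. Qed.

Lemma distr_fun_continuous (x : R) : mu [set x] = 0%E ->
  {for x, continuous (distr_fun mu)}.
Proof.
move=> mx; apply/left_right_continuousP; split; first exact: distr_fun_left.
exact: distr_fun_right_continuous.
Qed.

Let idR : {mfun R >-> R} :=
  HB.pack (@idfun R) (isMeasurableFun.Build _ _ _ _ _ (@measurable_id _ R setT)).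

Lemma countable_discontinuities : countable (discontinuities (distr_fun mu)).
Proof.
apply: sub_countable (@pmf_gt0_countable _ _ _ mu idR); apply: subset_card_le.
move=> x h; rewrite /= /pmf fine_gt0// ltey_eq fin_num_measure// andbT.
rewrite lt0e measure_ge0 andbT; apply/negP => /eqP m0; apply: h.
exact: distr_fun_continuous.
Qed.

(** The starting point a must avoid the points [x / r ^+ m] with x a discontinuity, a countable
    set. *)
Lemma continuity_grid (r e : R) : 0 < r -> 0 < e ->
  exists2 a, 0 < a < e &
    forall m : nat, {for a * r ^+ m, continuous (distr_fun mu)}.
Proof.
move=> r0 e0.
pose A := \bigcup_m [set x / r ^+ m | x in discontinuities (distr_fun mu)].
have cA : countable A.
  apply: bigcup_countable => // m _.
  exact: sub_countable (card_image_le _ _) countable_discontinuities.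
have [a a0 aA] := countable_lt_itv cA e0; exists a => // m.
apply: contrapT => h; apply: aA; exists m => //; exists (a * r ^+ m) => //.
by rewrite mulfK// gt_eqF// exprn_gt0.
Qed.

End discontinuities.

Section empirical_averages.
Context {R : realType}.

(** The normalization is by [N] and not by the number of selected items, so averages over disjoint
    ranges of rates add up. *)
Definition average N (lam : 'I_N -> R) (p : pred R) (f : R -> R) : R :=
  N%:R^-1 * \sum_(i < N | p (lam i)) f (lam i).

Lemma average_le N (lam : 'I_N -> R) (p : pred R) (f h : R -> R) :
  (forall i, p (lam i) -> f (lam i) <= h (lam i)) ->
  average lam p f <= average lam p h.
Proof. by move=> fh; rewrite /average ler_wpM2l// ler_sum. Qed.

Lemma average_ge0 N (lam : 'I_N -> R) (p : pred R) (f : R -> R) :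
  (forall i, p (lam i) -> 0 <= f (lam i)) -> 0 <= average lam p f.
Proof. by move=> f0; rewrite mulr_ge0// sumr_ge0. Qed.

Lemma average_split N (lam : 'I_N -> R) (p q : pred R) (f : R -> R) :
  average lam p f = average lam (predI p q) f + average lam (predD p q) f.
Proof.
rewrite /average -mulrDr (bigID (fun i => q (lam i)))/=; congr (_ * (_ + _)).
by apply: eq_bigl => i; rewrite andbC.
Qed.

Lemma eq_average N (lam : 'I_N -> R) (p q : pred R) (f h : R -> R) :
  (forall i, p (lam i) = q (lam i)) ->
  (forall i, p (lam i) -> f (lam i) = h (lam i)) ->
  average lam p f = average lam q h.
Proof.
move=> pq fh; rewrite /average; congr (_ * _).
by rewrite (eq_bigl (fun i => q (lam i)))//; apply: eq_bigr => i; rewrite -pq; exact: fh.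
Qed.

Lemma average_cst N (lam : 'I_N -> R) (a b c : R) : a <= b ->
  average lam (fun l => a < l <= b) (fun=> c) =
  c * (empirical_distr lam b - empirical_distr lam a).
Proof.
move=> ab; rewrite /average /empirical_distr -mulrBr mulrCA; congr (_ * _).
rewrite -sumrB big_distrr/= big_mkcond/=; apply: eq_bigr => i _.
rewrite ltNge; case: (leP (lam i) a) => la /=.
  by rewrite (le_trans la ab) subrr mulr0.
by case: (leP (lam i) b) => _; rewrite ?subr0 ?mulr1 ?subrr ?mulr0.
Qed.

Lemma average_itvD N (lam : 'I_N -> R) (a b c : R) (f : R -> R) : a <= b -> b <= c ->
  average lam (fun l => a < l <= c) f =
  average lam (fun l => a < l <= b) f + average lam (fun l => b < l <= c) f.
Proof.
move=> ab bc; rewrite (average_split _ _ (fun l => l <= b)); congr (_ + _).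
  apply: eq_average => // i /=; rewrite -andbA; congr (_ && _).
  by have [lb|lb] := leP (lam i) b; rewrite ?andbF// andbT (le_trans lb bc).
apply: eq_average => // i /=; rewrite -ltNge; case: (ltP b (lam i)) => //= lb.
by rewrite (le_lt_trans ab lb).
Qed.

Variables (a r : R).
Hypothesis a_gt0 : 0 < a.
Hypothesis r_gt1 : 1 < r.

Let pt (m : nat) : R := a * r ^+ m.

Let pt_gt0 m : 0 < pt m.
Proof. by rewrite mulr_gt0// exprn_gt0// (lt_trans ltr01). Qed.

Let pt_le m n : (m <= n)%N -> pt m <= pt n.
Proof. by move=> mn; rewrite ler_pM2l// ler_weXn2l// ltW. Qed.

Let average_cells_le N (lam : 'I_N -> R) (f : R -> R) (s : nat -> R) (k : nat) :
  (forall m l, pt m < l <= pt m.+1 -> f l <= s m) ->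
  average lam (fun l => pt 0 < l <= pt k) f <=
  \sum_(m < k) s m * (empirical_distr lam (pt m.+1) - empirical_distr lam (pt m)).
Proof.
move=> fs; elim: k => [|k IH].
  rewrite big_ord0 /average big1 ?mulr0// => i.
  by case: ltP => //= h; rewrite leNgt h.
rewrite (average_itvD _ _ (pt_le (leq0n k)) (pt_le (leqnSn k))) big_ord_recr/= lerD//.
rewrite -average_cst; last exact: pt_le.
by apply: average_le => i h; exact: fs.
Qed.

Let average_cells_ge N (lam : 'I_N -> R) (f : R -> R) (s : nat -> R) (k : nat) :
  (forall m l, pt m < l <= pt m.+1 -> s m <= f l) ->
  \sum_(m < k) s m * (empirical_distr lam (pt m.+1) - empirical_distr lam (pt m)) <=
  average lam (fun l => pt 0 < l <= pt k) f.
Proof.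
move=> fs; elim: k => [|k IH].
  rewrite big_ord0 /average big1 ?mulr0// => i.
  by case: ltP => //= h; rewrite leNgt h.
rewrite (average_itvD _ _ (pt_le (leq0n k)) (pt_le (leqnSn k))) big_ord_recr/= lerD//.
rewrite -average_cst; last exact: pt_le.
by apply: average_le => i h; exact: fs.
Qed.

Variable L : probability R R.

Let integral_cellsD (h : R -> R) (k : nat) :
  measurable_fun [set: R] h -> (forall l : R, 0 < l -> 0 <= h l) ->
  (\int[L]_(l in `]pt 0, pt k.+1]) (h l)%:E =
   \int[L]_(l in `]pt 0, pt k]) (h l)%:E +
   \int[L]_(l in `]pt k, pt k.+1]) (h l)%:E)%E.
Proof.
move=> mh h0.
have E : `]pt 0, pt k.+1]%classic = `]pt 0, pt k] `|` `]pt k, pt k.+1] :> set R.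
  apply/seteqP; split => l /=; rewrite !in_itv/=.
    by move=> /andP[l0 l1]; have [lk|lk] := leP l (pt k); [left; rewrite l0|right].
  case=> /andP[l0 l1]; apply/andP; split => //.
    exact: le_trans (pt_le (leqnSn k)).
  exact: le_lt_trans (pt_le (leq0n k)) l0.
rewrite E ge0_integral_setU//.
- by apply/measurable_EFinP; exact: measurable_funTS.
- move=> l; rewrite -E /= in_itv/= => /andP[l0 _]; rewrite lee_fin h0//.
  exact: lt_trans l0.
- apply/disj_setPS => l [] /=; rewrite !in_itv/= => /andP[_ l1] /andP[].
  by rewrite ltNge l1.
Qed.

Let integral_cells_ge (h : R -> R) (s : nat -> R) (k : nat) :
  measurable_fun [set: R] h -> (forall l : R, 0 < l -> 0 <= h l) ->
  (forall m, 0 <= s m) ->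
  (forall m l, pt m < l <= pt m.+1 -> s m <= h l) ->
  ((\sum_(m < k) s m * (distr_fun L (pt m.+1) - distr_fun L (pt m)))%:E <=
  \int[L]_(l in `]pt 0, pt k]) (h l)%:E)%E.
Proof.
move=> mh h0 s0 sh; elim: k => [|k IH].
  by rewrite big_ord0 set_itv_ge ?integral_set0// bnd_simp ltxx.
rewrite big_ord_recr/= integral_cellsD// EFinD leeD//.
rewrite EFinM -distr_fun_itv; last exact: pt_le.
rewrite -integral_cst//; apply: ge0_le_integral => //.
- by move=> l _; rewrite lee_fin.
- by apply/measurable_EFinP; exact: measurable_funTS.
- by move=> l; rewrite /= in_itv/= => /sh; rewrite lee_fin.
Qed.

Let integral_cells_le (h : R -> R) (s : nat -> R) (k : nat) :
  measurable_fun [set: R] h -> (forall l : R, 0 < l -> 0 <= h l) ->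
  (forall m l, pt m < l <= pt m.+1 -> h l <= s m) ->
  (\int[L]_(l in `]pt 0, pt k]) (h l)%:E <=
  (\sum_(m < k) s m * (distr_fun L (pt m.+1) - distr_fun L (pt m)))%:E)%E.
Proof.
move=> mh h0 sh; elim: k => [|k IH].
  by rewrite big_ord0 set_itv_ge ?integral_set0// bnd_simp ltxx.
rewrite big_ord_recr/= integral_cellsD// EFinD leeD//.
rewrite EFinM -distr_fun_itv; last exact: pt_le.
rewrite -integral_cst//; apply: ge0_le_integral => //.
- move=> l; rewrite /= in_itv/= => /andP[l0 _]; rewrite lee_fin h0//.
  exact: lt_trans l0.
- by apply/measurable_EFinP; exact: measurable_funTS.
- by move=> l; rewrite /= in_itv/= => /sh; rewrite lee_fin.
Qed.

Variable lam : forall N, 'I_N -> R.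
Arguments lam : clear implicits.
Hypothesis lam_cvg : weakly_converges (fun N => empirical_distr (lam N)) L.
Hypothesis grid : forall m, {for a * r ^+ m, continuous (distr_fun L)}.

Let cells_cvg (s : nat -> R) (k : nat) :
  \sum_(m < k) s m * (empirical_distr (lam N) (pt m.+1) - empirical_distr (lam N) (pt m))
    @[N --> \oo] -->
  \sum_(m < k) s m * (distr_fun L (pt m.+1) - distr_fun L (pt m)).
Proof.
apply: (@cvg_big _ _ +%R 0 xpredT add_continuous) => m _.
by apply: cvgMr; apply: cvgB; apply: lam_cvg; exact: grid.
Qed.

(* [s] separates [f] and [h] on each cell of the geometric grid. *)
Lemma limsup_average_le (f h : R -> R) (s : nat -> R) (k : nat) (e : R) : 0 < e ->
  measurable_fun [set: R] h -> (forall l : R, 0 < l -> 0 <= h l) ->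
  (forall m, 0 <= s m) ->
  (forall m l, a * r ^+ m < l <= a * r ^+ m.+1 -> f l <= s m <= h l) ->
  (\int[L]_(l in `]a, (a * r ^+ k)%R]) (h l)%:E < +oo)%E ->
  \forall N \near \oo, average (lam N) (fun l => a < l <= a * r ^+ k) f <=
    fine (\int[L]_(l in `]a, (a * r ^+ k)%R]) (h l)%:E) + e.
Proof.
move=> e0 mh h0 s0 fsh hoo.
have pt0 : pt 0 = a by rewrite /pt expr0 mulr1.
have cv := @cells_cvg s k.
have hge := @integral_cells_ge h s k mh h0 s0 (fun m l H => (andP (fsh m l H)).2).
rewrite pt0 in hge.
have hfin : (\int[L]_(l in `]a, (a * r ^+ k)%R]) (h l)%:E)%E \is a fin_num.
  rewrite ge0_fin_numE//; apply: integral_ge0 => l /=; rewrite in_itv/= => /andP[al _].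
  by rewrite lee_fin h0// (lt_trans a_gt0).
rewrite -(fineK hfin) lee_fin in hge.
near=> N; apply: le_trans (_ : \sum_(m < k) s m *
    (empirical_distr (lam N) (pt m.+1) - empirical_distr (lam N) (pt m)) <= _).
  have := @average_cells_le N (lam N) f s k (fun m l H => (andP (fsh m l H)).1).
  by rewrite pt0.
apply: le_trans (_ : \sum_(m < k) s m * (distr_fun L (pt m.+1) - distr_fun L (pt m)) + e <= _).
  by near: N; apply: (cvgr_le _ cv); rewrite ltrDl.
by rewrite lerD2r.
Unshelve. all: by end_near. Qed.

(** The conclusion is in the extended reals, with no finiteness of the integral presupposed: this is
    what later bounds the integral of the weight. *)
Lemma liminf_average_ge (f h : R -> R) (s : nat -> R) (k : nat) (e : R) : 0 < e ->
  measurable_fun [set: R] h -> (forall l : R, 0 < l -> 0 <= h l) ->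
  (forall m l, a * r ^+ m < l <= a * r ^+ m.+1 -> h l <= s m <= f l) ->
  \forall N \near \oo,
    (\int[L]_(l in `]a, (a * r ^+ k)%R]) (h l)%:E <=
     (average (lam N) (fun l => a < l <= a * r ^+ k) f + e)%:E)%E.
Proof.
move=> e0 mh h0 fsh.
have pt0 : pt 0 = a by rewrite /pt expr0 mulr1.
have cv := @cells_cvg s k.
have hle := @integral_cells_le h s k mh h0 (fun m l H => (andP (fsh m l H)).1).
rewrite pt0 in hle.
near=> N; apply: le_trans hle _; rewrite lee_fin.
apply: le_trans (_ : \sum_(m < k) s m *
    (empirical_distr (lam N) (pt m.+1) - empirical_distr (lam N) (pt m)) + e <= _).
  rewrite -lerBlDr; near: N; apply: (cvgr_ge _ cv); rewrite ltrBlDr ltrDl//.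
rewrite lerD2r.
have := @average_cells_ge N (lam N) f s k (fun m l H => (andP (fsh m l H)).2).
by rewrite pt0.
Unshelve. all: by end_near. Qed.

End empirical_averages.

(** * Averages of [w l * g (x / l)] for a weight that is either the rate itself or 1 *)

Section weighted_averages.
Context {R : realType}.
Variable L : probability R R.
Variable lam : forall N, 'I_N -> R.
Arguments lam : clear implicits.
Hypothesis lam_gt0 : forall N i, 0 < lam N i.
Hypothesis lam_cvg : weakly_converges (fun N => empirical_distr (lam N)) L.
Hypothesis L0 : L [set 0] = 0%E.

(** The empirical laws vanish on negative numbers, and so does [L] at its negative continuity
    points, which are dense; no atom at 0 is left. *)
Lemma limit_law_pos : distr_fun L 0 = 0.
Proof.
have E : L `]-oo, 0]%classic = L `]-oo, 0[%classic.
  rewrite (_ : `]-oo, 0]%classic = `]-oo, 0[ `|` [set 0]); first by rewrite measureU0.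
  by apply/seteqP; split => y /=; rewrite !in_itv/= le_eqVlt;
    [move/orP => [/eqP|]; [right|left]|case=> [->|->]; rewrite ?eqxx ?orbT].
have neg y : y < 0 -> L `]-oo, y]%classic = 0%E.
  move=> y0; have [z /andP[yz z0] zc] := countable_lt_itv (countable_discontinuities L) y0.
  have zcont : {for z, continuous (distr_fun L)} by apply: contrapT.
  have cv := lam_cvg zcont.
  have h : distr_fun L z = 0.
    rewrite -(cvg_lim _ cv)//; apply: lim_near_cst => //; apply: nearW => N.
    rewrite /empirical_distr big1 ?mulr0// => i _.
    by rewrite leNgt (lt_trans z0).
  apply/eqP; rewrite eq_le measure_ge0 andbT -distr_funE lee_fin -h.
  by apply: distr_fun_homo; exact: ltW.
apply/eqP; rewrite -eqe distr_funE E; apply/eqP.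
apply: measure_negligible => //.
apply: (@negligibleS _ _ _ L (\bigcup_n (`]-oo, (- n.+1%:R^-1)%R]%classic : set R))); last first.
  apply: negligible_bigcup => n; apply/negligibleP => //; apply: neg.
  by rewrite oppr_lt0 invr_gt0.
move=> y /=; rewrite in_itv/= => /ltr_add_invr[n hn]; exists n => //=.
by rewrite in_itv/= lerNr ltW//; move: hn; rewrite -ltrBrDl sub0r.
Qed.

Variable w : R -> R.
Hypothesis measurable_w : measurable_fun [set: R] w.
Hypothesis w_ge0 : forall l : R, 0 < l -> 0 <= w l.
Hypothesis w_scale : forall r l l' : R, 1 <= r -> 0 < l -> 0 < l' -> l <= r * l' ->
  w l <= r * w l'.
Hypothesis w_le1 : forall l : R, 0 < l -> l <= 1 -> w l <= 1.
Hypothesis w_ui : forall e : R, 0 < e -> exists K : R, forall N, (0 < N)%N ->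
  average (lam N) (fun l => K <= l) w <= e.

Let w_homo (l l' : R) : 0 < l -> l <= l' -> w l <= w l'.
Proof.
move=> l0 ll'; rewrite -[leRHS]mul1r; apply: w_scale => //.
  exact: lt_le_trans ll'.
by rewrite mul1r.
Qed.

(** Rates above [K] contribute at most 1 by uniform integrability; below [B] the scaling condition
    gives [w l <= B * w 1 <= B]. *)
Let w_bounded : exists2 M : R, 0 <= M & forall N, average (lam N) predT w <= M.
Proof.
have [K hK] := w_ui ltr01; pose B := Num.max 1 K.
have B1 : 1 <= B by rewrite le_max lexx.
have B0 : 0 < B by exact: lt_le_trans B1.
exists (1 + B) => [|N]; first by rewrite addr_ge0// ltW.
(* For [N = 0] the average is 0, the inverse of 0 being 0. *)
have [->|N0] := posnP N.
  by rewrite /average invr0 mul0r addr_ge0// ltW.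
rewrite (average_split _ _ (fun l => K <= l)); apply: lerD; first exact: hK.
apply: le_trans (_ : average (lam N) predT (fun=> B) <= _).
  rewrite /average ler_wpM2l// [leRHS](bigID (fun i => ~~ (K <= lam N i)))/=.
  rewrite [X in _ <= X + _](eq_bigl
    (fun i => (predD predT (fun l => K <= l)) (lam N i))); last first.
    by move=> i /=; rewrite andbT.
  rewrite -[leLHS]addr0 lerD ?sumr_ge0//; last by move=> *; exact: ltW.
  apply: ler_sum => i /=; rewrite andbT -ltNge => lK.
  have lB : lam N i <= B by rewrite le_max (ltW lK) orbT.
  apply: le_trans (w_homo (lam_gt0 i) lB) _.
  rewrite -[leRHS]mulr1; apply: le_trans (_ : B * w 1 <= _).
    by apply: w_scale => //; rewrite mulr1.
  by rewrite ler_pM2l// w_le1.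
rewrite /average sumr_const card_ord -[B *+ N]mulr_natl mulrA mulVf ?mul1r//.
by rewrite pnatr_eq0 -lt0n.
Qed.

Variable g : R -> R.
Hypothesis g_homo : {homo g : x y / x <= y}.
Hypothesis g_ge0 : forall x, 0 <= g x.
Hypothesis g_le1 : forall x, g x <= 1.

(** With weight 1 and [g = G] this is [G_oo]; with the identity as weight and [g = G_0] it is the
    numerator of the limit. *)
Definition weighted_integral (x : R) : \bar R :=
  (\int[L]_(l in `]0%R, +oo[) (w l * g (x / l))%:E)%E.

Let integrand x l := w l * g (x / l).

Let measurable_integrand x : measurable_fun [set: R] (integrand x).
Proof.
apply: measurable_funM => //; apply: measurableT_comp.
  by apply: nondecreasing_measurable => // y z; exact: g_homo.
by apply: measurable_funM => //; exact: measurable_inv.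
Qed.

Let integrand_ge0 x (l : R) : 0 < l -> 0 <= integrand x l.
Proof. by move=> l0; apply: mulr_ge0 => //; exact: w_ge0. Qed.

Let exhaust (f : R -> R) : measurable_fun [set: R] f ->
  (forall l : R, 0 < l -> 0 <= f l) ->
  (\int[L]_(l in `](n.+1%:R^-1)%R, n.+1%:R%R]) (f l)%:E)%E @[n --> \oo] -->
  (\int[L]_(l in `]0%R, +oo[) (f l)%:E)%E.
Proof.
move=> mf f0.
have U : \bigcup_n (`](n.+1%:R^-1)%R, n.+1%:R]%classic : set R) = `]0, +oo[%classic.
  apply/seteqP; split => l /=; rewrite in_itv/= andbT.
    by move=> [n _]; rewrite /= in_itv/= => /andP[h _]; apply: lt_trans h; rewrite invr_gt0.
  move=> l0; have /ltr_add_invr[n] := l0; rewrite add0r => hn.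
  pose m := maxn n (Num.truncn l); exists m => //=; rewrite in_itv/=; apply/andP; split.
    by apply: le_lt_trans hn; rewrite lef_pV2 ?posrE// ler_nat ltnS leq_maxl.
  apply/ltW; apply: lt_le_trans (truncnS_gt l) _.
  by rewrite ler_nat ltnS leq_maxr.
rewrite -U; apply: ge0_nondecreasing_set_cvg_integral => //.
- move=> i j ij; apply/subsetPset => l /=; rewrite !in_itv/= => /andP[h1 h2].
  apply/andP; split; last by rewrite (le_trans h2)// ler_nat.
  by apply: le_lt_trans h1; rewrite lef_pV2 ?posrE// ler_nat.
- by move=> i; apply/measurable_EFinP; exact: measurable_funTS.
- move=> i l /=; rewrite in_itv/= => /andP[h _]; rewrite lee_fin f0//.
  by apply: lt_trans h; rewrite invr_gt0.
Qed.

Let sub_itv (f : R -> R) (a b a' b' : R) : measurable_fun [set: R] f ->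
  (forall l : R, 0 < l -> 0 <= f l) -> 0 <= a' -> a' <= a -> b <= b' ->
  (\int[L]_(l in `]a, b]) (f l)%:E <= \int[L]_(l in `]a', b']) (f l)%:E)%E.
Proof.
move=> mf f0 a0 aa bb; apply: ge0_subset_integral => //.
- by apply/measurable_EFinP; exact: measurable_funTS.
- by move=> l /=; rewrite in_itv/= => /andP[h _]; rewrite lee_fin f0// (le_lt_trans a0 h).
- move=> l /=; rewrite !in_itv/= => /andP[h1 h2].
  by rewrite (le_lt_trans aa h1) (le_trans h2 bb).
Qed.

(** On each bounded window, a grid of ratio 2 bounds the integral by twice an empirical average plus
    1, hence by a constant that does not depend on the window. *)
Let w_integral_fin : (\int[L]_(l in `]0%R, +oo[) (w l)%:E < +oo)%E.
Proof.
have [M M0 hM] := w_bounded.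
apply: (@le_lt_trans _ _ (2 * M + 1)%:E); last exact: ltry.
have cv := exhaust measurable_w w_ge0.
rewrite -(cvg_lim _ cv)//; apply: lime_le; first by apply/cvg_ex; eexists; exact: cv.
apply: nearW => n.
have n0 : 0 < n.+1%:R^-1 :> R by rewrite invr_gt0.
have [a /andP[a0 an] grid] := continuity_grid L (ltr0n R 2) n0.
have [k hk] := exprn_unbounded (n.+1%:R / a) (ltr1n R 2).
have nk : n.+1%:R <= a * 2 ^+ k by rewrite mulrC -ler_pdivrMr.
apply: le_trans (sub_itv measurable_w w_ge0 (ltW a0) (ltW an) nk) _.
have cell m l : a * 2 ^+ m < l <= a * 2 ^+ m.+1 ->
    w l <= w (a * 2 ^+ m.+1) <= 2 * w l.
  move=> /andP[al la]; have l0 : 0 < l.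
    by apply: lt_trans al; rewrite mulr_gt0// exprn_gt0.
  rewrite w_homo//=; apply: w_scale => //; first by rewrite ler1n.
    by rewrite mulr_gt0// exprn_gt0.
  by rewrite exprS mulrCA ler_pM2l// ltW.
have [N _ /(_ N (leqnn N)) h] := liminf_average_ge a0 (ltr1n R 2) lam_cvg grid
  k ltr01 measurable_w w_ge0 cell.
apply: le_trans h _.
rewrite lee_fin lerD2r; apply: le_trans (_ : 2 * average (lam N) predT w <= _).
  rewrite /average mulrCA ler_wpM2l// big_distrr/=.
  rewrite [leRHS](bigID (fun i => a < lam N i <= a * 2 ^+ k))/=.
  by rewrite lerDl sumr_ge0// => i _; apply: mulr_ge0 => //; exact: w_ge0.
by rewrite ler_pM2l.
Qed.

Lemma weighted_integral_fin x : weighted_integral x \is a fin_num.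
Proof.
rewrite ge0_fin_numE; last first.
  apply: integral_ge0 => l; rewrite /= in_itv/= andbT => l0.
  by rewrite lee_fin; exact: integrand_ge0.
apply: le_lt_trans w_integral_fin; apply: ge0_le_integral => //.
- by move=> l; rewrite /= in_itv/= andbT => l0; rewrite lee_fin; exact: integrand_ge0.
- by apply/measurable_EFinP; apply: measurable_funTS; exact: measurable_integrand.
- by apply/measurable_EFinP; exact: measurable_funTS.
- by move=> l; rewrite /= in_itv/= andbT => l0; rewrite lee_fin ler_piMr// w_ge0.
Qed.

Let small_mass (e : R) : 0 < e -> exists2 b : R, 0 < b &
  forall a, 0 < a < b -> distr_fun L a < e.
Proof.
move=> e0; have := @distr_fun_right_continuous R L 0; rewrite limit_law_pos => cv.
have [b /= b0 hb] : \forall a \near 0^'+, distr_fun L a < e.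
  by apply: (cvgr_lt _ cv).
exists b => // a /andP[a0 ab]; apply: hb => //=.
by rewrite sub0r normrN gtr0_norm.
Qed.

(** Within a cell of ratio r the rate varies by a factor at most r. The gap between x and y absorbs
    this in the argument of g, which thus need not be continuous, and a factor r close to 1 absorbs
    it in the weight. *)
Lemma limsup_weighted (x y e : R) : 0 < x -> x < y -> 0 < e ->
  \forall N \near \oo, average (lam N) predT (fun l => w l * g (x / l)) <=
    fine (weighted_integral y) + e.
Proof.
move=> x0 xy e0; set I := fine (weighted_integral y).
have I0 : 0 <= I.
  rewrite fine_ge0//; apply: integral_ge0 => l; rewrite /= in_itv/= andbT => l0.
  by rewrite lee_fin; exact: integrand_ge0.
have e4 : 0 < e / 4 by rewrite divr_gt0.
(* The first bound gives [r * x <= y], the second [r * I <= I + e / 4]. The other three quarters of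
   e go to the cell sums, the large rates and the small rates. *)
pose r := Num.min (y / x) (1 + e / 4 / (1 + I)).
have r1 : 1 < r.
  rewrite lt_min ltr_pdivlMr// mul1r xy /= ltrDl divr_gt0//.
  by rewrite ltr_pwDl.
have r0 : 0 < r by exact: lt_trans r1.
have rx : r * x <= y by rewrite -ler_pdivlMr// ge_min lexx.
have rI : r * I <= I + e / 4.
  have : r <= 1 + e / 4 / (1 + I) by rewrite ge_min lexx orbT.
  move=> /(ler_wpM2r I0) /le_trans; apply; rewrite mulrDl mul1r lerD2l.
  rewrite mulrAC ler_pdivrMr ?ltr_pwDl//.
  by apply: ler_wpM2l; [exact: ltW|rewrite lerDr].
have [b b0 hb] := small_mass e4.
have m0 : 0 < Num.min b 1 by rewrite lt_min b0 ltr01.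
have [a /andP[a0]] := continuity_grid L r0 m0.
rewrite lt_min => /andP[ab a1] grid.
have [K hK] := w_ui e4.
have [k hk] := exprn_unbounded (K / a) r1.
have Kk : K <= a * r ^+ k by rewrite mulrC -ler_pdivrMr.
pose h l := r * integrand y l.
have mh : measurable_fun setT h by apply: measurable_funM.
have h0 (l : R) : 0 < l -> 0 <= h l.
  by move=> l0; apply: mulr_ge0; [exact: ltW|exact: integrand_ge0].
have pt0 m : 0 < a * r ^+ m by rewrite mulr_gt0// exprn_gt0.
(* The largest value a cell allows: weight at its right end, g at its left end. *)
pose s m := w (a * r ^+ m.+1) * g (x / (a * r ^+ m)).
have s0 m : 0 <= s m by apply: mulr_ge0 => //; exact: w_ge0.
have cell m l : a * r ^+ m < l <= a * r ^+ m.+1 -> integrand x l <= s m <= h l.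
  move=> /andP[al la]; have l0 : 0 < l by exact: lt_trans al.
  apply/andP; split.
    apply: ler_pM => //; [exact: w_ge0|exact: w_homo|].
    by apply: g_homo; rewrite ler_pM2l// lef_pV2 ?posrE// ltW.
  rewrite /h /integrand mulrA; apply: ler_pM => //; first exact: w_ge0.
    by apply: w_scale => //; [exact: ltW|rewrite exprS mulrCA ler_pM2l// ltW].
  apply: g_homo; rewrite ler_pdivrMr// mulrAC ler_pdivlMr//.
  apply: le_trans (_ : x * (r * (a * r ^+ m)) <= _).
    by rewrite ler_pM2l// mulrCA -exprS.
  by rewrite (mulrA x r) (mulrC x r) ler_pM2r.
have hI : (\int[L]_(l in `]a, (a * r ^+ k)%R]) (h l)%:E <= (r * I)%:E)%E.
  rewrite EFinM fineK ?weighted_integral_fin// -ge0_integralZl//; last 3 first.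
  - by apply/measurable_EFinP; apply: measurable_funTS; exact: measurable_integrand.
  - by move=> l; rewrite /= in_itv/= andbT => l0; rewrite lee_fin; exact: integrand_ge0.
  - by rewrite lee_fin ltW.
  apply: ge0_subset_integral => //.
  - by apply/measurable_EFinP; exact: measurable_funTS.
  - by move=> l; rewrite /= in_itv/= andbT => l0; rewrite lee_fin h0.
  - move=> l /=; rewrite !in_itv/= andbT => /andP[al _]; exact: lt_trans al.
have lim := limsup_average_le a0 r1 lam_cvg grid (k := k) e4 mh h0 s0 cell
  (le_lt_trans hI (ltry _)).
have cemp : empirical_distr (lam N) a @[N --> \oo] --> distr_fun L a.
  by apply: lam_cvg; have := grid 0%N; rewrite expr0 mulr1.
have La : distr_fun L a < e / 4 by apply: hb; rewrite a0.
near=> N.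
have N0 : (0 < N)%N by near: N; exact: nbhs_infty_gt.
have h1 : average (lam N) (fun l => a < l <= a * r ^+ k) (integrand x) <= r * I + e / 4.
  apply: le_trans (_ : fine (\int[L]_(l in `]a, (a * r ^+ k)%R]) (h l)%:E) + e / 4 <= _).
    by near: N; exact: lim.
  rewrite lerD2r -lee_fin fineK// ge0_fin_numE; first exact: le_lt_trans hI (ltry _).
  apply: integral_ge0 => l; rewrite /= in_itv/= => /andP[al _].
  by rewrite lee_fin h0// (lt_trans a0).
have h2 : average (lam N) (fun l => a * r ^+ k < l) (integrand x) <= e / 4.
  apply: le_trans (hK N N0); rewrite /average ler_wpM2l//.
  rewrite [leRHS](bigID (fun i => a * r ^+ k < lam N i))/= -[leLHS]addr0 lerD//.
    rewrite [leRHS](eq_bigl (fun i => a * r ^+ k < lam N i)); last first.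
      move=> i; case: (ltP (a * r ^+ k) (lam N i)) => hl; rewrite ?andbF// andbT.
      by rewrite (le_trans Kk (ltW hl)).
    by apply: ler_sum => i _; rewrite ler_piMr//; exact: w_ge0.
  by apply: sumr_ge0 => i _; exact: w_ge0.
have h3 : average (lam N) (fun l => l <= a) (integrand x) <= e / 4.
  apply: le_trans (_ : empirical_distr (lam N) a <= _).
    rewrite /average /empirical_distr ler_wpM2l// big_mkcond/=.
    apply: ler_sum => i _; case: ifP => // la.
    rewrite -[leRHS]mulr1; apply: ler_pM => //; first exact: w_ge0.
    by apply: w_le1 => //; apply: le_trans la (ltW a1).
  by apply/ltW; near: N; exact: (cvgr_lt _ cemp).
have -> : average (lam N) predT (fun l => w l * g (x / l)) =
    average (lam N) (fun l => l <= a) (integrand x) +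
    (average (lam N) (fun l => a < l <= a * r ^+ k) (integrand x) +
     average (lam N) (fun l => a * r ^+ k < l) (integrand x)).
  rewrite (average_split _ _ (fun l => l <= a)); congr (_ + _).
  rewrite (average_split _ _ (fun l => l <= a * r ^+ k)); congr (_ + _).
    by apply: eq_average => // i /=; rewrite andbT -ltNge.
  apply: eq_average => // i /=; rewrite andbT -!ltNge.
  case: (ltP (a * r ^+ k) (lam N i)) => //= hl.
  by apply: le_lt_trans hl; rewrite ler_peMr ?(ltW a0)// exprn_ege1// ltW.
by lra.
Unshelve. all: by end_near. Qed.

Lemma liminf_weighted (x y e : R) : 0 < y -> y < x -> 0 < e ->
  \forall N \near \oo, fine (weighted_integral y) - e <=
    average (lam N) predT (fun l => w l * g (x / l)).
Proof.
move=> y0 yx e0; set I := fine (weighted_integral y).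
have x0 : 0 < x by exact: lt_trans yx.
have e4 : 0 < e / 4 by rewrite divr_gt0.
have [M M0 hM] := w_bounded.
(* Here the factor r multiplies the average rather than the integral, so the uniform bound [M] on
   averages replaces the integral. *)
pose r := Num.min (x / y) (1 + e / 4 / (1 + M)).
have r1 : 1 < r.
  rewrite lt_min ltr_pdivlMr// mul1r yx /= ltrDl divr_gt0//.
  by rewrite ltr_pwDl.
have r0 : 0 < r by exact: lt_trans r1.
have ry : r * y <= x by rewrite -ler_pdivlMr// ge_min lexx.
have rM (u : R) : 0 <= u -> u <= M -> r * u <= u + e / 4.
  move=> u0 uM; have : r <= 1 + e / 4 / (1 + M) by rewrite ge_min lexx orbT.
  move=> /(ler_wpM2r u0) /le_trans; apply; rewrite mulrDl mul1r lerD2l.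
  rewrite mulrAC ler_pdivrMr ?ltr_pwDl//.
  by apply: ler_wpM2l; [exact: ltW|rewrite (le_trans uM)// lerDr].
have cvI : (\int[L]_(l in `](n.+1%:R^-1)%R, n.+1%:R%R]) (integrand y l)%:E)%E @[n --> \oo]
    --> (I%:E : \bar R).
  rewrite fineK ?weighted_integral_fin//; apply: exhaust => //.
  by move=> l; exact: integrand_ge0.
(* A bounded window carrying all but [e / 4] of the integral; the remaining rates are dropped from
   the average, being nonnegative terms. *)
have [n hn] : exists n : nat, ((I - e / 4)%:E <=
    \int[L]_(l in `](n.+1%:R^-1)%R, n.+1%:R%R]) (integrand y l)%:E)%E.
  apply: contrapT => H.
  have : (I%:E <= (I - e / 4)%:E)%E.
    rewrite -(cvg_lim _ cvI)//; apply: lime_le; first by apply/cvg_ex; eexists; exact: cvI.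
    by apply: nearW => n; rewrite leNgt; apply/negP => h; apply: H; exists n; exact: ltW.
  by rewrite lee_fin lerBrDr gerDl leNgt e4.
have n0 : 0 < n.+1%:R^-1 :> R by rewrite invr_gt0.
have [a /andP[a0 an] grid] := continuity_grid L r0 n0.
have [k hk] := exprn_unbounded (n.+1%:R / a) r1.
have nk : n.+1%:R <= a * r ^+ k by rewrite mulrC -ler_pdivrMr.
have pt0 m : 0 < a * r ^+ m by rewrite mulr_gt0// exprn_gt0.
pose s m := r * w (a * r ^+ m) * g (x / (a * r ^+ m.+1)).
pose f l := r * integrand x l.
have cell m l : a * r ^+ m < l <= a * r ^+ m.+1 -> integrand y l <= s m <= f l.
  move=> /andP[al la]; have l0 : 0 < l by exact: lt_trans al.
  apply/andP; split.
    apply: ler_pM => //; first exact: w_ge0.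
      by apply: w_scale => //; [exact: ltW|rewrite mulrCA -exprS].
    apply: g_homo; rewrite ler_pdivrMr// mulrAC ler_pdivlMr//.
    rewrite (_ : y * (a * r ^+ m.+1) = r * y * (a * r ^+ m)); last by rewrite exprS; ring.
    by apply: ler_pM => //; [rewrite mulr_ge0// ltW|exact: ltW|exact: ltW].
  rewrite /f /integrand mulrA; apply: ler_pM => //.
  - by apply: mulr_ge0; [exact: ltW|exact: w_ge0].
  - by rewrite ler_pM2l// w_homo// ltW.
  - by apply: g_homo; rewrite ler_pM2l// lef_pV2 ?posrE.
have lim := liminf_average_ge a0 r1 lam_cvg grid k e4 (measurable_integrand y)
  (@integrand_ge0 y) cell.
near=> N.
have h1 : I - e / 4 <= average (lam N) (fun l => a < l <= a * r ^+ k) f + e / 4.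
  rewrite -lee_fin; apply: le_trans hn _; apply: le_trans.
    exact: (sub_itv (measurable_integrand y) (@integrand_ge0 y) (ltW a0) (ltW an) nk).
  by near: N; exact: lim.
have h2 : average (lam N) (fun l => a < l <= a * r ^+ k) f <=
    r * average (lam N) predT (integrand x).
  rewrite /average mulrCA ler_wpM2l// big_distrr/=.
  rewrite [leRHS](bigID (fun i => a < lam N i <= a * r ^+ k))/=.
  rewrite lerDl sumr_ge0// => i _.
  by apply: mulr_ge0; [exact: ltW|exact: integrand_ge0].
have h3 : 0 <= average (lam N) predT (integrand x).
  by apply: average_ge0 => i _; exact: integrand_ge0.
have h4 : average (lam N) predT (integrand x) <= M.
  by apply: le_trans (hM N); apply: average_le => i _; rewrite ler_piMr// w_ge0.
have h5 := rM _ h3 h4.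
rewrite -[average _ _ _]/(average (lam N) predT (integrand x)); lra.
Unshelve. all: by end_near. Qed.

End weighted_averages.

(** * Limit of the miss probability *)

Section hazard.
Context {R : realType}.
Variables (F0 : probability R R) (f0 : R -> R).
Hypothesis density : is_density F0 f0.

Lemma density_atomless x : F0 [set x] = 0%E.
Proof. by case: density => _ _ ->//; apply: (@integral_Sset1 _ _ _ x). Qed.

Lemma measurable_hazard : measurable_fun [set: R] (hazard_rate F0 f0).
Proof.
case: density => mf0 _ _; apply: measurable_funM => //.
apply: (measurableT_comp measurable_inv); apply: measurable_funB => //.
exact: measurable_distr_fun.
Qed.

Lemma hazard_ge0 t : 0 <= hazard_rate F0 f0 t.
Proof.
case: density => _ f0_ge0 _; rewrite /hazard_rate divr_ge0// subr_ge0.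
exact: distr_fun_le1.
Qed.

Hypothesis F0_supp : F0 `[0, +oo[%classic = 1%E.

Let measurable_exhausted : measurable [set t : R | 1 <= distr_fun F0 t].
Proof.
have -> : [set t | 1 <= distr_fun F0 t] = distr_fun F0 @^-1` `[1, +oo[%classic.
  by apply/seteqP; split => t /=; rewrite in_itv/= andbT.
by rewrite -[X in measurable X]setTI; exact: measurable_distr_fun.
Qed.

(** By right continuity the distribution function is already 1 at the infimum of this set; nothing
    is left to its right, and the infimum itself is no atom. *)
Let exhausted_null : F0 [set t | 1 <= distr_fun F0 t] = 0%E.
Proof.
set S := [set t | _].
have [->|/set0P[t0 St0]] := eqVneq S set0; first by rewrite measure0.
have S_lb : has_lbound S.
  exists 0 => t St; rewrite leNgt; apply/negP => t_lt0.
  have : distr_fun F0 t <= 0.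
    rewrite -lee_fin distr_funE.
    rewrite -[leRHS](atomless_nonneg_le0 F0_supp density_atomless).
    apply: le_measure; rewrite ?inE// => s /=; rewrite !in_itv/= => /le_trans; apply.
    exact: ltW.
  by rewrite leNgt (lt_le_trans ltr01).
have S_inf : has_inf S by split => //; exists t0.
have Fa : 1 <= distr_fun F0 (inf S).
  rewrite leNgt; apply/negP => Fa.
  have cv : distr_fun F0 y @[y --> (inf S)^'+] --> distr_fun F0 (inf S).
    exact: distr_fun_right_continuous.
  have [e/= e0 he] := cvgr_lt _ cv _ Fa.
  have [t St ht] := inf_adherent e0 S_inf.
  have := ge_inf S_lb St; rewrite le_eqVlt => /orP[/eqP ta|at_].
    by move: Fa; rewrite ta ltNge; move/negP; apply.
  have : distr_fun F0 t < 1.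
    apply: he => //=; rewrite ltr_distl; apply/andP; split; lra.
  by rewrite ltNge; move/negP; apply.
have right_null : F0 `]inf S, +oo[%classic = 0%E.
  rewrite distr_fun_gt; have -> : distr_fun F0 (inf S) = 1.
    by apply/eqP; rewrite eq_le Fa distr_fun_le1.
  by rewrite subrr.
apply/eqP; rewrite eq_le measure_ge0 andbT.
rewrite -[leRHS](null_set_setU _ _ (density_atomless (inf S)) right_null)//.
apply: le_measure; rewrite ?inE//; first exact: measurableU.
move=> t St; have := ge_inf S_lb St; rewrite le_eqVlt => /orP[/eqP ->|h]; first by left.
by right => /=; rewrite in_itv/= h.
Qed.

(** The hazard rate vanishes where the density does, a null set, or where it takes its default
    value. It makes the limit 0 when [thetastar] is 0. *)
Lemma hazard_distr0 : hazard_distr F0 (hazard_rate F0 f0) 0 = 0.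
Proof.
have [mf0 f0_ge0 dens] := density.
have m0 : measurable [set t : R | f0 t = 0].
  rewrite -[X in measurable X]setTI; have -> : [set t | f0 t = 0] = f0 @^-1` [set 0] by [].
  exact: mf0.
have null0 : F0 [set t : R | f0 t = 0] = 0%E.
  rewrite dens// integral0_eq// => t /= ->//.
have sub : hazard_rate F0 f0 @^-1` `[0, 0]%classic `<=`
    [set t : R | f0 t = 0] `|` [set t | 1 <= distr_fun F0 t].
  move=> t /=; rewrite in_itv/= => /andP[h1 h2].
  have : hazard_rate F0 f0 t == 0 by rewrite eq_le h1 h2.
  rewrite /hazard_rate mulf_eq0 => /orP[/eqP ->|]; first by left.
  by rewrite invr_eq0 subr_eq0 => /eqP <-; right => /=.
suff : F0 (hazard_rate F0 f0 @^-1` `[0, 0]%classic) = 0%E by rewrite /hazard_distr => ->.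
apply/eqP; rewrite eq_le measure_ge0 andbT.
apply: le_trans (le_measure _ _ _ sub) _.
- by rewrite inE -[X in measurable X]setTI; exact: measurable_hazard.
- by rewrite inE; exact: measurableU.
- by rewrite -[leRHS](null_set_setU m0 measurable_exhausted null0 exhausted_null).
Qed.

End hazard.

(** The law of [eta] under [nu], so that the facts on distribution functions apply to [G] and
    [G_0]. *)
Lemma hazard_distrE (R : realType) (nu : probability R R) (eta : R -> R) :
  measurable_fun [set: R] eta -> (forall t, 0 <= eta t) ->
  exists mu : probability R R, hazard_distr nu eta = distr_fun mu.
Proof.
move=> meta eta_ge0.
pose X : {mfun R >-> R} := HB.pack eta (isMeasurableFun.Build _ _ _ _ _ meta).
exists (distribution nu X); apply/funext => x.
rewrite /hazard_distr /distr_fun /distribution /pushforward; congr (fine (nu _)).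
by apply/seteqP; split => t /=; rewrite !in_itv/= ?eta_ge0//.
Qed.

Lemma eq_hazard_distr (R : realType) (nu nu' : set R -> \bar R) (eta : R -> R) :
  (forall A, measurable A -> nu A = nu' A) -> measurable_fun [set: R] eta ->
  hazard_distr nu eta = hazard_distr nu' eta.
Proof.
move=> nuE meta; apply/funext => x; rewrite /hazard_distr nuE//.
by rewrite -[X in measurable X]setTI; exact: meta.
Qed.

Lemma countable_negligible (R : realType) (mu : probability R R) (A : set R) :
  countable A -> (forall x, A x -> mu [set x] = 0%E) -> mu.-negligible A.
Proof.
move=> /countable_injP[f finj] A0.
apply: (@negligibleS _ _ _ mu (\bigcup_n [set x | A x /\ f x = n])).
  by move=> x Ax; exists (f x).
apply: negligible_bigcup => n.
have [[x [Ax fx]]|none] := pselect (exists x, A x /\ f x = n).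
  apply: (@negligibleS _ _ _ mu [set x]); last by apply/negligibleP => //; exact: A0.
  by move=> y [Ay fy]; apply: finj; rewrite ?inE// fx fy.
rewrite (_ : [set x | _] = set0); first exact: negligible_set0.
by apply/seteqP; split => // x hx; apply: none; exists x.
Qed.

Lemma continuous_distr_fun (R : realType) (mu : probability R R) (x : R) :
  {for x, continuous (distr_fun mu)} -> mu [set x] = 0%E.
Proof.
move=> cx; apply/eqP; rewrite eq_le measure_ge0 andbT; apply/lee_addgt0Pr => e e0.
rewrite add0e.
have cv : distr_fun mu y @[y --> x] --> distr_fun mu x by exact: cx.
have h : distr_fun mu x - e < distr_fun mu x by rewrite ltrBlDr ltrDl.
have [r /= r0 hr] := cvgr_gt _ cv _ h.
pose y := x - r / 2.
have yx : y < x by rewrite /y ltrBlDr ltrDl divr_gt0.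
have hy : distr_fun mu x - e < distr_fun mu y.
  apply: hr; rewrite /= /y opprB addrC subrK gtr0_norm ?divr_gt0//.
  by rewrite ltr_pdivrMr// ltr_pMr// ltr1n.
apply: le_trans (_ : mu `]y, x]%classic <= _)%E.
  by apply: le_measure; rewrite ?inE// => z /= ->; rewrite in_itv/= yx lexx.
by rewrite (distr_fun_itv _ (ltW yx)) lee_fin lerBlDr -lerBlDl ltW.
Qed.

Section weighted_limits.
Context {R : realType}.
Variables (L : probability R R) (w : R -> R).
Hypothesis measurable_w : measurable_fun [set: R] w.
Hypothesis w_ge0 : forall l : R, 0 < l -> 0 <= w l.
Hypothesis w_fin : (\int[L]_(l in `]0%R, +oo[) (w l)%:E < +oo)%E.

Lemma measurable_scaled_distr (mu : probability R R) (x : R) :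
  measurable_fun [set: R] (fun l : R => distr_fun mu (x / l)).
Proof.
apply: (measurableT_comp (measurable_distr_fun mu)).
by apply: measurable_funM => //; exact: measurable_inv.
Qed.

(** Dominated convergence, with the integrable weight as dominating function. Almost everywhere
    convergence is the right generality for levels increasing to x, where jumps of [mu]
    interfere. *)
Lemma weighted_integral_cvg (mu : probability R R) (s : nat -> R) (h : R -> R) :
  measurable_fun [set: R] h ->
  {ae L, forall l : R, 0 < l -> distr_fun mu (s n / l) @[n --> \oo] --> h l} ->
  fine (weighted_integral L w (distr_fun mu) (s n)) @[n --> \oo] -->
    fine (\int[L]_(l in `]0%R, +oo[) (w l * h l)%:E)%E.
Proof.
move=> mh sh.
pose D : set R := `]0, +oo[%classic.
have mw : measurable_fun D (EFin \o w).
  by apply/measurable_EFinP; exact: measurable_funTS.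
have w_int : L.-integrable D (EFin \o w).
  apply/integrableP; split => //; apply: le_lt_trans w_fin.
  apply: ge0_le_integral => //=.
  - exact: measurable_itv.
  - by apply/measurable_EFinP; apply: measurableT_comp => //; exact: measurable_funTS.
  - by move=> l; rewrite /D/= in_itv/= andbT => l0; rewrite lee_fin ger0_norm// w_ge0.
have [|||||fint _ cv] := @dominated_convergence _ _ R L D
    (measurable_itv _) (fun n l => (w l * distr_fun mu (s n / l))%:E)
    (fun l => (w l * h l)%:E) (EFin \o w).
- move=> n; apply/measurable_EFinP; apply: measurable_funTS.
  by apply: measurable_funM => //; exact: measurable_scaled_distr.
- by apply/measurable_EFinP; apply: measurable_funTS; exact: measurable_funM.
- apply: filterS sh => l hl; rewrite /D/= in_itv/= andbT => l0.
  apply: cvg_EFin; first exact: nearW.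
  by apply: cvgMr; exact: hl.
- exact: w_int.
- apply: aeW => l n; rewrite /D/= in_itv/= andbT => l0.
  rewrite lee_fin normrM !ger0_norm ?distr_fun_ge0 ?w_ge0//.
  by rewrite ler_piMr ?w_ge0// distr_fun_le1.
apply: fine_cvg; rewrite fineK; last exact: integrable_fin_num.
exact: cv.
Qed.

Lemma weighted_integral_right (mu : probability R R) (x e : R) : 0 < e ->
  exists2 y : R, x < y & fine (weighted_integral L w (distr_fun mu) y) <=
    fine (weighted_integral L w (distr_fun mu) x) + e.
Proof.
move=> e0; pose s (n : nat) : R := x + n.+1%:R^-1.
have scv (l : R) : 0 < l -> distr_fun mu (s n / l) @[n --> \oo] --> distr_fun mu (x / l).
  move=> l0; have rc : distr_fun mu y @[y --> (x / l)^'+] --> distr_fun mu (x / l).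
    exact: distr_fun_right_continuous.
  apply: ((cvg_at_rightP _ _ _).1 rc); split.
    by move=> n; rewrite ltr_pM2r ?invr_gt0// ltrDl invr_gt0.
  apply: cvgMl; rewrite -[X in _ --> X]addr0; apply: cvgD; first exact: cvg_cst.
  exact: cvg_harmonic.
have cv := weighted_integral_cvg (measurable_scaled_distr mu x) (aeW _ scv).
set I := fine _ in cv *; have I_lt : I < I + e by rewrite ltrDl.
have [n _ /(_ n (leqnn n)) hn] := cvgr_le _ cv _ I_lt.
by exists (s n) => //; rewrite ltrDl invr_gt0.
Qed.

(* The l > 0 with x / l a discontinuity of mu form a countable set of continuity
   points of L. *)
Lemma weighted_integral_left (mu : probability R R) (x e : R) : 0 < x -> 0 < e ->
  ~ [set l * z | l in discontinuities (distr_fun L) & z in discontinuities (distr_fun mu)] x ->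
  exists2 y : R, 0 < y < x & fine (weighted_integral L w (distr_fun mu) x) - e <=
    fine (weighted_integral L w (distr_fun mu) y).
Proof.
(* The shift by 2 keeps [s 0] positive. *)
move=> x0 e0 xN; pose s (n : nat) : R := x - x * n.+2%:R^-1.
have s_lt n : s n < x by rewrite ltrBlDr ltrDl mulr_gt0// invr_gt0.
have s_gt0 n : 0 < s n.
  by rewrite subr_gt0 -[ltRHS]mulr1 ltr_pM2l// invf_lt1// ltr1n.
have scv : {ae L, forall l : R, 0 < l ->
    distr_fun mu (s n / l) @[n --> \oo] --> distr_fun mu (x / l)}.
  pose B := [set l : R | 0 < l /\ discontinuities (distr_fun mu) (x / l)].
  have B_null : L.-negligible B.
    apply: countable_negligible => [|l [l0 lD]].
      have /countable_injP[f finj] := countable_discontinuities mu.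
      apply/countable_injP; exists (fun l => f (x / l)) => l l'.
      rewrite !inE => -[l0 lD] [l'0 l'D] /finj; rewrite !inE => /(_ lD l'D) h.
      by apply: invr_inj; apply: mulfI h; rewrite gt_eqF.
    apply: continuous_distr_fun; apply: contrapT => ld; apply: xN.
    by exists l => //; exists (x / l) => //; rewrite mulrC divfK ?gt_eqF.
  apply: negligibleS B_null => l /=; apply: contra_notP => lB l0.
  have xc : {for x / l, continuous (distr_fun mu)}.
    by apply: contrapT => xd; apply: lB; split.
  have lc : distr_fun mu y @[y --> (x / l)^'-] --> distr_fun mu (x / l).
    by apply: cvg_at_left_filter; exact: xc.
  apply: ((cvg_at_leftP _ _ _).1 lc); split.
    by move=> n; rewrite ltr_pM2r ?invr_gt0.
  apply: cvgMl; rewrite -[X in _ --> X]subr0; apply: cvgB; first exact: cvg_cst.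
  rewrite -[X in _ --> X](mulr0 x); apply: cvgMr.
  have := @cvg_harmonic R; rewrite -(cvg_shiftS (fun n => n.+1%:R^-1 : R)).
  exact.
have cv := weighted_integral_cvg (measurable_scaled_distr mu x) scv.
set I := fine _ in cv *; have I_gt : I - e < I by rewrite ltrBlDr ltrDl.
have [n _ /(_ n (leqnn n)) hn] := cvgr_ge _ cv _ I_gt.
by exists (s n) => //; rewrite s_gt0 s_lt.
Qed.

End weighted_limits.

Section limits.
Context {R : realType}.
Variable L : probability R R.
Variable lam : forall N, 'I_N -> R.
Arguments lam : clear implicits.
Hypothesis lam_gt0 : forall N i, 0 < lam N i.
Hypothesis lam_cvg : weakly_converges (fun N => empirical_distr (lam N)) L.
Hypothesis L0 : L [set 0] = 0%E.
Hypothesis lam_ui : unif_integrable lam.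

Let ui_id (e : R) : 0 < e -> exists K : R, forall N, (0 < N)%N ->
  average (lam N) (fun l => K <= l) id <= e.
Proof. by move=> /lam_ui[K _ hK]; exists K => N N0; exact: hK. Qed.

(** Above a threshold that is at least 1, the weight 1 is dominated by the rate. *)
Let ui_1 (e : R) : 0 < e -> exists K : R, forall N, (0 < N)%N ->
  average (lam N) (fun l => K <= l) (fun=> 1) <= e.
Proof.
move=> /lam_ui[K _ hK]; exists (Num.max 1 K) => N N0.
apply: le_trans (hK N N0); rewrite /average ler_wpM2l//.
rewrite [leLHS]big_mkcond [leRHS]big_mkcond/=; apply: ler_sum => i _.
by rewrite ge_max; case: (leP 1 (lam N i)); case: (leP K (lam N i)) => //= *; exact: ltW.
Qed.

Let scale_id (r l l' : R) : 1 <= r -> 0 < l -> 0 < l' -> l <= r * l' -> id l <= r * id l'.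
Proof. by []. Qed.

Let scale_1 (r l l' : R) : 1 <= r -> 0 < l -> 0 < l' -> l <= r * l' -> (1 : R) <= r * 1.
Proof. by rewrite mulr1. Qed.

Let one_homo : {homo (fun _ : R => 1 : R) : x y / x <= y}.
Proof. by []. Qed.

Let measurable_1 : measurable_fun [set: R] (fun=> 1 : R).
Proof. exact: measurable_cst. Qed.

Let id_ge0 (l : R) : 0 < l -> 0 <= id l.
Proof. exact: ltW. Qed.

Let one_ge0 (l : R) : 0 < l -> (0 : R) <= 1.
Proof. by []. Qed.

Let id_le1 (l : R) : 0 < l -> l <= 1 -> id l <= 1.
Proof. by []. Qed.

Let one_le1 (l : R) : 0 < l -> l <= 1 -> (1 : R) <= 1.
Proof. by []. Qed.

Let limsup_id := limsup_weighted lam_gt0 lam_cvg L0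
  (@measurable_id _ R setT) id_ge0 scale_id id_le1 ui_id.
Let liminf_id := liminf_weighted lam_gt0 lam_cvg
  (@measurable_id _ R setT) id_ge0 scale_id id_le1 ui_id.
Let fin_id := weighted_integral_fin lam_gt0 lam_cvg
  (@measurable_id _ R setT) id_ge0 scale_id id_le1 ui_id.
Let limsup_1 := limsup_weighted lam_gt0 lam_cvg L0 measurable_1 one_ge0 scale_1 one_le1 ui_1.
Let liminf_1 := liminf_weighted lam_gt0 lam_cvg measurable_1 one_ge0 scale_1 one_le1 ui_1.
Let fin_1 := weighted_integral_fin lam_gt0 lam_cvg measurable_1 one_ge0 scale_1 one_le1 ui_1.

Let mean_integralE : weighted_integral L id (fun=> 1) 1 = (\int[L]_(l in `]0%R, +oo[) l%:E)%E.
Proof. by rewrite /weighted_integral; apply: eq_integral => l _; rewrite mulr1. Qed.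

Lemma limit_mean_fin : (\int[L]_(l in `]0%R, +oo[) l%:E < +oo)%E.
Proof.
have := fin_id one_homo (fun=> ler01) (fun=> lexx 1) 1.
by rewrite mean_integralE => /fin_numP[_]; rewrite lt_neqAle leey andbT.
Qed.

Lemma limit_mean_gt0 : 0 < \int[L]_(l in `]0, +oo[) l.
Proof.
have rc : distr_fun L y @[y --> 0^'+] --> distr_fun L 0 by exact: distr_fun_right_continuous.
rewrite (limit_law_pos lam_gt0 lam_cvg L0) in rc.
have [r /= r0 hr] := cvgr_lt _ rc _ ltr01.
pose a := r / 2; have a0 : 0 < a by rewrite divr_gt0.
have aL : distr_fun L a < 1.
  by apply: hr => //=; rewrite sub0r normrN gtr0_norm// /a; lra.
rewrite -lte_fin fineK; last first.
  by rewrite ge0_fin_numE ?limit_mean_fin//;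
    apply: integral_ge0 => l; rewrite /= in_itv/= andbT lee_fin => /ltW.
apply: lt_le_trans (_ : (a%:E * L `]a, +oo[%classic <= _)%E).
  by rewrite distr_fun_gt -EFinM lte_fin mulr_gt0// subr_gt0.
rewrite -integral_cst//.
apply: le_trans (_ : (\int[L]_(l in `]a, +oo[) l%:E <= _)%E).
  apply: ge0_le_integral => //.
  - by move=> l _; rewrite lee_fin ltW.
  - by move=> l; rewrite /= in_itv/= andbT lee_fin => /ltW.
apply: ge0_subset_integral => //.
- by move=> l; rewrite /= in_itv/= andbT lee_fin => /ltW.
- by move=> l; rewrite /= !in_itv/= !andbT; exact: lt_trans.
Qed.

(** With g constant the level no longer matters, so the upper and the lower bound have the same
    limit. *)
Lemma mean_cvg : average (lam N) predT id @[N --> \oo] --> \int[L]_(l in `]0, +oo[) l.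
Proof.
have E N : average (lam N) predT (fun l => id l * 1) = average (lam N) predT id.
  by apply: eq_average => // i _; rewrite mulr1.
have E' (x : R) : fine (weighted_integral L id (fun=> 1) x) = \int[L]_(l in `]0, +oo[) l.
  by rewrite -[RHS]/(fine _) -mean_integralE.
apply/cvgrPdist_le => e e0.
have upper := limsup_id one_homo (fun=> ler01) (fun=> lexx 1) ltr01 (ltr1n R 2) e0.
have lower := liminf_id one_homo (fun=> ler01) (fun=> lexx 1) ltr01 (ltr1n R 2) e0.
apply: filterS2 lower upper => N; rewrite E !E' => h1 h2.
by rewrite ler_distl; apply/andP; split; lra.
Qed.

Section ratio.
Variable mu : probability R R.
Let mean := \int[L]_(l in `]0, +oo[) l.
Let I x := fine (weighted_integral L id (distr_fun mu) x).
Let ratio N x := average (lam N) predT (fun l => l * distr_fun mu (x / l)) /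
  average (lam N) predT id.

Lemma limsup_ratio (x y e : R) : 0 < x -> x < y -> 0 < e ->
  \forall N \near \oo, ratio N x <= I y / mean + e.
Proof.
move=> x0 xy e0; have m0 := limit_mean_gt0.
(* Divided by the limit mean, d costs [e / 2]; the other half absorbs the convergence of the
   denominator. *)
pose d := mean * e / 2; have d0 : 0 < d by rewrite divr_gt0// mulr_gt0.
have cv : (I y + d) / average (lam N) predT id @[N --> \oo] --> (I y + d) / mean.
  by apply: cvgMr; apply: cvgV; [rewrite gt_eqF|exact: mean_cvg].
have lt_e : (I y + d) / mean < I y / mean + e.
  rewrite mulrDl ltrD2l /d -mulrA mulrAC divff ?gt_eqF// mul1r; lra.
have := limsup_id (distr_fun_homo mu) (distr_fun_ge0 mu) (distr_fun_le1 mu) x0 xy d0.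
move=> upper; apply: filterS2 (cvgr_le _ cv _ lt_e) upper => N h1 h2; apply: le_trans h1.
rewrite /ratio ler_wpM2r// invr_ge0 average_ge0// => i _; exact: ltW.
Qed.

Lemma liminf_ratio (x y e : R) : 0 < y -> y < x -> 0 < e ->
  \forall N \near \oo, I y / mean - e <= ratio N x.
Proof.
move=> y0 yx e0; have m0 := limit_mean_gt0.
pose d := mean * e / 2; have d0 : 0 < d by rewrite divr_gt0// mulr_gt0.
have cv : (I y - d) / average (lam N) predT id @[N --> \oo] --> (I y - d) / mean.
  by apply: cvgMr; apply: cvgV; [rewrite gt_eqF|exact: mean_cvg].
have lt_e : I y / mean - e < (I y - d) / mean.
  rewrite mulrBl ltrD2l ltrN2 /d -mulrA mulrAC divff ?gt_eqF// mul1r; lra.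
have := liminf_id (distr_fun_homo mu) (distr_fun_ge0 mu) (distr_fun_le1 mu) y0 yx d0.
move=> lower; apply: filterS2 (cvgr_ge _ cv _ lt_e) lower => N h1 h2; apply: le_trans h1 _.
rewrite /ratio ler_wpM2r// invr_ge0 average_ge0// => i _; exact: ltW.
Qed.

Let mixE x : fine (weighted_integral L (fun=> 1) (distr_fun mu) x) =
  mixture_distr (distr_fun mu) L x.
Proof.
rewrite /mixture_distr /Rintegral /weighted_integral; congr fine.
by apply: eq_integral => l _; rewrite mul1r.
Qed.

Lemma limsup_mixture (x y e : R) : 0 < x -> x < y -> 0 < e ->
  \forall N \near \oo, average (lam N) predT (fun l => distr_fun mu (x / l)) <=
    mixture_distr (distr_fun mu) L y + e.
Proof.
move=> x0 xy e0; rewrite -mixE.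
have := limsup_1 (distr_fun_homo mu) (distr_fun_ge0 mu) (distr_fun_le1 mu) x0 xy e0.
apply: filterS => N; apply: le_trans; apply: average_le => i _; by rewrite mul1r.
Qed.

Lemma liminf_mixture (x y e : R) : 0 < y -> y < x -> 0 < e ->
  \forall N \near \oo, mixture_distr (distr_fun mu) L y - e <=
    average (lam N) predT (fun l => distr_fun mu (x / l)).
Proof.
move=> y0 yx e0; rewrite -mixE.
have := liminf_1 (distr_fun_homo mu) (distr_fun_ge0 mu) (distr_fun_le1 mu) y0 yx e0.
apply: filterS => N /le_trans; apply; apply: average_le => i _; by rewrite mul1r.
Qed.

Lemma mixture_homo : {homo mixture_distr (distr_fun mu) L : x y / x <= y}.
Proof.
move=> x y xy; rewrite -!mixE fine_le//.
- exact: fin_1 (distr_fun_homo mu) (distr_fun_ge0 mu) (distr_fun_le1 mu) _.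
- exact: fin_1 (distr_fun_homo mu) (distr_fun_ge0 mu) (distr_fun_le1 mu) _.
apply: ge0_le_integral => //.
- by move=> l _; rewrite lee_fin mul1r distr_fun_ge0.
- apply/measurable_EFinP; apply: measurable_funTS; apply: measurable_funM => //.
  exact: measurable_scaled_distr.
- apply/measurable_EFinP; apply: measurable_funTS; apply: measurable_funM => //.
  exact: measurable_scaled_distr.
- move=> l; rewrite /= in_itv/= andbT => l0; rewrite lee_fin !mul1r.
  by apply: distr_fun_homo; rewrite ler_pM2r ?invr_gt0.
Qed.

(** It ensures that the quantile at [1 - c], which is below 1, is finite. *)
Lemma mixture_tail (e : R) : 0 < e ->
  exists2 x : R, 0 <= x & 1 - e < mixture_distr (distr_fun mu) L x.
Proof.
move=> e0.
have mass1 : (\int[L]_(l in `]0%R, +oo[) (1 * 1 : R)%:E)%E = 1%E.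
  rewrite mulr1 integral_cst// mul1e.
  have := distr_fun_gt L 0; rewrite (limit_law_pos lam_gt0 lam_cvg L0) subr0; exact.
have w1_fin : (\int[L]_(l in `]0%R, +oo[) (1 : R)%:E < +oo)%E.
  by move: mass1; rewrite mulr1 => ->; rewrite ltry.
have scv : {ae L, forall l : R, 0 < l -> distr_fun mu (n%:R / l) @[n --> \oo] --> (1 : R)}.
  apply: aeW => l l0; apply/cvgrPdist_lt => r r0.
  have [x0 hx0] := distr_fun_tail mu r0.
  exists (Num.truncn (x0 * l)).+1 => // n /= hn.
  have h : 1 - r < distr_fun mu (n%:R / l).
    apply: hx0; rewrite ler_pdivlMr//; apply/ltW; apply: lt_le_trans (truncnS_gt _) _.
    by rewrite ler_nat.
  by rewrite ger0_norm ?subr_ge0 ?distr_fun_le1//; lra.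
have cv := weighted_integral_cvg measurable_1 one_ge0 w1_fin measurable_1 scv.
rewrite mass1 in cv.
have h : 1 - e < 1 by rewrite ltrBlDr ltrDl.
have [n _ /(_ n (leqnn n)) hn] := cvgr_gt _ cv _ h.
by exists n%:R => //; rewrite -mixE.
Qed.

End ratio.
End limits.

Lemma quantile_nonneg (R : realType) (H : R -> R) (p : R) : (0 <= quantile H p)%E.
Proof. by apply/ereal_infP => _ [y [y0 _] <-]; rewrite lee_fin. Qed.

Lemma fine_quantile (R : realType) (H : R -> R) (p x : R) : 0 <= x -> p <= H x ->
  (fine (quantile H p))%:E = quantile H p.
Proof.
move=> x0 px; rewrite fineK// ge0_fin_numE ?quantile_nonneg//.
by apply: le_lt_trans (ltry x); apply: ereal_inf_lbound; exists x.
Qed.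

Lemma quantile_ge (R : realType) (H : R -> R) (p x : R) :
  0 <= x -> x < fine (quantile H p) -> H x < p.
Proof.
move=> x0; apply: contraTT; rewrite -!leNgt => pH.
by rewrite -lee_fin (fine_quantile x0 pH); apply: ereal_inf_lbound; exists x.
Qed.

(** Continuity of the quantile function at p excludes a flat stretch of [H] at height p: for q
    slightly above p the quantile is still below x, so [H] has reached q before x. *)
Lemma quantile_lt (R : realType) (H : R -> R) (p x : R) : {homo H : y z / y <= z} ->
  0 <= p < 1 -> (exists2 z, 0 <= z & p <= H z) ->
  quantile H q @[q --> within `[0, 1] (nbhs p)] --> quantile H p ->
  fine (quantile H p) < x -> p < H x.
Proof.
move=> H_homo /andP[p0 p1] [z z0 pz] cv Qx.
have Qx' : (quantile H p < x%:E)%E by rewrite -(fine_quantile z0 pz) lte_fin.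
have : \forall q \near within `[0, 1] (nbhs p), (quantile H q < x%:E)%E.
  have op : nbhs (quantile H p) [set y | (y < x%:E)%E].
    exact: (open_nbhs_nbhs (conj (@open_ereal_lt_ereal R x%:E) Qx')).
  exact: cv _ op.
move=> [r /= r0 hr].
(* Capped at 1, as the continuity of the quantile is relative to the unit interval. *)
pose q := Num.min 1 (p + r / 2).
have pq : p < q by rewrite lt_min p1 ltrDl divr_gt0.
have /ereal_inf_lt [_ [y [y0 qy] <-]] : (quantile H q < x%:E)%E.
  apply: hr; rewrite /=.
    rewrite ltr0_norm ?subr_lt0// opprB ltrBlDl gt_min; apply/orP; right.
    by rewrite ltrD2l; lra.
  by rewrite in_itv/= (le_trans p0 (ltW pq)) ge_min lexx.
rewrite lte_fin => yx; apply: lt_le_trans pq (le_trans qy _).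
by apply: H_homo; exact: ltW.
Qed.

(** * Bounds on the miss probability for a fixed number of items *)

Section miss_bounds.
Context {R : realType} {d : measure_display} {Omega : measurableType d}.
Variables (P : probability Omega R) (theta : R -> Omega -> Omega) (N : nat).
Variables (Phi : 'I_N -> R.-ker Omega ~> R) (lam : 'I_N -> R).
Variables (F0 muF : probability R R) (eta : R -> R).
Variables (k : nat) (rule : ('I_N -> R) -> {set 'I_N}).
Hypothesis N_gt0 : (0 < N)%N.
Hypothesis flow : preserving_flow P theta.
Hypothesis lam_gt0 : forall i, 0 < lam i.
Hypothesis intensityE : forall i, intensity P (Phi i) = (lam i)%:E.
Hypothesis renewal : forall i,
  stationary_renewal P theta (Phi i) (fun t => distr_fun F0 (lam i * t)).
Hypothesis indep : independent_processes P Phi.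
Hypothesis F0_atomless : forall x, F0 [set x] = 0%E.
Hypothesis F0_supp : F0 `[0, +oo[%classic = 1%E.
Hypothesis muFE : forall A, measurable A -> muF A = age_law F0 A.
Hypothesis measurable_eta : measurable_fun [set: R] eta.
Hypothesis eta_ge0 : forall t, 0 <= eta t.
Hypothesis sel : selects_largest k rule.

Let G := hazard_distr (age_law F0) eta.
Let G0 := hazard_distr F0 eta.
Let miss := miss_probability P theta Phi (optimal_policy eta lam Phi rule).
Let ratio x := average lam predT (fun l => l * G0 (x / l)) / average lam predT id.

Let palm_laws : exists Q : 'I_N -> probability Omega R,
  forall i A, measurable A -> Q i A = palm P theta (Phi i) A.
Proof.
suff /choice[Q QE] : forall i : 'I_N, exists Q : probability Omega R,
    forall A, measurable A -> Q A = palm P theta (Phi i) A by exists Q.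
move=> i; have [pp _ _ _ _] := renewal i.
exact: palm_probability flow pp (lam_gt0 i) (intensityE i).
Qed.

Let ratioE x : ratio x = \sum_(i < N) lam i / (\sum_(i < N) lam i) * G0 (x / lam i).
Proof.
rewrite /ratio /average invfM invrK mulrACA mulVf ?pnatr_eq0 -?lt0n// mul1r mulr_suml.
by apply: eq_bigr => i _; rewrite mulrAC.
Qed.

Let weights1 : \sum_(i < N) lam i / (\sum_(i < N) lam i) = 1.
Proof. by rewrite -mulr_suml divff// gt_eqF// sum_intensity_gt0. Qed.

Let weight_ge0 i : 0 <= lam i / (\sum_(i < N) lam i).
Proof. by rewrite divr_ge0 ?ltW// sum_intensity_gt0. Qed.

Let ratio_shift x c : ratio x + c =
  \sum_(i < N) lam i / (\sum_(i < N) lam i) * (G0 (x / lam i) + c).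
Proof.
under [RHS]eq_bigr do rewrite mulrDr.
by rewrite big_split/= -ratioE -mulr_suml weights1 mul1r.
Qed.

Lemma miss_upper (x t : R) : 0 < t ->
  \sum_(j < N) (1 - G (x / lam j)) + t <= k%:R -> miss <= ratio x + N%:R / t ^+ 2.
Proof.
move=> t0 ht; have [Q QE] := palm_laws.
apply: le_trans (miss_le flow lam_gt0 intensityE renewal indep QE measurable_eta sel x N_gt0) _.
rewrite ratio_shift; apply: ler_sum => i _; rewrite ler_wpM2l// lerD//.
  by rewrite (palm_intensity_law flow (lam_gt0 i) (renewal i) (QE i)).
rewrite -lee_fin fineK ?fin_num_measure//; last first.
  by apply: measurable_superlevel; exact: (measurable_nexceeds renewal).
exact: (palm_nexceeds_gt flow lam_gt0 intensityE renewal indep QE F0_atomless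
  F0_supp muFE measurable_eta eta_ge0 i t0 ht).
Qed.

Lemma miss_lower (x t : R) : 0 < t ->
  k%:R + 1 + t <= \sum_(j < N) (1 - G (x / lam j)) -> ratio x - N%:R / t ^+ 2 <= miss.
Proof.
move=> t0 ht; have [Q QE] := palm_laws.
apply: le_trans (miss_ge flow lam_gt0 intensityE renewal indep QE measurable_eta sel x N_gt0).
rewrite ratio_shift; apply: ler_sum => i _; rewrite ler_wpM2l// lerB//.
  by rewrite (palm_intensity_law flow (lam_gt0 i) (renewal i) (QE i)).
rewrite -lee_fin fineK ?fin_num_measure//; last first.
  by apply: measurable_strict_sublevel; exact: (measurable_nexceeds renewal).
exact: (palm_nexceeds_lt flow lam_gt0 intensityE renewal indep QE F0_atomless
  F0_supp muFE measurable_eta eta_ge0 i t0 ht).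
Qed.

Lemma miss_nonneg : 0 <= miss.
Proof.
have [Q QE] := palm_laws.
exact: (miss_ge0 flow lam_gt0 intensityE renewal QE).
Qed.

End miss_bounds.

Lemma sum_complement (R : realType) N (lam : 'I_N -> R) (f : R -> R) : (0 < N)%N ->
  \sum_(j < N) (1 - f (lam j)) = N%:R * (1 - average lam predT f).
Proof.
move=> N0; rewrite sumrB sumr_const card_ord mulrBr mulr1; congr (_ - _).
by rewrite /average mulrA divff ?mul1r// pnatr_eq0 -lt0n.
Qed.

Lemma near_inv_small (R : realType) (e : R) : 0 < e ->
  \forall N \near \oo, (N%:R : R)^-1 <= e.
Proof.
move=> e0; exists (Num.truncn e^-1).+1 => // N /= hN.
rewrite -[leRHS]invrK lef_pV2 ?posrE ?invr_gt0//; last first.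
  by rewrite ltr0n; apply: leq_trans hN.
by apply/ltW; apply: lt_le_trans (truncnS_gt _) _; rewrite ler_nat.
Qed.

Lemma near_chebyshev_small (R : realType) (s e : R) : 0 < s -> 0 < e ->
  \forall N \near \oo, (N%:R : R) / (s * N%:R) ^+ 2 <= e.
Proof.
move=> s0 e0; have h := near_inv_small (mulr_gt0 (exprn_gt0 2 s0) e0).
apply: filterS2 h (nbhs_infty_gt 0) => N hN N0.
have N0' : 0 < N%:R :> R by rewrite ltr0n.
have -> : N%:R / (s * N%:R) ^+ 2 = N%:R^-1 / s ^+ 2 by field; rewrite !gt_eqF.
by rewrite ler_pdivrMr ?exprn_gt0// mulrC.
Qed.

Unset Implicit Arguments.
Theorem corollary2 (R : realType) (d : measure_display) (Omega : measurableType d)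
  (P : probability Omega R) (theta : R -> Omega -> Omega)
  (F0 : probability R R) (f0 : R -> R)
  (lam : forall N : nat, 'I_N -> R)
  (Phi : forall N : nat, 'I_N -> R.-ker Omega ~> R)
  (C : nat -> nat)
  (rule : forall N : nat, ('I_N -> R) -> {set 'I_N})
  (L : probability R R) (c : R)
  (eta := hazard_rate F0 f0)
  (G := hazard_distr (age_law F0) eta)
  (G0 := hazard_distr F0 eta)
  (Qoo := quantile (mixture_distr G L))
  (thetastar := fine (Qoo (1 - c)))
  (X := fun (N : nat) (i : 'I_N) (w : Omega) =>
          stoch_intensity eta (lam N i) (Phi N i w) 0) :
  preserving_flow P theta ->
  F0 `[0, +oo[%classic = 1%E ->
  is_density F0 f0 ->
  (\int[F0]_x x%:E)%E = 1%E ->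
  (forall N : nat, (1 < N)%N -> (1 <= C N < N)%N) ->
  (forall (N : nat) (i : 'I_N), 0 < lam N i) ->
  (forall (N : nat) (i j : 'I_N), (i <= j)%N -> lam N j <= lam N i) ->
  (forall (N : nat) (i : 'I_N),
     stationary_renewal P theta (Phi N i) (fun t => distr_fun F0 (lam N i * t))) ->
  (forall (N : nat) (i : 'I_N), intensity P (Phi N i) = (lam N i)%:E) ->
  (forall N : nat, independent_processes P (Phi N)) ->
  (forall N : nat, (1 < N)%N -> selects_largest (C N) (rule N)) ->
  weakly_converges (fun N => empirical_distr (lam N)) L ->
  L [set 0] = 0%E ->
  (forall (N : nat) (i j : 'I_N), i != j ->
     palm P theta (superpose (Phi N)) [set w | X N i w = X N j w] = 0%E) ->
  unif_integrable lam ->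
  0 < c <= 1 ->
  Qoo p @[p --> within `[0, 1] (nbhs (1 - c))] --> Qoo (1 - c) ->
  ~ [set l * x | l in discontinuities (distr_fun L) & x in discontinuities G0]
      thetastar ->
  (C N)%:R / N%:R @[N --> \oo] --> c ->
  miss_probability P theta (Phi N)
    (optimal_policy eta (lam N) (Phi N) (rule N)) @[N --> \oo] -->
  (\int[L]_(l in `]0, +oo[) (l * G0 (thetastar / l))) /
  (\int[L]_(l in `]0, +oo[) l).
Proof.
move=> flow F0_supp density F0_mean C_bounds lam_gt0 _ renewal intensityE indep sel.
move=> lam_cvg L0 _ lam_ui /andP[c0 c1] Q_cvg thetaN C_cvg.
have atomless := density_atomless density.
have meta : measurable_fun [set: R] eta := measurable_hazard density.
have eta_ge0 : forall t, 0 <= eta t := hazard_ge0 density.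
have [muF muFE] := age_probability F0_supp atomless F0_mean.
have [muG muGE] := hazard_distrE muF meta eta_ge0.
have [mu0 G0E] := hazard_distrE F0 meta eta_ge0.
have GE : G = distr_fun muG by rewrite -muGE /G; apply: eq_hazard_distr => // A /muFE.
have G00 : G0 0 = 0 := hazard_distr0 density F0_supp.
rewrite -/G0 in G0E.
pose H := mixture_distr (distr_fun muG) L.
have QooE : Qoo = quantile H by rewrite /Qoo GE.
have theta_ge0 : 0 <= thetastar by rewrite fine_ge0// quantile_nonneg.
have H_homo : {homo H : x y / x <= y} := mixture_homo lam_gt0 lam_cvg lam_ui muG.
have below (x : R) : 0 <= x -> x < thetastar -> H x < 1 - c.
  by rewrite /thetastar QooE; exact: quantile_ge.
have above (x : R) : thetastar < x -> 1 - c < H x.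
  move: Q_cvg; rewrite /thetastar QooE => Q_cvg; apply: quantile_lt => //.
    by apply/andP; split; lra.
  have [z z0 /ltW hz] := mixture_tail lam_gt0 lam_cvg L0 muG c0.
  by exists z.
have avg N x : average (lam N) predT (fun l => G (x / l)) =
    average (lam N) predT (fun l => distr_fun muG (x / l)) by rewrite GE.
set mean := \int[L]_(l in _) l.
have mean_gt0 : 0 < mean := limit_mean_gt0 lam_gt0 lam_cvg L0 lam_ui.
have mean_fin := limit_mean_fin lam_gt0 lam_cvg lam_ui.
pose I x := fine (weighted_integral L id (distr_fun mu0) x).
have -> : \int[L]_(l in `]0, +oo[) (l * G0 (thetastar / l)) = I thetastar.
  by rewrite /I -G0E.
pose M N := miss_probability P theta (Phi N) (optimal_policy eta (lam N) (Phi N) (rule N)).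
have upper (e : R) : 0 < e -> \forall N \near \oo, M N <= I thetastar / mean + e.
  move=> e0.
  (* One third each for the change of level from [thetastar] to [y0], the limit of the ratio and the
     Chebyshev error. *)
  have e3 : 0 < e / 3 by lra.
  have [y0 ty0 Iy0] := weighted_integral_right (@measurable_id _ R setT)
    (fun l => @ltW _ _ 0 l) mean_fin mu0 thetastar (mulr_gt0 mean_gt0 e3).
  (* The policy is tested at the middle level x; the average of [G] there is compared with [H y]
     below it, and the ratio with [I y0] above it. *)
  pose x := (thetastar + y0) / 2; pose y := (thetastar + x) / 2.
  have ty : thetastar < y by rewrite /y /x; lra.
  have yx : y < x by rewrite /y /x; lra.
  have xy0 : x < y0 by rewrite /x; lra.
  have ypos : 0 < y by exact: le_lt_trans ty.
  (* The gap pays three times: for the limit of the average of [G], for that of [C N / N], and for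
     the deviation [s * N] in Chebyshev's inequality. *)
  pose s := (H y - (1 - c)) / 3.
  have s0 : 0 < s by rewrite /s; have := above _ ty; lra.
  have cs : c - s < c by lra.
  near=> N.
  have N1 : (1 < N)%N by near: N; exact: nbhs_infty_gt.
  have N0 : (0 < N)%N by exact: ltnW.
  have N0' : 0 < N%:R :> R by rewrite ltr0n.
  have hr : average (lam N) predT (fun l => l * distr_fun mu0 (x / l)) /
      average (lam N) predT id <= I y0 / mean + e / 3.
    by near: N; apply: limsup_ratio => //; exact: lt_trans yx.
  have hG : H y - s <= average (lam N) predT (fun l => distr_fun muG (x / l)).
    by near: N; exact: liminf_mixture.
  have hC : c - s <= (C N)%:R / N%:R by near: N; exact: cvgr_ge C_cvg _ cs.
  have ht : (N%:R : R) / (s * N%:R) ^+ 2 <= e / 3.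
    by near: N; exact: near_chebyshev_small.
  have hI : I y0 / mean <= I thetastar / mean + e / 3.
    by rewrite -lerBlDl -mulrBl ler_pdivrMr// mulrC lerBlDl.
  have st : 0 < s * N%:R by rewrite mulr_gt0.
  have := @miss_upper _ _ _ _ _ _ _ _ _ _ _ _ _ N0 flow (lam_gt0 N) (intensityE N) (renewal N)
    (indep N) atomless F0_supp muFE meta eta_ge0 (sel N N1) x _ st.
  rewrite -/G -/G0 G0E (sum_complement _ (fun l => G (x / l)) N0) avg => hM.
  apply: le_trans (hM _) _; last by lra.
  move: hC; rewrite ler_pdivlMr// => hC.
  apply: le_trans hC; rewrite mulrC -mulrDl ler_pM2r//.
  by rewrite /s in hG *; lra.
have lower (e : R) : 0 < e -> \forall N \near \oo, I thetastar / mean - e <= M N.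
  move=> e0.
  (* At 0 there is no positive level below [thetastar]; the limit is then 0 because [G_0] vanishes
     at 0, and the miss probability is nonnegative. *)
  have [theta0|theta_gt0] := eqVneq thetastar 0.
    have -> : I thetastar = 0.
      rewrite /I /weighted_integral theta0 integral0_eq// => l _.
      by rewrite mul0r -G0E G00 mulr0.
    near=> N; apply: le_trans (_ : 0 <= _); first by rewrite mul0r sub0r oppr_le0 ltW.
    apply: (@miss_nonneg _ _ _ _ _ _ _ _ _ _ _ _ flow (lam_gt0 N) (intensityE N) (renewal N)).
    by near: N; exact: nbhs_infty_gt.
  rewrite neq_lt ltNge theta_ge0/= in theta_gt0.
  have e3 : 0 < e / 3 by lra.
  rewrite G0E in thetaN.
  have [y0 /andP[y00 y0t] Iy0] := weighted_integral_left (@measurable_id _ R setT)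
    (fun l => @ltW _ _ 0 l) mean_fin theta_gt0 (mulr_gt0 mean_gt0 e3) thetaN.
  pose x := (thetastar + y0) / 2; pose y := (thetastar + x) / 2.
  have yt : y < thetastar by rewrite /y /x; lra.
  have xy : x < y by rewrite /y /x; lra.
  have y0x : y0 < x by rewrite /x; lra.
  have x0 : 0 < x by exact: lt_trans y0x.
  have ypos : 0 < y by exact: lt_trans xy.
  (* A fourth share is needed here: it covers the single item left out of the count, through
     [1 <= s * N]. *)
  pose s := (1 - c - H y) / 4.
  have s0 : 0 < s by rewrite /s; have := below _ (ltW ypos) yt; lra.
  have cs : c < c + s by lra.
  near=> N.
  have N1 : (1 < N)%N by near: N; exact: nbhs_infty_gt.
  have N0 : (0 < N)%N by exact: ltnW.
  have N0' : 0 < N%:R :> R by rewrite ltr0n.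
  have hr : I y0 / mean - e / 3 <= average (lam N) predT (fun l => l * distr_fun mu0 (x / l)) /
      average (lam N) predT id.
    by near: N; apply: liminf_ratio.
  have hG : average (lam N) predT (fun l => distr_fun muG (x / l)) <= H y + s.
    by near: N; exact: limsup_mixture.
  have hC : (C N)%:R / N%:R <= c + s by near: N; exact: cvgr_le C_cvg _ cs.
  have h1 : (N%:R : R)^-1 <= s by near: N; exact: near_inv_small.
  have ht : (N%:R : R) / (s * N%:R) ^+ 2 <= e / 3.
    by near: N; exact: near_chebyshev_small.
  have hI : I thetastar / mean - e / 3 <= I y0 / mean.
    by rewrite lerBlDr -lerBlDl -mulrBl ler_pdivrMr// mulrC lerBlDl -lerBlDr.
  have st : 0 < s * N%:R by rewrite mulr_gt0.
  have := @miss_lower _ _ _ _ _ _ _ _ _ _ _ _ _ N0 flow (lam_gt0 N) (intensityE N) (renewal N)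
    (indep N) atomless F0_supp muFE meta eta_ge0 (sel N N1) x _ st.
  rewrite -/G -/G0 G0E (sum_complement _ (fun l => G (x / l)) N0) avg => hM.
  apply: le_trans (hM _); first by lra.
  move: hC; rewrite ler_pdivrMr// => hC.
  have h1' : 1 <= s * N%:R by rewrite -ler_pdivrMr// div1r.
  apply: le_trans (_ : (c + s) * N%:R + s * N%:R + s * N%:R <= _).
    by rewrite !lerD.
  rewrite -!mulrDl [leRHS]mulrC ler_pM2r//.
  by rewrite /s in hG *; lra.
apply/cvgrPdist_le => e e0.
apply: filterS2 (lower e e0) (upper e e0) => N h1 h2.
by rewrite distrC ler_distl; apply/andP.
Unshelve. all: by end_near.
Qed.
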